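(* Let $K\subset(0,\infty)$ be nonempty and compact with $K=\overline{\operatorname{int}(K)}$. Let $\psi:[0,\infty)\to\mathbb R$ be twice continuously differentiable (with one-sided derivatives at $0$) and $\sup_{x\ge0}|\psi''(x)|<\infty$. For $n\ge2$ and a POVM $D$ on $\mathcal H^{\otimes n}$ with outcomes in $\mathbb R$, put $$R_{z,N}^\psi(D):=\int_{\mathbb R}\{x-\psi(N)\}^2\operatorname{Tr}[\rho_{z,N}^{\otimes n}D(dx)],\qquad R_{n,\psi}^{\mathrm{all}}(K):=\inf_D\sup_{z\in\mathbb C,\,N\in K}R_{z,N}^\psi(D),$$ the infimum being over all such POVMs. Then, as $n\to\infty$, $$R_{n,\psi}^{\mathrm{all}}(K)=\frac1{n-1}\sup_{N\in K}\{\psi'(N)\}^2N(N+1)+o(n^{-1}).$$ Moreover, total residual photon-number measurement, with outcome $S$, followed by the plug-in estimator $\widehat\psi_n=\psi\bigl(S/(n-1)\bigr)$ is asymptotically minimax on $K$, i.e. its worst-case risk over $z\in\mathbb C$, $N\in K$ equals $R_{n,\psi}^{\mathrm{all}}(K)+o(n^{-1})$.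
   Context: $\mathcal H=L^2(\mathbb R)$ with number (Hermite) basis $\{|k\rangle\}_{k\ge0}$, annihilation operator $a$ ($a|k\rangle=\sqrt k|k-1\rangle$), displacement operators $D(z)=\exp(za^\dagger-\bar za)$, $z\in\mathbb C$. The thermal state is $\phi_N=\frac1{N+1}\sum_{k\ge0}\bigl(\frac N{N+1}\bigr)^k|k\rangle\langle k|$ for $N>0$, and $\rho_{z,N}=D(z)\phi_ND(z)^\dagger$. A POVM with outcomes in $\mathbb R$ is a map from Borel sets to positive bounded operators, countably additive in the weak operator topology, with total mass $I$. **Total residual photon-number measurement.** $U_n$ is a fixed passive (total-photon-number preserving) unitary on $\mathcal H^{\otimes n}$ with $U_n\rho_{z,N}^{\otimes n}U_n^\dagger=\rho_{\sqrt n\,z,N}\otimes\phi_N^{\otimes(n-1)}$ and $U_nD(w)^{\otimes n}U_n^\dagger=D(\sqrt n\,w)\otimes I^{\otimes(n-1)}$ for all $z,w\in\mathbb C$, $N>0$ (such a unitary exists). $\Pi_s^{(m)}$ is the projection on $\mathcal H^{\otimes m}$ onto the closed span of $|k_1\rangle\otimes\dots\otimes|k_m\rangle$ with $k_1+\dots+k_m=s$. The measurement is $M_n^\star(\{s\})=U_n^\dagger(I\otimes\Pi_s^{(n-1)})U_n$, $s\in\mathbb N_0$; its outcome $S$ has, independently of $z$, the law $p_N^{(n-1)}$, where $p_N^{(m)}(s)=\binom{s+m-1}{m-1}(N+1)^{-m}(N/(N+1))^s$. Measuring $M_n^\star$ and then applying $t:\mathbb N_0\to\mathbb R$ is the POVM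 $B\mapsto\sum_s\mathbf 1\{t(s)\in B\}M_n^\star(\{s\})$. *)

(* Defs.v *)
From HB Require Import structures.
From mathcomp Require Import all_boot all_order all_algebra.
From mathcomp Require Import complex ring.
From mathcomp Require Import all_classical all_reals all_analysis.

Set Implicit Arguments.
Unset Strict Implicit.
Unset Printing Implicit Defensive.

Import Order.TTheory GRing.Theory Num.Theory.
Import numFieldNormedType.Exports.

Local Open Scope classical_set_scope.
Local Open Scope ring_scope.
Local Open Scope complex_scope.

Section Sums.
Context {R : realType} {I : choiceType}.

(* Unordered sums, meaningful for absolutely summable families. *)
Definition rsum (f : I -> R) : R :=
  fine (\esum_(i in setT) ((EFin \o f)^\+ i) -
        \esum_(i in setT) ((EFin \o f)^\- i))%E.

Definition csum (f : I -> R[i]) : R[i] :=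
  rsum (fun i => complex.Re (f i)) +i* rsum (fun i => complex.Im (f i)).

End Sums.

Section EllTwo.
Context {R : realType}.

Definition sqmod (c : R[i]) : R := complex.Re c ^+ 2 + complex.Im c ^+ 2.

Lemma sqmod_ge0 (c : R[i]) : 0 <= sqmod c.
Proof. by rewrite addr_ge0 ?sqr_ge0. Qed.

Lemma sqmodD (c d : R[i]) : sqmod (c + d) <= 2 * sqmod c + 2 * sqmod d.
Proof.
case: c d => [a b] [a' b']; rewrite /sqmod /= -subr_ge0.
rewrite [X in 0 <= X](_ : _ = (a - a') ^+ 2 + (b - b') ^+ 2); last by ring.
by rewrite addr_ge0 ?sqr_ge0.
Qed.

Lemma sqmodM (c d : R[i]) : sqmod (c * d) = sqmod c * sqmod d.
Proof. by case: c d => [a b] [a' b']; rewrite /sqmod /=; ring. Qed.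

Context {I : choiceType}.

Definition sq_summable (f : I -> R[i]^o) : Prop :=
  (\esum_(i in setT) (sqmod (f i))%:E < +oo)%E.

Lemma esumZ_le (a : R) (f : I -> \bar R) :
  0 <= a -> (forall i, 0 <= f i)%E ->
  (\esum_(i in setT) (a%:E * f i) <= a%:E * \esum_(i in setT) f i)%E.
Proof.
move=> a0 f0; apply: ge_ereal_sup => _ [A [finA _] <-].
rewrite -ge0_mule_fsumr//; apply: lee_wpmul2l; first by rewrite lee_fin.
by apply: ereal_sup_ubound; exists A.
Qed.

Definition l2_pred : {pred (I -> R[i]^o)} := fun f => `[< sq_summable f >].

Lemma l2_submod_closed : submod_closed l2_pred.
Proof.
split.
  apply/asboolP; rewrite /sq_summable esum1 // => i _.
  by rewrite /sqmod /= expr0n /= addr0.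
move=> c u v /asboolP su /asboolP sv; apply/asboolP; rewrite /sq_summable.
have le2 i : ((sqmod ((c *: u + v) i))%:E <=
    (2 * sqmod c)%:E * (sqmod (u i))%:E + 2%:E * (sqmod (v i))%:E)%E.
  rewrite -!EFinM -EFinD lee_fin (le_trans (sqmodD _ _))//.
  by rewrite [_ i]/(c * u i) sqmodM mulrA.
have ge0M (a : R) (w : I -> R[i]^o) i : 0 <= a ->
    (0 <= a%:E * (sqmod (w i))%:E)%E.
  by move=> a0; rewrite -EFinM lee_fin mulr_ge0 ?sqmod_ge0.
have c0 : 0 <= 2 * sqmod c by rewrite mulr_ge0 ?sqmod_ge0.
apply: le_lt_trans; first by apply: le_esum => i _; exact: le2.
rewrite esumD; try by move=> i _; apply: ge0M.
apply: lte_add_pinfty; apply: le_lt_trans.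
- by apply: esumZ_le => // i; rewrite lee_fin sqmod_ge0.
- by rewrite lte_mul_pinfty// lee_fin.
- by apply: esumZ_le => // i; rewrite lee_fin sqmod_ge0.
- by rewrite lte_mul_pinfty// lee_fin.
Qed.
HB.instance Definition _ :=
  GRing.isSubmodClosed.Build R[i] (I -> R[i]^o) l2_pred l2_submod_closed.

End EllTwo.

Record l2 (R : realType) (I : choiceType) : Type := L2 {
  l2_val :> I -> R[i]^o ;
  l2_valP : l2_val \in l2_pred }.

HB.instance Definition _ R I := [isSub for @l2_val R I].
HB.instance Definition _ R I := [Choice of l2 R I by <:].
HB.instance Definition _ R I := [SubChoice_isSubLmodule of l2 R I by <:].

Definition op (R : realType) (I : choiceType) : Type := l2 R I -> l2 R I.

Section Operators.
Context {R : realType} {I : choiceType}.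
Implicit Types (u v : l2 R I) (T : op R I).

(* The vector with coordinates f, for square-summable f (otherwise 0). *)
Definition mkl2 (f : I -> R[i]^o) : l2 R I := insubd 0 f.

Lemma mkl2E (f : I -> R[i]^o) : sq_summable f -> mkl2 f =1 f.
Proof. by move=> sf i; rewrite /mkl2 (@insubdK _ _ (l2 R I))//; exact/asboolP. Qed.

Definition ket (i : I) : l2 R I := mkl2 (fun j => (j == i)%:R).

Lemma ketE i j : ket i j = (j == i)%:R.
Proof.
apply: mkl2E; rewrite /sq_summable.
rewrite (_ : (fun k => _) = (fun k => if k \in [set i] then 1 else 0)%E).
  by rewrite -esum_mkcond esum_set1// ltry.
apply/funext => k; rewrite /sqmod; have [->|ki] := eqVneq k i.
  by rewrite mem_set//= expr1n expr0n addr0.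
by rewrite memNset /= ?expr0n ?addr0//; exact/eqP.
Qed.

Definition inner u v : R[i] := csum (fun i => (u i)^* * v i).

Definition l2norm v : R := Num.sqrt (complex.Re (inner v v)).

Definition bounded_op T : Prop :=
  linear T /\ exists c : R, forall v, l2norm (T v) <= c * l2norm v.

Definition positive_op T : Prop := forall v, 0 <= inner v (T v).

(* A bounded operator is determined by its matrix in the basis ket. *)
Definition mxop (A : I -> I -> R[i]) : op R I :=
  fun v => mkl2 (fun i => csum (fun j => A i j * v j)).

Definition diagop (w : I -> R[i]) : op R I :=
  fun v => mkl2 (fun i => w i * v i).

(* <i|T^dagger v> = <T i|v> *)
Definition adj T : op R I := fun v => mkl2 (fun i => inner (T (ket i)) v).

Definition entry T (i j : I) : R[i] := inner (ket i) (T (ket j)).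

Definition tr T : R[i] := csum (fun i => entry T i i).

Definition unitary T : Prop :=
  [/\ bounded_op T, adj T \o T =1 idfun & T \o adj T =1 idfun].

(* Sum of a sequence of operators in the weak operator topology. *)
Definition opsum (T : nat -> op R I) : op R I :=
  fun v => mkl2 (fun i => csum (fun s => T s v i)).

Definition povm (M : set R -> op R I) : Prop :=
  [/\ forall B, measurable B -> bounded_op (M B) /\ positive_op (M B),
      forall F : (set R)^nat, (forall k, measurable (F k)) -> trivIset setT F ->
        forall u v, (series (fun k => inner u (M (F k) v)) : nat -> R[i]^o) @ \oo
                      --> (inner u (M (\bigcup_k F k) v) : R[i]^o) &
      M setT =1 idfun].

End Operators.

(* H = L^2(R) is identified with l2 nat through the number basis, and its
   n-fold tensor power with l2 (n.-tuple nat) through the product basis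
   |k_1> (x) ... (x) |k_n>. *)
Notation mode1 R := (op R nat).
Notation modes R n := (op R (n.-tuple nat)).

Section Fock.
Context {R : realType}.
Implicit Types (z : R[i]) (N : R).

(* Coordinates of a f and a^dagger f, where a|k> = sqrt k |k-1>. *)
Definition annih (f : nat -> R[i]) (k : nat) : R[i] :=
  (Num.sqrt k.+1%:R)%:C * f k.+1.

Definition creat (f : nat -> R[i]) (k : nat) : R[i] :=
  (Num.sqrt k%:R)%:C * f k.-1.

Definition disp_gen z (f : nat -> R[i]) (k : nat) : R[i] :=
  z * creat f k - z^* * annih f k.

(* exp(z a^dagger - z^* a): on a number state the exponential series converges
   absolutely, and the resulting map extends to a unitary. *)
Definition disp z : mode1 R :=
  mxop (fun m k => csum (fun j =>
    j`!%:R^-1 * iter j (disp_gen z) (fun l => (l == k)%:R) m)).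

Definition thermal N : mode1 R :=
  diagop (fun k => ((N + 1)^-1 * (N / (N + 1)) ^+ k)%:C).

Definition rho z N : mode1 R := disp z \o thermal N \o adj (disp z).

Definition tpow n (T : mode1 R) : modes R n :=
  mxop (fun k l : n.-tuple nat => \prod_(i < n) entry T (tnth k i) (tnth l i)).
Arguments tpow : clear implicits.

(* A (x) B, with A on the first mode and B on the n - 1 others. *)
Definition tens n (A : mode1 R) (B : modes R n.-1) : modes R n :=
  mxop (fun k l : n.-tuple nat =>
    entry A (head 0%N k) (head 0%N l) *
    entry B [tuple of behead k] [tuple of behead l]).

(* Projection onto the closed span of the |k_1>...|k_n> with total s. *)
Definition proj_total n (s : nat) : modes R n :=
  diagop (fun k : n.-tuple nat => (sumn k == s)%:R).
Arguments proj_total : clear implicits.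

Definition residual_unitary n (U : modes R n) : Prop :=
  [/\ unitary U,
      forall s, U \o proj_total n s =1 proj_total n s \o U,
      forall z N, 0 < N ->
        U \o tpow n (rho z N) \o adj U =1
        tens (rho ((Num.sqrt n%:R)%:C * z) N) (tpow n.-1 (thermal N)) &
      forall z, U \o tpow n (disp z) \o adj U =1
        tens (disp ((Num.sqrt n%:R)%:C * z)) (tpow n.-1 idfun)].

Definition residual_meas n (U : modes R n) (s : nat) : modes R n :=
  adj U \o tens idfun (proj_total n.-1 s) \o U.

Definition postprocess n (E : nat -> modes R n) (t : nat -> R) :
    set R -> modes R n :=
  fun B => opsum (fun s v => (\1_B (t s) : R)%:C *: E s v).

(* Tr[rho^{(x) n} M(B)], which is real for a positive operator M(B). *)
Definition outcome_law n z N (M : set R -> modes R n) : set R -> \bar R :=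
  fun B => (complex.Re (tr (tpow n (rho z N) \o M B)))%:E.

Definition risk n (psi : R -> R) z N (M : set R -> modes R n) : \bar R :=
  \int[outcome_law z N M]_x ((x - psi N) ^+ 2)%:E.

Definition worst_risk n (psi : R -> R) (K : set R) (M : set R -> modes R n) :
    \bar R :=
  ereal_sup [set risk psi zN.1 zN.2 M | zN in [set zN : R[i] * R | K zN.2]].

Definition minimax_risk (psi : R -> R) (K : set R) (n : nat) : \bar R :=
  ereal_inf [set worst_risk psi K M | M in @povm R (n.-tuple nat)].

Definition plugin_meas (psi : R -> R) n (U : modes R n) : set R -> modes R n :=
  postprocess (residual_meas U) (fun s => psi (s%:R / n.-1%:R)).

End Fock.

Section Asymptotics.
Context {R : realType}.

(* f is differentiable at x with derivative l, as a function on [0, +oo[. *)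
Definition has_deriv_ge0 (f : R -> R) (x l : R) : Prop :=
  (f y - f x) / (y - x) @[y --> within [set y | 0 <= y] x^'] --> l.

(* a_n = b_n + o(1/n) *)
Definition eq_o_inv (a b : nat -> \bar R) : Prop :=
  exists2 e : R^nat, e =o_\oo (fun n : nat => n%:R^-1 : R) &
    \forall n \near \oo, a n = (b n + (e n)%:E)%E.

End Asymptotics.

(* Main.v *)
Require Import Defs.
From HB Require Import structures.
From mathcomp Require Import all_boot all_order all_algebra.
From mathcomp Require Import complex ring lra.
From mathcomp Require Import all_classical all_reals all_analysis.
From mathcomp Require Import measurable_realfun.
From mathcomp Require mpoly.
Set Implicit Arguments.
Unset Strict Implicit.
Unset Printing Implicit Defensive.

Import Order.TTheory GRing.Theory Num.Theory.
Import numFieldNormedType.Exports.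

Local Open Scope classical_set_scope.
Local Open Scope ring_scope.

Local Notation "x %:C" := (real_complex _ x).

(* Lower bound: at z = 0 the state is diagonal in the number basis, with product geometric
   weights, so a measurement amounts to a randomized estimator based on n independent geometric
   variables; by Jensen it may be replaced by its conditional mean.  Its expectation E(N) is
   within sqrt W of psi(N), where W is the worst risk, and the Chapman-Robbins inequality applied
   along n equal steps of a small interval [a, b] in K bounds |E(b) - E(a)| by about
   (b - a) sqrt (n W / (a (a + 1))).  Hence liminf n W >= a (a + 1) ((psi b - psi a) / (b - a))^2,
   and b -> a gives the bound at each interior point a.
   Upper bound: the residual photon number is a sum of n - 1 independent geometric variables
   whatever z is, and a second-order Taylor expansion with its second and fourth central moments
   gives the risk of the plug-in estimator.
   A passive unitary is needed for the first part: take the linear substitution of variables, in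
   the polynomial model of Fock space, given by a symmetric orthogonal matrix whose first row is
   constant.  It carries the generator of a common displacement of all modes to the generator of a
   sqrt n times larger displacement of the first mode alone. *)

(** * Absolutely summable families *)

Section RealSums.
Context {R : realType}.
Implicit Types I J : choiceType.

(** Why n steps: across a fixed interval the chi-square distance between n-fold product laws grows
    exponentially in n, which makes Chapman-Robbins useless. Steps of length (b - a) / n bring it
    down to about (b - a)^2 / (n a (a + 1)), and the n square roots add up to the right order. No
    derivative of the expectation and no prior on N is involved, and the bias, at most sqrt W at
    each end, is smaller than the main term by a factor of order sqrt n whatever W is. The value z =
    0 is allowed because the supremum over z can only be larger. Operators are matrices over a
    countable basis, and infinite sums are total functions with default values. So each
    rearrangement needs its own absolute summability, and boundedness has to be derived from matrix
    entries. For displacements the source is the majorant x^j / sqrt (j!); for the passive unitary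
    it is the finiteness of rows and columns. Its matrix V is an involution, so the substitution is
    one too; together with the symmetry of the Fischer pairing this yields a real symmetric matrix
    with square 1, hence a unitary. *)

Definition asum I (f : I -> R) : Prop :=
  (\esum_(i in setT) (`|f i|)%:E < +oo)%E.

Lemma asum_summable I (f : I -> R) : asum f -> summable setT (EFin \o f).
Proof. by []. Qed.

Lemma asum_le I (f g : I -> R) :
  (forall i, `|f i| <= g i) -> asum g -> asum f.
Proof.
move=> fg; apply: le_lt_trans; apply: le_esum => i _.
by rewrite lee_fin (le_trans (fg i))// ler_norm.
Qed.

Lemma eq_asum I (f g : I -> R) : f =1 g -> asum f -> asum g.
Proof. by move=> /funext ->. Qed.

Lemma asumD I (f g : I -> R) : asum f -> asum g -> asum (fun i => f i + g i).
Proof.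
move=> sf sg; exact: (summableD (asum_summable sf) (asum_summable sg)).
Qed.

Lemma asumN I (f : I -> R) : asum f -> asum (fun i => - f i).
Proof. by rewrite /asum => h; under eq_esum do rewrite normrN. Qed.

Lemma asumB I (f g : I -> R) : asum f -> asum g -> asum (fun i => f i - g i).
Proof. by move=> ? ?; apply: asumD => //; exact: asumN. Qed.

Lemma asumZ I (a : R) (f : I -> R) : asum f -> asum (fun i => a * f i).
Proof.
move=> sf; rewrite /asum.
have : (`|a|%:E * (\esum_(i in setT) (`|f i|)%:E) < +oo)%E.
  by rewrite lte_mul_pinfty// lee_fin.
apply: le_lt_trans; apply: le_trans (esumZ_le _ _) => //.
by apply: le_esum => i _; rewrite normrM EFinM.
Qed.

Lemma asum_abs I (f : I -> R) : asum f -> asum (fun i => `|f i|).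
Proof. by rewrite /asum => h; under eq_esum do rewrite normr_id. Qed.

Lemma asum_ge0E I (f : I -> R) : (forall i, 0 <= f i) ->
  asum f <-> (\esum_(i in setT) (f i)%:E < +oo)%E.
Proof.
move=> f0; rewrite /asum (_ : (fun i => (`|f i|)%:E) = EFin \o f)//.
by apply/funext => i /=; rewrite ger0_norm.
Qed.

Lemma rsum_diff I (g h : I -> R) : (forall i, 0 <= g i) -> (forall i, 0 <= h i) ->
  asum g -> asum h ->
  rsum (fun i => g i - h i) =
  fine (\esum_(i in setT) (g i)%:E) - fine (\esum_(i in setT) (h i)%:E).
Proof.
move=> g0 h0 sg sh; rewrite /rsum.
have -> : EFin \o (fun i => g i - h i) = ((EFin \o g) \- (EFin \o h))%E.
  by apply/funext => i.
rewrite esumB ?fineB//.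
all: try by move=> i _ /=; rewrite lee_fin.
all: rewrite ge0_fin_numE ?(asum_ge0E g0).1 ?(asum_ge0E h0).1//.
all: by apply: esum_ge0 => i _ /=; rewrite lee_fin.
Qed.

Lemma rsum_ge0 I (f : I -> R) : (forall i, 0 <= f i) -> asum f ->
  (rsum f)%:E = \esum_(i in setT) (f i)%:E.
Proof.
move=> f0 sf.
have -> : rsum f = rsum (fun i => f i - (fun=> 0) i).
  by congr rsum; apply/funext => i; rewrite subr0.
have s0 : asum (fun _ : I => 0 : R) by rewrite /asum esum1// => i; rewrite normr0.
rewrite rsum_diff// [in X in _ - X]esum1//= subr0 fineK//.
rewrite ge0_fin_numE ?(asum_ge0E f0).1//.
by apply: esum_ge0 => i _; rewrite lee_fin.
Qed.

Definition posp I (f : I -> R) i := Num.max (f i) 0.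
Definition negp I (f : I -> R) i := Num.max (- f i) 0.

Lemma posp_ge0 I (f : I -> R) i : 0 <= posp f i.
Proof. by rewrite le_max lexx orbT. Qed.
Lemma negp_ge0 I (f : I -> R) i : 0 <= negp f i.
Proof. by rewrite le_max lexx orbT. Qed.
Lemma posp_negp I (f : I -> R) i : f i = posp f i - negp f i.
Proof. by rewrite /posp /negp; case: (ltrP (f i) 0); case: (ltrP (- f i) 0); lra. Qed.
Lemma posp_le I (f : I -> R) i : `|posp f i| <= `|f i|.
Proof.
rewrite (ger0_norm (posp_ge0 _ _)) /posp ge_max normr_ge0 andbT; exact: ler_norm.
Qed.
Lemma negp_le I (f : I -> R) i : `|negp f i| <= `|f i|.
Proof.
by rewrite (ger0_norm (negp_ge0 _ _)) /negp ge_max normr_ge0 andbT -normrN ler_norm.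
Qed.
Lemma asum_posp I (f : I -> R) : asum f -> asum (posp f).
Proof. by move=> sf; apply: asum_le (asum_abs sf) => i; exact: posp_le. Qed.
Lemma asum_negp I (f : I -> R) : asum f -> asum (negp f).
Proof. by move=> sf; apply: asum_le (asum_abs sf) => i; exact: negp_le. Qed.

Lemma rsum_nn I (f : I -> R) : (forall i, 0 <= f i) -> asum f ->
  rsum f = fine (\esum_(i in setT) (f i)%:E).
Proof. by move=> f0 sf; rewrite -rsum_ge0. Qed.

(* Every identity between sums below is reduced to nonnegative families through this one. *)
Lemma rsumB_ge0 I (g h : I -> R) : (forall i, 0 <= g i) -> (forall i, 0 <= h i) ->
  asum g -> asum h -> rsum (fun i => g i - h i) = rsum g - rsum h.
Proof. by move=> *; rewrite rsum_diff// !rsum_nn. Qed.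

Lemma rsumD_ge0 I (g h : I -> R) : (forall i, 0 <= g i) -> (forall i, 0 <= h i) ->
  asum g -> asum h -> rsum (fun i => g i + h i) = rsum g + rsum h.
Proof.
move=> g0 h0 sg sh; apply: EFin_inj.
rewrite rsum_ge0 ?EFinD ?rsum_ge0//; last 2 first.
- by move=> i; rewrite addr_ge0.
- exact: asumD.
by rewrite -esumD => [|i _|i _]; rewrite ?lee_fin.
Qed.

Lemma rsum_pn I (f : I -> R) : asum f -> rsum f = rsum (posp f) - rsum (negp f).
Proof.
move=> sf; rewrite -rsumB_ge0; [|exact: posp_ge0|exact: negp_ge0|exact: asum_posp|exact: asum_negp].
by congr rsum; apply/funext => i; exact: posp_negp.
Qed.

Lemma rsumD I (f g : I -> R) : asum f -> asum g ->
  rsum (fun i => f i + g i) = rsum f + rsum g.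
Proof.
move=> sf sg; rewrite (rsum_pn sf) (rsum_pn sg).
transitivity (rsum (fun i => (posp f i + posp g i) - (negp f i + negp g i))).
  congr rsum; apply/funext => i; rewrite [in LHS](posp_negp f) [in LHS](posp_negp g); lra.
have [? ?] := (asum_posp sf, asum_posp sg).
have [? ?] := (asum_negp sf, asum_negp sg).
rewrite rsumB_ge0 ?rsumD_ge0//; try by [exact: posp_ge0|exact: negp_ge0|exact: asumD|
  move=> i; rewrite addr_ge0 ?posp_ge0 ?negp_ge0].
by lra.
Qed.

Lemma rsum0 I : rsum (fun _ : I => 0 : R) = 0.
Proof.
rewrite rsum_nn ?esum1//.
by rewrite /asum esum1// => i; rewrite normr0.
Qed.

Lemma asum0 I : asum (fun _ : I => 0 : R).
Proof. by rewrite /asum esum1// => i; rewrite normr0. Qed.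

Lemma rsumN I (f : I -> R) : asum f -> rsum (fun i => - f i) = - rsum f.
Proof.
move=> sf; apply/eqP; rewrite -subr_eq0 opprK -rsumD//; last exact: asumN.
by rewrite (_ : (fun i => _) = fun=> 0) ?rsum0//; apply/funext => i; rewrite addNr.
Qed.

Lemma rsumB I (f g : I -> R) : asum f -> asum g ->
  rsum (fun i => f i - g i) = rsum f - rsum g.
Proof. by move=> sf sg; rewrite rsumD ?rsumN//; exact: asumN. Qed.

Lemma rsum_pos I (f : I -> R) : (forall i, 0 <= f i) -> 0 <= rsum f.
Proof.
move=> f0; rewrite /rsum [in X in (_ - X)%E]esum1; last first.
  by move=> i _; rewrite funenegE /= -EFin_max max_r// oppr_le0.
by rewrite sube0 fine_ge0// esum_ge0.
Qed.

Lemma rsum_le I (f g : I -> R) : asum f -> asum g ->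
  (forall i, f i <= g i) -> rsum f <= rsum g.
Proof.
move=> sf sg fg; rewrite -subr_ge0 -rsumB//.
by apply: rsum_pos => i; rewrite subr_ge0.
Qed.

(** The inequality missing from [esumZ_le] is [esumZ_le] itself for the factor [a^-1]. *)
Lemma esumZ I (a : R) (f : I -> \bar R) : 0 <= a -> (forall i, 0 <= f i)%E ->
  (\esum_(i in setT) (a%:E * f i) = a%:E * \esum_(i in setT) f i)%E.
Proof.
rewrite le_eqVlt => /orP[/eqP <- f0|a0 f0].
  by rewrite mul0e esum1// => i _; rewrite mul0e.
apply/eqP; rewrite eq_le esumZ_le ?(ltW a0)//=.
rewrite -lee_pdivlMl//.
apply: le_trans (esumZ_le _ _); rewrite ?invr_ge0 ?(ltW a0)//.
  apply: le_esum => i _; rewrite muleA -EFinM mulVf ?gt_eqF// mul1e//.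
by move=> i; rewrite mule_ge0// lee_fin ltW.
Qed.

Lemma rsumZ_ge0 I (a : R) (f : I -> R) : 0 <= a -> (forall i, 0 <= f i) -> asum f ->
  rsum (fun i => a * f i) = a * rsum f.
Proof.
move=> a0 f0 sf; apply: EFin_inj.
rewrite EFinM !rsum_ge0//; last 2 first.
- by move=> i; rewrite mulr_ge0.
- exact: asumZ.
under eq_esum do rewrite EFinM.
by rewrite esumZ.
Qed.

Lemma rsumZ I (a : R) (f : I -> R) : asum f ->
  rsum (fun i => a * f i) = a * rsum f.
Proof.
move=> sf.
wlog a0 : a / 0 <= a.
  move=> h; have [a0|a0] := leP 0 a; first exact: h.
  rewrite -[in RHS](opprK a) mulNr -h; last by rewrite oppr_ge0 ltW.
  rewrite -rsumN; last exact: asumZ.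
  by congr rsum; apply/funext => i; rewrite mulNr opprK.
rewrite (rsum_pn sf) mulrBr -!rsumZ_ge0//;
  
  try by [exact: posp_ge0|exact: negp_ge0|exact: asum_posp|exact: asum_negp].
rewrite -rsumB; try by apply: asumZ; [exact: asum_posp || exact: asum_negp].
by congr rsum; apply/funext => i; rewrite -mulrBr -posp_negp.
Qed.

Lemma rsumZr I (a : R) (f : I -> R) : asum f ->
  rsum (fun i => f i * a) = rsum f * a.
Proof.
by move=> sf; rewrite [RHS]mulrC -rsumZ//; congr rsum; apply/funext => i; rewrite mulrC.
Qed.

Lemma ler_rsum_norm I (f : I -> R) : asum f -> `|rsum f| <= rsum (fun i => `|f i|).
Proof.
move=> sf; rewrite ler_norml -rsumN; last exact: asum_abs.
have sa := asum_abs sf.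
apply/andP; split; apply: rsum_le => //.
- exact: asumN.
- by move=> i; rewrite lerNl -normrN ler_norm.
- by move=> i; rewrite ler_norm.
Qed.

Lemma esum_pair I J (f : I * J -> \bar R) : (forall p, 0 <= f p)%E ->
  \esum_(p in setT) f p = \esum_(i in setT) \esum_(j in setT) f (i, j).
Proof.
move=> f0; rewrite (esum_esum (a := fun i j => f (i, j)))//.
rewrite (_ : setT `*`` _ = setT); first by apply: eq_esum => -[].
by apply/seteqP; split.
Qed.

Lemma asum_pairP I J (f : I * J -> R) :
  (\esum_(i in setT) \esum_(j in setT) (`|f (i, j)|)%:E < +oo)%E -> asum f.
Proof. by rewrite /asum esum_pair// => p; rewrite lee_fin. Qed.

Lemma asum_slice I J (f : I * J -> R) i : asum f -> asum (fun j => f (i, j)).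
Proof.
rewrite /asum esum_pair; last by move=> p; rewrite lee_fin.
apply: le_lt_trans; rewrite [leRHS](esumID [set i])//; last first.
  by move=> ? _; exact: esum_ge0.
by rewrite setTI esum_set1 ?leeDl//; apply: esum_ge0 => *; rewrite ?lee_fin ?esum_ge0.
Qed.

Lemma rsum_pair_ge0 I J (f : I * J -> R) : (forall p, 0 <= f p) -> asum f ->
  asum (fun i => rsum (fun j => f (i, j))) /\
  rsum f = rsum (fun i => rsum (fun j => f (i, j))).
Proof.
move=> f0 sf.
have e : \esum_(i in setT) (rsum (fun j => f (i, j)))%:E = \esum_(p in setT) (f p)%:E.
  rewrite esum_pair; last by move=> p; rewrite lee_fin.
  by apply: eq_esum => i _; rewrite rsum_ge0//; exact: asum_slice.
have s : asum (fun i => rsum (fun j => f (i, j))).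
  apply/asum_ge0E; first by move=> i; apply: rsum_pos.
  by rewrite e; exact: (asum_ge0E f0).1.
split=> //; apply: EFin_inj; rewrite !rsum_ge0//.
by move=> i; apply: rsum_pos.
Qed.

Lemma asum_rsum I J (f : I * J -> R) : asum f ->
  asum (fun i => rsum (fun j => f (i, j))).
Proof.
move=> sf; have [s _] := rsum_pair_ge0 (fun p => normr_ge0 (f p)) (asum_abs sf).
by apply: asum_le s => i; apply: ler_rsum_norm; exact: asum_slice.
Qed.

Lemma rsum_pair I J (f : I * J -> R) : asum f ->
  rsum f = rsum (fun i => rsum (fun j => f (i, j))).
Proof.
move=> sf; rewrite (rsum_pn sf).
have [sp ->] := rsum_pair_ge0 (posp_ge0 f) (asum_posp sf).
have [sn ->] := rsum_pair_ge0 (negp_ge0 f) (asum_negp sf).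
rewrite -rsumB//; congr rsum; apply/funext => i.
rewrite [RHS]rsum_pn//; exact: asum_slice.
Qed.

Lemma set_bij_setT I J (e : I -> J) : bijective e -> set_bij setT setT e.
Proof.
move=> [g eg ge]; split=> //.
- by move=> x y _ _ /(congr1 g); rewrite !eg.
- by move=> y _; exists (g y).
Qed.

Lemma esum_bij I J (e : I -> J) (f : J -> \bar R) : bijective e ->
  \esum_(j in setT) f j = \esum_(i in setT) f (e i).
Proof. by move=> /set_bij_setT; exact: reindex_esum. Qed.

Lemma asum_bij I J (e : I -> J) (f : J -> R) : bijective e ->
  asum f <-> asum (f \o e).
Proof. by move=> be; rewrite /asum (esum_bij _ be). Qed.

Lemma rsum_bij I J (e : I -> J) (f : J -> R) : bijective e ->
  rsum f = rsum (f \o e).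
Proof.
move=> be; rewrite /rsum (esum_bij _ be) [X in (_ - X)%E](esum_bij _ be).
by congr (fine (_ - _)); apply: eq_esum => i _; rewrite ?funeposE ?funenegE.
Qed.

Lemma rsum_swap I J (f : I -> J -> R) : asum (fun p => f p.1 p.2) ->
  rsum (fun i => rsum (f i)) = rsum (fun j => rsum (fun i => f i j)).
Proof.
move=> sf.
have be : bijective (fun p : J * I => (p.2, p.1)) by exists (fun p => (p.2, p.1)) => -[].
rewrite -(rsum_pair sf) (rsum_bij _ be) rsum_pair//.
exact/(asum_bij _ be).
Qed.

Lemma esum_single I (f : I -> \bar R) i0 : (0 <= f i0)%E ->
  (forall i, i != i0 -> f i = 0%E) ->
  \esum_(i in setT) f i = f i0.
Proof.
move=> f0 fi; rewrite -[RHS](esum_set1 f0) [RHS]esum_mkcond.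
apply: eq_esum => i _; have [->|ii] := eqVneq i i0; first by rewrite mem_set.
by rewrite memNset ?fi//=; exact/eqP.
Qed.

Lemma asum_single I (f : I -> R) i0 : (forall i, i != i0 -> f i = 0) -> asum f.
Proof.
by move=> fi; rewrite /asum (esum_single (i0 := i0)) ?ltry// => i ii; rewrite fi ?normr0.
Qed.

Lemma rsum_single I (f : I -> R) i0 : (forall i, i != i0 -> f i = 0) ->
  rsum f = f i0.
Proof.
move=> fi; have sf := asum_single fi.
rewrite rsum_pn// !rsum_nn; 
  try by [exact: posp_ge0|exact: negp_ge0|exact: asum_posp|exact: asum_negp].
rewrite !(esum_single (i0 := i0)) -?posp_negp//; try by rewrite lee_fin ?posp_ge0 ?negp_ge0.
all: by move=> i ii; rewrite /posp /negp fi// ?oppr0 maxxx.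
Qed.

Lemma asum_sum I (T : Type) (s : seq T) (f : T -> I -> R) :
  (forall t, asum (f t)) -> asum (fun i => \sum_(t <- s) f t i).
Proof.
move=> sf; elim: s => [|t s ih].
  by apply: eq_asum (asum0 I) => i; rewrite big_nil.
by apply: eq_asum (asumD (sf t) ih) => i; rewrite big_cons.
Qed.

Lemma rsum_sum I (T : Type) (s : seq T) (f : T -> I -> R) :
  (forall t, asum (f t)) ->
  rsum (fun i => \sum_(t <- s) f t i) = \sum_(t <- s) rsum (f t).
Proof.
move=> sf; elim: s => [|t s ih].
  by rewrite big_nil -[RHS](rsum0 I); congr rsum; apply/funext => i; rewrite big_nil.
rewrite big_cons -ih -rsumD//; last exact: asum_sum.
by congr rsum; apply/funext => i; rewrite big_cons.
Qed.

Lemma fin_supp_sum I (f : I -> R) (s : seq I) : uniq s ->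
  (forall i, i \notin s -> f i = 0) ->
  f = (fun i => \sum_(t <- s) (i == t)%:R * f t).
Proof.
move=> us fs; apply/funext => i; have [si|si] := boolP (i \in s).
  rewrite (bigD1_seq i)//= eqxx mul1r big1 ?addr0// => j ji.
  by rewrite eq_sym (negbTE ji) mul0r.
rewrite fs// big_seq big1// => j sj; case: eqP => [e|]; last by rewrite mul0r.
by move: si; rewrite e sj.
Qed.

Lemma asum_fin I (f : I -> R) (s : seq I) : uniq s ->
  (forall i, i \notin s -> f i = 0) -> asum f.
Proof.
move=> us fs; rewrite (fin_supp_sum us fs); apply: asum_sum => t.
by apply: (asum_single (i0 := t)) => i /negbTE ->; rewrite mul0r.
Qed.

Lemma rsum_fin I (f : I -> R) (s : seq I) : uniq s ->
  (forall i, i \notin s -> f i = 0) -> rsum f = \sum_(i <- s) f i.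
Proof.
move=> us fs; rewrite {1}(fin_supp_sum us fs) rsum_sum => [|t]; last first.
  by apply: (asum_single (i0 := t)) => i /negbTE ->; rewrite mul0r.
apply: eq_bigr => t _; rewrite (rsum_single (i0 := t)) ?eqxx ?mul1r//.
by move=> i /negbTE ->; rewrite mul0r.
Qed.

(** A finite set whose sum comes within [e] of the supremum leaves a remainder below [e];
    [ket_approx] truncates vectors this way. *)
Lemma esum_tail I (f : I -> R) (e : R) : (forall i, 0 <= f i) -> asum f -> 0 < e ->
  exists s : seq I, uniq s /\ rsum (fun i => if i \in s then 0 else f i) < e.
Proof.
move=> f0 sf e0.
have fin : (\esum_(i in setT) (f i)%:E)%E \is a fin_num by rewrite -rsum_ge0.
have [x [A [finA _] <-] lt] := ub_ereal_sup_adherent e0 fin.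
have [s us eA] : exists2 s : seq I, uniq s & A = [set` s].
  have [s sA] := (finite_seqP _).1 finA.
  by exists (undup s); rewrite ?undup_uniq// sA; apply/seteqP; split=> i /=; rewrite mem_undup.
exists s; split=> //; rewrite -lte_fin.
have sfs : asum (fun i => if i \in s then 0 else f i).
  by apply: asum_le sf => i; case: ifP; rewrite ?normr0 // ger0_norm.
have sfi : asum (fun i => if i \in s then f i else 0).
  by apply: asum_le sf => i; case: ifP; rewrite ?normr0 // ger0_norm.
have : rsum f = rsum (fun i => if i \in s then 0 else f i) + \sum_(i <- s) f i.
  have -> : \sum_(i <- s) f i = rsum (fun i => if i \in s then f i else 0).
    rewrite (rsum_fin us) => [|i /negbTE ->//].
    by apply: eq_big_seq => i ->.
  by rewrite -rsumD//; congr rsum; apply/funext => i; case: ifP; rewrite ?addr0 ?add0r.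
have E := rsum_ge0 f0 sf; rewrite /esum in E.
move: lt; rewrite -E -EFinB.
rewrite (_ : (\sum_(x0 \in A) _)%E = (\sum_(i <- s) f i)%:E); last first.
  rewrite eA -fsbig_seq// sumEFin.
 by [].
rewrite !lte_fin; lra.
Qed.

Lemma nneseries_cvg (f : nat -> R) : (forall i, 0 <= f i) -> asum f ->
  series f @ \oo --> rsum f.
Proof.
move=> f0 sf.
have := @ereal_nondecreasing_is_cvgn R (fun n => (series f n)%:E).
have : (\sum_(i <oo) (f i)%:E = (rsum f)%:E)%E.
  by rewrite nneseries_esumT ?rsum_ge0// => n; rewrite lee_fin.
move=> e _.
have c : cvgn (fun n => \sum_(0 <= i < n) (f i)%:E)%E.
  by apply: is_cvg_nneseries => i _ _; rewrite lee_fin.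
have : (fun n => \sum_(0 <= i < n) (f i)%:E)%E @ \oo --> (rsum f)%:E.
  by rewrite -e; exact: c.
move=> /fine_cvgP[_]; apply: cvg_trans; apply: near_eq_cvg; near=> n.
by rewrite /= sumEFin/= /series.
Unshelve. all: by end_near. Qed.

(** Connects unordered sums with limits of partial sums, the form in which POVM additivity is stated
    and geometric series are evaluated. *)
Lemma series_cvg_rsum (f : nat -> R) : asum f -> series f @ \oo --> rsum f.
Proof.
move=> sf; rewrite (rsum_pn sf).
have := cvgB (nneseries_cvg (posp_ge0 f) (asum_posp sf))
  (nneseries_cvg (negp_ge0 f) (asum_negp sf)).
move=> /(_ _); apply: cvg_trans; apply: near_eq_cvg; near=> n => /=.
rewrite /series/= -[LHS]/(_ - _) -sumrB; apply: eq_bigr => i _.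
by rewrite -posp_negp.
Unshelve. all: by end_near. Qed.

Lemma asum_boundP I (f : I -> R) (c : R) :
  (forall s : seq I, uniq s -> \sum_(i <- s) `|f i| <= c) -> asum f.
Proof.
move=> h; apply: (@le_lt_trans _ _ c%:E); last exact: ltry.
apply: ge_ereal_sup => _ [A [finA _] <-].
have [s sA] := (finite_seqP _).1 finA.
have -> : A = [set` undup s].
  by rewrite sA; apply/seteqP; split=> i /=; rewrite mem_undup.
by rewrite fsbig_seq ?undup_uniq// sumEFin lee_fin h// undup_uniq.
Qed.

(* AM-GM with a free parameter, then optimized. *)
Lemma rsum_cauchy I (u v : I -> R) :
  asum (fun i => u i ^+ 2) -> asum (fun i => v i ^+ 2) ->
  asum (fun i => u i * v i) /\
  rsum (fun i => `|u i * v i|) ^+ 2 <=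
    rsum (fun i => u i ^+ 2) * rsum (fun i => v i ^+ 2).
Proof.
move=> su sv.
have s : asum (fun i => u i * v i).
  apply: asum_le (asumD su sv) => i.
  rewrite normrM -(real_normK (num_real (u i))) -(real_normK (num_real (v i))).
  move: (normr_ge0 (u i)) (normr_ge0 (v i)) (sqr_ge0 (`|u i| - `|v i|)); nra.
split=> //; set a := rsum (fun i => `|_|); set A := rsum _; set B := rsum _.
have A0 : 0 <= A by apply: rsum_pos => i; rewrite sqr_ge0.
have B0 : 0 <= B by apply: rsum_pos => i; rewrite sqr_ge0.
have a0 : 0 <= a by apply: rsum_pos.
have key t : 2 * t * a <= t ^+ 2 * A + B.
  rewrite /a /A /B -!rsumZ//; last by exact: asum_abs.
  rewrite -rsumD//; last exact: asumZ.
  apply: rsum_le => [||i]; [exact/asumZ/asum_abs|by apply: asumD => //; exact: asumZ|].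
  rewrite normrM -(real_normK (num_real (u i))) -(real_normK (num_real (v i))).
  by move: (sqr_ge0 (t * `|u i| - `|v i|)); nra.
have [A00|Ap] := eqVneq A 0.
  have [->|an] := eqVneq a 0; first by rewrite expr0n mulr_ge0.
  (* For this value of [t], [key] would read 2 (B + 1) <= B. *)
  have := key ((B + 1) / a); rewrite A00 mulr0 mul0r add0r -mulrA divfK//.
  lra.
have {Ap}A0 : 0 < A by rewrite lt_neqAle eq_sym Ap.
have /(ler_wpM2l (ltW A0)) := key (a / A).
have -> : A * (2 * (a / A) * a) = 2 * a ^+ 2 by field; rewrite gt_eqF.
have -> : A * ((a / A) ^+ 2 * A + B) = a ^+ 2 + A * B by field; rewrite gt_eqF.
lra.
Qed.

End RealSums.

#[global] Opaque asum rsum.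

(** * Absolutely summable complex families *)

Section ComplexSums.
Context {R : realType}.
Implicit Types (I J : choiceType) (c d : R[i]).

(** The norm of [R[i]] takes its values in [R[i]]; the real part gives the modulus as a real number,
    so that complex summability becomes a statement on real families. *)
Definition cabs c : R := complex.Re `|c|.

Lemma cabsE c : `|c| = (cabs c)%:C.
Proof. by rewrite /cabs normc_def. Qed.

Lemma cabs_sqrt c : cabs c = Num.sqrt (sqmod c).
Proof. by rewrite /cabs normc_def; case: c. Qed.

Lemma cabs_ge0 c : 0 <= cabs c.
Proof. by rewrite cabs_sqrt sqrtr_ge0. Qed.

Lemma sqmodE c : sqmod c = cabs c ^+ 2.
Proof. by rewrite cabs_sqrt sqr_sqrtr// sqmod_ge0. Qed.

Lemma cabsM c d : cabs (c * d) = cabs c * cabs d.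
Proof. by rewrite !cabs_sqrt sqmodM sqrtrM ?sqmod_ge0. Qed.

Lemma cabsD c d : cabs (c + d) <= cabs c + cabs d.
Proof. by have := ler_normD c d; rewrite !cabsE -rmorphD/= lecR. Qed.

Lemma cabsN c : cabs (- c) = cabs c.
Proof. by rewrite /cabs normrN. Qed.

Lemma cabs0 : cabs 0 = 0.
Proof. by rewrite /cabs normr0. Qed.

Lemma cabs1 : cabs 1 = 1.
Proof. by rewrite /cabs normr1. Qed.

Lemma cabs_eq0 c : cabs c = 0 -> c = 0.
Proof. by move=> c0; apply/eqP; rewrite -normr_eq0 cabsE c0. Qed.

Lemma cabs_conj c : cabs c^* = cabs c.
Proof. by rewrite /cabs norm_conjC. Qed.

Lemma cabs_real (x : R) : cabs x%:C = `|x|.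
Proof. by rewrite cabs_sqrt /sqmod/= expr0n/= addr0 sqrtr_sqr. Qed.

Lemma cabs_nat n : cabs n%:R = n%:R.
Proof. by rewrite /cabs normr_nat -(rmorph_nat (real_complex R)). Qed.

Lemma Re_le_cabs c : `|complex.Re c| <= cabs c.
Proof. by rewrite cabs_sqrt -sqrtr_sqr ler_sqrt ?sqmod_ge0// lerDl sqr_ge0. Qed.

Lemma Im_le_cabs c : `|complex.Im c| <= cabs c.
Proof. by rewrite cabs_sqrt -sqrtr_sqr ler_sqrt ?sqmod_ge0// lerDr sqr_ge0. Qed.

Lemma cabs_le_ReIm c : cabs c <= `|complex.Re c| + `|complex.Im c|.
Proof.
rewrite -(ler_pXn2r (ltn0Sn 1)) ?nnegrE ?cabs_ge0 ?addr_ge0// -sqmodE.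
case: c => a b /=; rewrite /sqmod /= -(real_normK (num_real a)) -(real_normK (num_real b)).
move: (normr_ge0 a) (normr_ge0 b); nra.
Qed.

Lemma conj_mul_cabs c : c^* * c = (cabs c ^+ 2)%:C.
Proof.
by rewrite mulrC -normCK cabsE rmorphXn.
Qed.

Definition csm I (f : I -> R[i]) : Prop := asum (fun i => cabs (f i)).

Lemma csm_Re I (f : I -> R[i]) : csm f -> asum (fun i => complex.Re (f i)).
Proof. by apply: asum_le => i; exact: Re_le_cabs. Qed.

Lemma csm_Im I (f : I -> R[i]) : csm f -> asum (fun i => complex.Im (f i)).
Proof. by apply: asum_le => i; exact: Im_le_cabs. Qed.

Lemma csm_le I (f : I -> R[i]) (g : I -> R) :
  (forall i, cabs (f i) <= g i) -> asum g -> csm f.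
Proof. by move=> fg; apply: asum_le => i; rewrite ger0_norm ?cabs_ge0. Qed.

Lemma eq_csm I (f g : I -> R[i]) : f =1 g -> csm f -> csm g.
Proof. by move=> /funext ->. Qed.

Lemma eq_csum I (f g : I -> R[i]) : f =1 g -> csum f = csum g.
Proof. by move=> /funext ->. Qed.

Lemma eq_rsum I (f g : I -> R) : f =1 g -> rsum f = rsum g.
Proof. by move=> /funext ->. Qed.

Lemma csmD I (f g : I -> R[i]) : csm f -> csm g -> csm (fun i => f i + g i).
Proof. by move=> sf sg; apply: csm_le (asumD sf sg) => i; exact: cabsD. Qed.

Lemma csmZ I c (f : I -> R[i]) : csm f -> csm (fun i => c * f i).
Proof. by move=> sf; apply: csm_le (asumZ (cabs c) sf) => i; rewrite cabsM. Qed.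

Lemma csmZr I c (f : I -> R[i]) : csm f -> csm (fun i => f i * c).
Proof. by move=> /(csmZ c); apply: eq_csm => i; rewrite mulrC. Qed.

Lemma csm0 I : csm (fun _ : I => 0).
Proof. by apply: csm_le (asum0 I) => i; rewrite cabs0. Qed.

Lemma eqC c d : complex.Re c = complex.Re d -> complex.Im c = complex.Im d -> c = d.
Proof. by case: c d => [? ?] [? ?] /= -> ->. Qed.

Lemma csumD I (f g : I -> R[i]) : csm f -> csm g ->
  csum (fun i => f i + g i) = csum f + csum g.
Proof.
move=> sf sg; apply: eqC; rewrite /=.
  by rewrite -rsumD; [apply: eq_rsum => i; case: (f i) (g i) => [? ?] []|exact: csm_Re..].
by rewrite -rsumD; [apply: eq_rsum => i; case: (f i) (g i) => [? ?] []|exact: csm_Im..].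
Qed.

Lemma csumZ I c (f : I -> R[i]) : csm f -> csum (fun i => c * f i) = c * csum f.
Proof.
move=> sf; have [sr si] := (csm_Re sf, csm_Im sf).
case: c => a b; apply: eqC => /=; rewrite -!rsumZ// -?rsumB -?rsumD; try exact: asumZ.
  by apply: eq_rsum => i; case: (f i).
by apply: eq_rsum => i; case: (f i).
Qed.

Lemma csumZr I c (f : I -> R[i]) : csm f -> csum (fun i => f i * c) = csum f * c.
Proof.
by move=> sf; rewrite [RHS]mulrC -csumZ//; apply: eq_csum => i; rewrite mulrC.
Qed.

Lemma csum0 I : csum (fun _ : I => 0 : R[i]) = 0.
Proof. by apply: eqC; rewrite /= rsum0. Qed.

Lemma csum_conj I (f : I -> R[i]) : csm f -> csum (fun i => (f i)^*) = (csum f)^*.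
Proof.
move=> sf; apply: eqC => /=; first by apply: eq_rsum => i; case: (f i).
by rewrite -rsumN; [apply: eq_rsum => i; case: (f i)|exact: csm_Im].
Qed.

Lemma csum_real I (f : I -> R) : csum (fun i => (f i)%:C) = (rsum f)%:C.
Proof. by apply: eqC => //=; rewrite rsum0. Qed.

(** A factor [u] of modulus 1 turns the sum into its modulus; then only real parts have to be
    compared. *)
Lemma cabs_csum I (f : I -> R[i]) : csm f -> cabs (csum f) <= rsum (fun i => cabs (f i)).
Proof.
move=> sf; set S := csum f.
have [S0|S0] := eqVneq (cabs S) 0.
  by rewrite S0; apply: rsum_pos => i; exact: cabs_ge0.
pose u := S^* * (cabs S)^-1%:C.
have cu : cabs u = 1.
  rewrite cabsM cabs_conj cabs_real ger0_norm ?invr_ge0 ?cabs_ge0//.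
  by rewrite mulfV.
have -> : cabs S = complex.Re (u * S).
  rewrite /u mulrAC conj_mul_cabs -rmorphM/=.
  by rewrite expr2 -mulrA mulfV// mulr1.
rewrite -csumZ//=; apply: rsum_le => //; first exact/csm_Re/csmZ.
move=> i; apply: le_trans (ler_norm _) _; apply: le_trans (Re_le_cabs _) _.
by rewrite cabsM cu mul1r.
Qed.

Lemma csm_bij I J (e : I -> J) (f : J -> R[i]) : bijective e -> csm f <-> csm (f \o e).
Proof. by move=> be; apply: (asum_bij (fun i => cabs (f i)) be). Qed.

Lemma csum_bij I J (e : I -> J) (f : J -> R[i]) : bijective e ->
  csum f = csum (f \o e).
Proof. by move=> be; apply: eqC; rewrite /= (rsum_bij _ be). Qed.

Lemma csm_slice I J (f : I * J -> R[i]) i : csm f -> csm (fun j => f (i, j)).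
Proof. exact: (@asum_slice _ _ _ (fun p => cabs (f p))). Qed.

Lemma csm_csum I J (f : I * J -> R[i]) : csm f -> csm (fun i => csum (fun j => f (i, j))).
Proof.
move=> sf; apply: csm_le (asum_rsum sf) => i.
by apply: cabs_csum; exact: csm_slice.
Qed.

Lemma csum_pair I J (f : I * J -> R[i]) : csm f ->
  csum f = csum (fun i => csum (fun j => f (i, j))).
Proof. by move=> sf; apply: eqC; rewrite /= rsum_pair//; [exact: csm_Re|exact: csm_Im]. Qed.

(** Tonelli's criterion. Summability of each row is a separate hypothesis because [rsum] gives the
    value 0 to a divergent nonnegative row. *)
Lemma csm_pairP I J (f : I * J -> R[i]) :
  (forall i, csm (fun j => f (i, j))) ->
  asum (fun i => rsum (fun j => cabs (f (i, j)))) -> csm f.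
Proof.
move=> s1 s2; apply: asum_pairP.
rewrite (_ : (\esum_(i in _) _) =
  \esum_(i in setT) (rsum (fun j => cabs (f (i, j))))%:E)%E.
  by rewrite -asum_ge0E// => i; apply: rsum_pos => j; exact: cabs_ge0.
apply: eq_esum => i _; rewrite rsum_ge0; [|by move=> j; exact: cabs_ge0|exact: s1].
by apply: eq_esum => j _; rewrite ger0_norm// cabs_ge0.
Qed.

Lemma csum_swap I J (f : I -> J -> R[i]) : csm (fun p => f p.1 p.2) ->
  csum (fun i => csum (f i)) = csum (fun j => csum (fun i => f i j)).
Proof.
move=> sf; apply: eqC; rewrite /=.
  exact: rsum_swap (csm_Re sf).
exact: rsum_swap (csm_Im sf).
Qed.

Lemma csum_single I (f : I -> R[i]) i0 : (forall i, i != i0 -> f i = 0) ->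
  csum f = f i0.
Proof.
by move=> fi; apply: eqC; rewrite /= (rsum_single (i0 := i0))// => i /fi ->.
Qed.

Lemma csm_single I (f : I -> R[i]) i0 : (forall i, i != i0 -> f i = 0) -> csm f.
Proof.
by move=> fi; apply: (asum_single (i0 := i0)) => i /fi ->; rewrite cabs0.
Qed.

Lemma csm_fin I (f : I -> R[i]) (s : seq I) : uniq s ->
  (forall i, i \notin s -> f i = 0) -> csm f.
Proof. by move=> us fs; apply: (asum_fin us) => i /fs ->; rewrite cabs0. Qed.

Lemma csum_fin I (f : I -> R[i]) (s : seq I) : uniq s ->
  (forall i, i \notin s -> f i = 0) -> csum f = \sum_(i <- s) f i.
Proof.
move=> us fs; apply: eqC; rewrite /= (rsum_fin us) => [|i /fs ->//].
  by elim: {us fs} s => [|i s ih]; rewrite ?big_nil// !big_cons ih raddfD.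
by elim: {us fs} s => [|i s ih]; rewrite ?big_nil// !big_cons ih raddfD.
Qed.

Lemma csm_sum I (T : Type) (s : seq T) (f : T -> I -> R[i]) :
  (forall t, csm (f t)) -> csm (fun i => \sum_(t <- s) f t i).
Proof.
move=> sf; elim: s => [|t s ih].
  by apply: eq_csm (csm0 I) => i; rewrite big_nil.
by apply: eq_csm (csmD (sf t) ih) => i; rewrite big_cons.
Qed.

Lemma csum_sum I (T : Type) (s : seq T) (f : T -> I -> R[i]) :
  (forall t, csm (f t)) ->
  csum (fun i => \sum_(t <- s) f t i) = \sum_(t <- s) csum (f t).
Proof.
move=> sf; elim: s => [|t s ih].
  by rewrite big_nil -[RHS](csum0 I); apply: eq_csum => i; rewrite big_nil.
rewrite big_cons -ih -csumD//; last exact: csm_sum.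
by apply: eq_csum => i; rewrite big_cons.
Qed.

Lemma csm_prod I J (f : I -> R[i]) (g : J -> R[i]) : csm f -> csm g ->
  csm (fun p : I * J => f p.1 * g p.2).
Proof.
move=> sf sg; apply: csm_pairP => [i|]; first exact: (csmZ (f i) sg).
rewrite (_ : (fun i => _) = fun i => cabs (f i) * rsum (fun j => cabs (g j))).
  by apply: eq_asum (asumZ (rsum (fun j => cabs (g j))) sf) => i; rewrite mulrC.
by apply/funext => i /=; rewrite -rsumZ//; apply: eq_rsum => j; rewrite cabsM.
Qed.

Lemma csum_prod I J (f : I -> R[i]) (g : J -> R[i]) : csm f -> csm g ->
  csum (fun p : I * J => f p.1 * g p.2) = csum f * csum g.
Proof.
move=> sf sg; rewrite (csum_pair (csm_prod sf sg)) -csumZr//.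
by apply: eq_csum => i /=; rewrite csumZ.
Qed.

Lemma conjD c d : (c + d)^* = c^* + d^*.
Proof. exact: rmorphD. Qed.

Lemma conjM c d : (c * d)^* = c^* * d^*.
Proof. exact: rmorphM. Qed.

Lemma conj_nat n : (n%:R : R[i])^* = n%:R.
Proof. exact: conjC_nat. Qed.

Lemma conj_real (x : R) : (x%:C)^* = x%:C.
Proof. exact: (conjc_real x). Qed.

Lemma conjN c : (- c)^* = - c^*.
Proof. exact: rmorphN. Qed.

Lemma conj_sum (T : Type) (s : seq T) (f : T -> R[i]) :
  (\sum_(t <- s) f t)^* = \sum_(t <- s) (f t)^*.
Proof. exact: rmorph_sum. Qed.

End ComplexSums.

#[global] Opaque csm csum.

(** * Bounded operators on l2 *)

Section L2.
Context {R : realType} {I : choiceType}.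
Implicit Types (u v w : l2 R I) (f g : I -> R[i]).

Definition sqs f := asum (fun i => cabs (f i) ^+ 2).

Lemma sq_summableP (f : I -> R[i]^o) : sq_summable f <-> sqs f.
Proof.
rewrite /sqs asum_ge0E; last by move=> i; rewrite sqr_ge0.
by rewrite /sq_summable; under eq_esum do rewrite sqmodE.
Qed.

Lemma l2_sqs v : sqs v.
Proof. by have /asboolP/sq_summableP : l2_pred v := l2_valP v. Qed.

Lemma l2P u v : (forall i, u i = v i) -> u = v.
Proof. by move=> uv; apply: val_inj; apply/funext. Qed.

Lemma mkl2_eq f : sqs f -> forall i, mkl2 f i = f i.
Proof. by move=> sf i; apply: mkl2E; exact/sq_summableP. Qed.

Lemma mkl2_val v : mkl2 v = v.
Proof. by apply: l2P => i; rewrite mkl2_eq//; exact: l2_sqs. Qed.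

Lemma l2addE u v i : (u + v) i = u i + v i. Proof. by []. Qed.
Lemma l2scaleE (c : R[i]) u i : (c *: u) i = c * u i. Proof. by []. Qed.
Lemma l2oppE u i : (- u) i = - u i. Proof. by []. Qed.
Lemma l2sumE (T : Type) (s : seq T) (F : T -> l2 R I) i :
  (\sum_(t <- s) F t) i = \sum_(t <- s) F t i.
Proof. by elim: s => [|t s ih]; rewrite ?big_nil// !big_cons l2addE ih. Qed.

Lemma sqs_cauchy f g : sqs f -> sqs g -> csm (fun i => f i * g i) /\
  rsum (fun i => cabs (f i * g i)) ^+ 2 <=
  rsum (fun i => cabs (f i) ^+ 2) * rsum (fun i => cabs (g i) ^+ 2).
Proof.
move=> sf sg; have [s le] := rsum_cauchy sf sg.
have e : (fun i => `|cabs (f i) * cabs (g i)|) = (fun i => cabs (f i * g i)).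
  by apply/funext => i; rewrite cabsM ger0_norm// mulr_ge0 ?cabs_ge0.
split; first by move: (asum_abs s); rewrite e.
by rewrite -e.
Qed.

Lemma sqs_conj f : sqs f -> sqs (fun i => (f i)^*).
Proof. by apply: eq_asum => i; rewrite cabs_conj. Qed.

Lemma inner_csm u v : csm (fun i => (u i)^* * v i).
Proof. by have [] := sqs_cauchy (sqs_conj (l2_sqs u)) (l2_sqs v). Qed.

Lemma innerDr u v w : inner u (v + w) = inner u v + inner u w.
Proof.
rewrite /inner -csumD; try exact: inner_csm.
by apply: eq_csum => i; rewrite l2addE mulrDr.
Qed.

Lemma innerZr c u v : inner u (c *: v) = c * inner u v.
Proof.
rewrite /inner -csumZ; last exact: inner_csm.
by apply: eq_csum => i; rewrite l2scaleE mulrCA.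
Qed.

Lemma inner_conj u v : inner u v = (inner v u)^*.
Proof.
rewrite /inner -csum_conj; last exact: inner_csm.
by apply: eq_csum => i; rewrite conjM conjCK mulrC.
Qed.

Lemma innerZl c u v : inner (c *: u) v = c^* * inner u v.
Proof. by rewrite inner_conj innerZr conjM -inner_conj. Qed.

Lemma inner0r u : inner u 0 = 0.
Proof. by rewrite -(scale0r (0 : l2 R I)) innerZr mul0r. Qed.

Lemma inner_sumr (T : Type) (s : seq T) (F : T -> l2 R I) u :
  inner u (\sum_(t <- s) F t) = \sum_(t <- s) inner u (F t).
Proof. by elim: s => [|t s ih]; rewrite ?big_nil ?inner0r// !big_cons innerDr ih. Qed.

Definition nsq v : R := rsum (fun i => cabs (v i) ^+ 2).

Lemma nsq_ge0 v : 0 <= nsq v.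
Proof. by apply: rsum_pos => i; rewrite sqr_ge0. Qed.

Lemma inner_nsq v : inner v v = (nsq v)%:C.
Proof. by rewrite /nsq -csum_real; apply: eq_csum => i; rewrite conj_mul_cabs. Qed.

Lemma l2normE v : l2norm v = Num.sqrt (nsq v).
Proof. by rewrite /l2norm inner_nsq. Qed.

Lemma l2norm_ge0 v : 0 <= l2norm v.
Proof. by rewrite l2normE sqrtr_ge0. Qed.

Lemma l2norm_sq v : l2norm v ^+ 2 = nsq v.
Proof. by rewrite l2normE sqr_sqrtr// nsq_ge0. Qed.

Lemma cauchy_schwarz u v : cabs (inner u v) <= l2norm u * l2norm v.
Proof.
have [s le] := sqs_cauchy (sqs_conj (l2_sqs u)) (l2_sqs v).
rewrite -(ler_pXn2r (ltn0Sn 1)) ?nnegrE ?cabs_ge0 ?mulr_ge0 ?l2norm_ge0//.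
rewrite exprMn !l2norm_sq; apply: le_trans (_ : _ <= _).
  by apply: lerXn2r (cabs_csum s); rewrite nnegrE ?cabs_ge0//;
    apply: rsum_pos => i; exact: cabs_ge0.
apply: le_trans le _; rewrite le_eqVlt; apply/orP; left; apply/eqP; congr (_ * _).
by apply: eq_rsum => i; rewrite cabs_conj.
Qed.

Lemma inner_ketl i v : inner (ket i) v = v i.
Proof.
rewrite /inner (csum_single (i0 := i)) => [|j /negbTE ji]; rewrite ketE ?eqxx ?ji.
  by rewrite conj_nat mul1r.
by rewrite conj_nat mul0r.
Qed.

Lemma inner_ketr i v : inner v (ket i) = (v i)^*.
Proof. by rewrite inner_conj inner_ketl. Qed.

Lemma l2norm0 : l2norm (0 : l2 R I) = 0.
Proof. by rewrite /l2norm inner0r sqrtr0. Qed.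

Lemma ket_combE (s : seq I) (a : I -> R[i]) i : uniq s ->
  (\sum_(j <- s) a j *: ket j : l2 R I) i = if i \in s then a i else 0.
Proof.
move=> us; rewrite l2sumE.
have e j : (a j *: ket j : l2 R I) i = a j * (i == j)%:R by rewrite l2scaleE ketE.
rewrite (eq_bigr _ (fun j _ => e j)).
have [si|si] := boolP (i \in s).
  rewrite (bigD1_seq i)//= big1 => [|j ji]; first by rewrite eqxx mulr1 addr0.
  by rewrite eq_sym (negbTE ji) mulr0.
rewrite big_seq big1// => j sj.
by case: eqP => [e'|]; rewrite ?mulr0//; move: si; rewrite e' sj.
Qed.

(* Every vector is the sum of a finite combination of kets and a small remainder. *)
Lemma ket_approx v (e : R) : 0 < e -> exists (s : seq I) (w : l2 R I),
  v = \sum_(i <- s) v i *: ket i + w /\ l2norm w < e.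
Proof.
move=> e0; have e20 : 0 < e ^+ 2 by rewrite exprn_gt0.
have [s [us lt]] := esum_tail (fun i => sqr_ge0 (cabs (v i))) (l2_sqs v) e20.
exists s, (v - \sum_(i <- s) v i *: ket i); split; first by rewrite addrC subrK.
rewrite -(ltr_pXn2r (ltn0Sn 1)) ?nnegrE ?l2norm_ge0 ?(ltW e0)// l2norm_sq.
apply: le_lt_trans lt; rewrite le_eqVlt; apply/orP; left; apply/eqP.
apply: eq_rsum => i; rewrite l2addE l2oppE ket_combE//.
by case: ifP => _; rewrite ?subrr ?cabs0 ?expr0n// subr0.
Qed.

(** By [ket_approx], the value at [v] is the value at an arbitrarily small remainder. This yields
    [adjP], whose two sides agree on kets by the definition of [adj]. *)
Lemma functional_ext (L : l2 R I -> R[i]) (c : R) :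
  (forall a u v, L (a *: u + v) = a * L u + L v) ->
  (forall v, cabs (L v) <= c * l2norm v) ->
  (forall i, L (ket i) = 0) -> forall v, L v = 0.
Proof.
move=> Llin Lb Lk v; apply: cabs_eq0; apply/eqP; rewrite eq_le cabs_ge0 andbT.
have L0 : L 0 = 0.
  apply: cabs_eq0; apply/eqP; rewrite eq_le cabs_ge0 andbT.
  by rewrite (le_trans (Lb _))// l2norm0 mulr0.
apply/ler_addgt0Pr => e e0; rewrite add0r.
have c1 : 0 < `|c| + 1 by rewrite ltr_wpDl.
have [s [w [-> ltw]]] := ket_approx v (divr_gt0 e0 c1).
have Ls (r : seq I) (a : I -> R[i]) w' : L (\sum_(i <- r) a i *: ket i + w') = L w'.
  elim: r => [|i r ih]; first by rewrite big_nil add0r.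
  by rewrite big_cons -addrA Llin Lk mulr0 add0r.
rewrite Ls; apply: le_trans (Lb _) _.
rewrite ltr_pdivlMr// in ltw; have n0 := l2norm_ge0 w; have := ler_norm c; nra.
Qed.

End L2.

Section Operators.
Context {R : realType} {I : choiceType}.
Implicit Types (u v w : l2 R I) (S T : op R I).

Lemma bounded_lin T : bounded_op T -> forall a u v, T (a *: u + v) = a *: T u + T v.
Proof. by case. Qed.

Lemma bounded_add T : bounded_op T -> forall u v, T (u + v) = T u + T v.
Proof. by case=> l _ u v; rewrite -(scale1r u) l !scale1r. Qed.

Lemma bounded0 T : bounded_op T -> T 0 = 0.
Proof. by move=> bT; apply: (addrI (T 0)); rewrite -bounded_add// !addr0. Qed.

Lemma bounded_scale T : bounded_op T -> forall a u, T (a *: u) = a *: T u.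
Proof.
by move=> bT a u; rewrite -[a *: u]addr0 bounded_lin// bounded0// addr0.
Qed.

Lemma bounded_sum T : bounded_op T -> forall (r : seq I) (F : I -> l2 R I),
  T (\sum_(i <- r) F i) = \sum_(i <- r) T (F i).
Proof.
move=> bT r F; elim: r => [|i r ih]; first by rewrite !big_nil bounded0.
by rewrite !big_cons bounded_add// ih.
Qed.

Lemma bounded_pos T : bounded_op T ->
  exists c : R, 0 <= c /\ forall v, l2norm (T v) <= c * l2norm v.
Proof.
move=> [_ [c bc]]; exists `|c|; split=> // v; apply: le_trans (bc v) _.
by rewrite ler_wpM2r ?l2norm_ge0// ler_norm.
Qed.

Lemma bounded_comp S T : bounded_op S -> bounded_op T -> bounded_op (S \o T).
Proof.
move=> bS bT; split.
  by move=> a u v /=; rewrite !bounded_lin.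
have [[c [c0 bc]] [d [d0 bd]]] := (bounded_pos bS, bounded_pos bT).
exists (c * d) => v /=; apply: le_trans (bc _) _.
by rewrite -mulrA ler_wpM2l.
Qed.

Lemma bounded_id : bounded_op (idfun : op R I).
Proof. by split=> //; exists 1 => v; rewrite mul1r. Qed.

Lemma eq_bounded S T : S =1 T -> bounded_op S -> bounded_op T.
Proof. by move=> /funext ->. Qed.

Lemma inner_ext u v : (forall w, inner w u = inner w v) -> u = v.
Proof. by move=> uv; apply: l2P => i; rewrite -!inner_ketl. Qed.

Lemma sqs_bounded (f : I -> R[i]) (c : R) :
  (forall s : seq I, uniq s -> \sum_(i <- s) cabs (f i) ^+ 2 <= c) ->
  sqs f /\ rsum (fun i => cabs (f i) ^+ 2) <= c.
Proof.
move=> h; have sf : sqs f.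
  apply: (asum_boundP (c := c)) => s us; apply: le_trans (h s us).
  by apply: ler_sum => i _; rewrite ger0_norm// sqr_ge0.
split=> //; rewrite -lee_fin rsum_ge0//; last by move=> i; rewrite sqr_ge0.
apply: ge_ereal_sup => _ [A [finA _] <-].
have [s sA] := (finite_seqP _).1 finA.
have -> : A = [set` undup s].
  by rewrite sA; apply/seteqP; split=> i /=; rewrite mem_undup.
by rewrite -fsbig_seq ?undup_uniq// sumEFin lee_fin h// undup_uniq.
Qed.

Lemma nsq_fin (s : seq I) (a : I -> R[i]) : uniq s ->
  nsq (\sum_(i <- s) a i *: ket i) = \sum_(i <- s) cabs (a i) ^+ 2.
Proof.
move=> us; rewrite /nsq.
have e i := ket_combE a i us.
rewrite (rsum_fin us) => [|i /negbTE si]; last by rewrite e si cabs0 expr0n.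
by apply: eq_big_seq => i si; rewrite e si.
Qed.

(** [adj] goes through [mkl2], which returns 0 unless the coordinates are square summable. If u is a
    finite truncation of the candidate, then |u|^2 = <T u|v'> <= c |u| |v'|, which bounds every
    partial sum by (c |v'|)^2. *)
Lemma adj_sqs T v : bounded_op T -> sqs (fun i => inner (T (ket i)) v) /\
  exists c : R, forall v', l2norm (mkl2 (fun i => inner (T (ket i)) v')) <= c * l2norm v'.
Proof.
move=> bT; have [c [c0 bc]] := bounded_pos bT.
have key v' : sqs (fun i => inner (T (ket i)) v') /\
    rsum (fun i => cabs (inner (T (ket i)) v') ^+ 2) <= (c * l2norm v') ^+ 2.
  pose a i := inner (T (ket i)) v'.
  apply: (sqs_bounded (f := a)) => s us.
  set x := \sum_(i <- s) _.
  pose u := \sum_(i <- s) a i *: ket i.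
  have e : inner (T u) v' = x%:C.
    rewrite /u bounded_sum// inner_conj inner_sumr conj_sum /x rmorph_sum/=.
    apply: eq_bigr => i _; rewrite bounded_scale// -inner_conj innerZl.
    exact: conj_mul_cabs.
  have x0 : 0 <= x by apply: sumr_ge0 => i _; rewrite sqr_ge0.
  have nu : l2norm u ^+ 2 = x by rewrite l2norm_sq nsq_fin.
  have : x <= c * l2norm u * l2norm v'.
    have := cauchy_schwarz (T u) v'; rewrite e cabs_real ger0_norm// => /le_trans; apply.
    by rewrite ler_wpM2r ?l2norm_ge0.
  rewrite -nu; have := l2norm_ge0 u; have := l2norm_ge0 v'.
  move: (l2norm u) (l2norm v') => p q q0 p0.
  have [->|pn] := eqVneq p 0; first by rewrite expr0n/= => _; rewrite sqr_ge0.
  have pp : 0 < p by rewrite lt_neqAle eq_sym pn.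
  rewrite expr2 mulrAC ler_pM2r// => ?; rewrite -expr2 lerXn2r ?nnegrE// mulr_ge0//.
have [s1 _] := key v; split=> //; exists c => v'.
have [s le] := key v'.
rewrite -(ler_pXn2r (ltn0Sn 1)) ?nnegrE ?mulr_ge0 ?l2norm_ge0// l2norm_sq.
apply: le_trans le; rewrite le_eqVlt; apply/orP; left; apply/eqP.
by apply: eq_rsum => i; rewrite mkl2_eq.
Qed.

Lemma adjE T v i : bounded_op T -> adj T v i = inner (T (ket i)) v.
Proof. by move=> bT; rewrite /adj mkl2_eq//; have [] := adj_sqs v bT. Qed.

Lemma adj_bounded T : bounded_op T -> bounded_op (adj T).
Proof.
move=> bT; split; last by have [_] := adj_sqs 0 bT.
move=> a u v; apply: l2P => i.
by rewrite l2addE l2scaleE !adjE// innerDr innerZr.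
Qed.

Lemma adjP T u v : bounded_op T -> inner (adj T u) v = inner u (T v).
Proof.
move=> bT; have bA := adj_bounded bT.
have [[c [c0 bc]] [d [d0 bd]]] := (bounded_pos bT, bounded_pos bA).
apply/eqP; rewrite -subr_eq0; apply/eqP; move: v.
apply: (functional_ext (c := d * l2norm u + c * l2norm u)).
- by move=> a v w; rewrite bounded_lin// !innerDr !innerZr; ring.
- move=> v; apply: le_trans (cabsD _ _) _; rewrite cabsN mulrDl lerD//.
    apply: le_trans (cauchy_schwarz _ _) _.
    by rewrite ler_wpM2r ?l2norm_ge0.
  apply: le_trans (cauchy_schwarz _ _) _.
  by rewrite mulrAC mulrC ler_wpM2r ?l2norm_ge0.
- by move=> i; rewrite inner_ketr adjE// -inner_conj subrr.
Qed.

Lemma adjP' T u v : bounded_op T -> inner u (adj T v) = inner (T u) v.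
Proof. by move=> bT; rewrite inner_conj adjP// -inner_conj. Qed.

Lemma entryE T i j : entry T i j = T (ket j) i.
Proof. exact: inner_ketl. Qed.

Lemma bounded_entry T v i : bounded_op T ->
  csm (fun j => entry T i j * v j) /\ T v i = csum (fun j => entry T i j * v j).
Proof.
move=> bT.
have e j : entry T i j * v j = (adj T (ket i) j)^* * v j.
  by rewrite adjE// -inner_conj.
split; first by apply: eq_csm (inner_csm (adj T (ket i)) v) => j; rewrite e.
rewrite -inner_ketl -adjP//; apply: eq_csum => j; rewrite e//.
Qed.

Lemma bounded_ext S T : bounded_op S -> bounded_op T ->
  (forall i j, entry S i j = entry T i j) -> S =1 T.
Proof.
move=> bS bT e v; apply: l2P => i.
have [_ ->] := bounded_entry v i bS; have [_ ->] := bounded_entry v i bT.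
by apply: eq_csum => j; rewrite e.
Qed.

(** [tpow] and [tens] are defined by matrices only; this identifies them with operators already
    known to be bounded. *)
Lemma mxop_bounded (A : I -> I -> R[i]) T : bounded_op T ->
  (forall i j, A i j = entry T i j) -> mxop A =1 T.
Proof.
move=> bT e v; rewrite -[RHS]mkl2_val; congr mkl2; apply/funext => i.
have [_ ->] := bounded_entry v i bT; apply: eq_csum => j; rewrite e//.
Qed.

Lemma entry_comp S T i j : bounded_op S ->
  csm (fun k => entry S i k * entry T k j) /\
  entry (S \o T) i j = csum (fun k => entry S i k * entry T k j).
Proof.
move=> bS; have [s e] := bounded_entry (T (ket j)) i bS.
split; first by apply: eq_csm s => k; rewrite (entryE T k j).
by rewrite entryE /= e; apply: eq_csum => k; rewrite (entryE T k j).
Qed.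

Lemma entry_adj T i j : bounded_op T -> entry (adj T) i j = (entry T j i)^*.
Proof. by move=> bT; rewrite entryE adjE// inner_ketr entryE. Qed.

Lemma diag_sqs (d : I -> R[i]) (c : R) v : (forall i, cabs (d i) <= c) ->
  sqs (fun i => d i * v i).
Proof.
move=> dc; apply: asum_le (asumZ (c ^+ 2) (l2_sqs v)) => i.
rewrite ger0_norm ?sqr_ge0// cabsM exprMn ler_wpM2r ?sqr_ge0//.
by rewrite lerXn2r ?nnegrE ?cabs_ge0// (le_trans (cabs_ge0 _) (dc i)).
Qed.

Lemma diagE (d : I -> R[i]) (c : R) v i : (forall i, cabs (d i) <= c) ->
  diagop d v i = d i * v i.
Proof. by move=> dc; rewrite /diagop mkl2_eq//; exact: diag_sqs dc. Qed.

Lemma diag_bounded (d : I -> R[i]) (c : R) : (forall i, cabs (d i) <= c) ->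
  bounded_op (diagop d).
Proof.
move=> dc; split.
  move=> a u v; apply: l2P => i.
  by rewrite l2addE l2scaleE !(diagE _ _ dc) l2addE l2scaleE; ring.
exists `|c| => v.
rewrite -(ler_pXn2r (ltn0Sn 1)) ?nnegrE ?mulr_ge0 ?l2norm_ge0//.
rewrite exprMn !l2norm_sq real_normK ?num_real// /nsq -rsumZ; last exact: l2_sqs.
apply: rsum_le; [exact: l2_sqs|exact/asumZ/l2_sqs|move=> i].
rewrite (diagE _ _ dc) cabsM exprMn ler_wpM2r ?sqr_ge0//.
by rewrite lerXn2r ?nnegrE ?cabs_ge0// (le_trans (cabs_ge0 _) (dc i)).
Qed.

Lemma entry_diag (d : I -> R[i]) (c : R) i j : (forall i, cabs (d i) <= c) ->
  entry (diagop d) i j = d i * (i == j)%:R.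
Proof. by move=> dc; rewrite entryE (diagE _ _ dc) ketE. Qed.

Lemma entry_id i j : entry (idfun : op R I) i j = (i == j)%:R.
Proof. by rewrite entryE ketE. Qed.

Definition colortho (A : I -> I -> R[i]) : Prop := forall j k,
  csm (fun i => (A i j)^* * A i k) /\ csum (fun i => (A i j)^* * A i k) = (j == k)%:R.

(** In infinite dimension orthonormal columns alone give an isometry; orthonormal rows make it
    onto. *)
Definition unimx (A : I -> I -> R[i]) : Prop :=
  colortho A /\ colortho (fun i j => (A j i)^*).

Lemma colortho_sqs (A : I -> I -> R[i]) j : colortho A ->
  sqs (fun i => A i j) /\ rsum (fun i => cabs (A i j) ^+ 2) = 1.
Proof.
move=> /(_ j j) [s e]; rewrite eqxx in e.
have e' : (fun i => (A i j)^* * A i j) = (fun i => (cabs (A i j) ^+ 2)%:C).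
  by apply/funext => i; exact: conj_mul_cabs.
rewrite e' in s e; split.
  by apply: eq_asum s => i; rewrite cabs_real ger0_norm// sqr_ge0.
by apply: (complexI (R := R)); rewrite -csum_real e.
Qed.

(* Bessel's inequality for the orthonormal rows. *)
Lemma unimx_bounded (A : I -> I -> R[i]) : unimx A ->
  bounded_op (mxop A) /\ forall i j, entry (mxop A) i j = A i j.
Proof.
move=> [cA rA].
have sr i : sqs (fun j => (A i j)^*) by have [] := colortho_sqs i rA.
pose r i : l2 R I := mkl2 (fun j => (A i j)^*).
have rE i v : csum (fun j => A i j * v j) = inner (r i) v.
  by apply: eq_csum => j; rewrite mkl2_eq// conjCK.
have ro i k : inner (r i) (r k) = (i == k)%:R.
  rewrite -(rA i k).2; apply: eq_csum => j.
  by rewrite !mkl2_eq.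
have key v : sqs (fun i => inner (r i) v) /\
    rsum (fun i => cabs (inner (r i) v) ^+ 2) <= nsq v.
  pose a i := inner (r i) v.
  apply: (sqs_bounded (f := a)) => s us.
  set x := \sum_(i <- s) _.
  pose u := \sum_(i <- s) a i *: r i.
  have e : inner u v = x%:C.
    rewrite inner_conj inner_sumr conj_sum /x rmorph_sum/=.
    apply: eq_bigr => i _; rewrite -inner_conj innerZl.
    exact: conj_mul_cabs.
  have nu : nsq u = x.
    apply: (complexI (R := R)); rewrite -inner_nsq {2}/u inner_sumr /x rmorph_sum/=.
    apply: eq_big_seq => i si; rewrite innerZr -conj_mul_cabs mulrC; congr (_ * _).
    rewrite inner_conj /u inner_sumr (bigD1_seq i)//= big1 => [|k ki].
      by rewrite innerZr ro eqxx mulr1 addr0.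
    by rewrite innerZr ro eq_sym (negbTE ki) mulr0.
  have x0 : 0 <= x by apply: sumr_ge0 => i _; rewrite sqr_ge0.
  have := cauchy_schwarz u v; rewrite e cabs_real ger0_norm//.
  rewrite -l2norm_sq -nu -l2norm_sq.
  have := l2norm_ge0 u; have := l2norm_ge0 v.
  move: (l2norm u) (l2norm v) => p q q0 p0.
  have [->|pn] := eqVneq p 0; first by rewrite expr0n/= => _; rewrite sqr_ge0.
  have pp : 0 < p by rewrite lt_neqAle eq_sym pn.
  by rewrite expr2 ler_pM2l// => ?; rewrite -expr2 lerXn2r ?nnegrE.
have mE v i : mxop A v i = inner (r i) v.
  rewrite /mxop (_ : (fun i => _) = fun i => inner (r i) v); last exact/funext.
  by rewrite mkl2_eq//; have [] := key v.
split; last first.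
  by move=> i j; rewrite entryE mE inner_ketr mkl2_eq// conjCK.
split; first by move=> a u v; apply: l2P => i; rewrite l2addE l2scaleE !mE innerDr innerZr.
exists 1 => v; rewrite mul1r -(ler_pXn2r (ltn0Sn 1)) ?nnegrE ?l2norm_ge0// !l2norm_sq.
have [s le] := key v; apply: le_trans le; rewrite le_eqVlt; apply/orP; left; apply/eqP.
by apply: eq_rsum => i; rewrite mE.
Qed.

Lemma unimx_unitary (A : I -> I -> R[i]) : unimx A -> unitary (mxop A).
Proof.
move=> uA; have [bA eA] := unimx_bounded uA; have bA' := adj_bounded bA.
case: uA => cA rA; split=> //.
  apply: bounded_ext => [||i j]; [exact: bounded_comp|exact: bounded_id|].
  have [_ ->] := entry_comp (mxop A) i j bA'.
  rewrite entry_id -(cA i j).2; apply: eq_csum => k.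
  by rewrite entry_adj// !eA.
apply: bounded_ext => [||i j]; [exact: bounded_comp|exact: bounded_id|].
have [_ ->] := entry_comp (adj (mxop A)) i j bA.
rewrite entry_id -(rA i j).2; apply: eq_csum => k.
by rewrite entry_adj// !eA conjCK.
Qed.

Lemma unitary_adj T : unitary T -> unitary (adj T).
Proof.
move=> [bT e1 e2]; have bA := adj_bounded bT.
have e : adj (adj T) =1 T.
  move=> v; apply: inner_ext => w; rewrite adjP'//.
  by rewrite adjP.
by split=> // v /=; rewrite e; [exact: e2|exact: e1].
Qed.

Lemma unitary_comp S T : unitary S -> unitary T -> unitary (S \o T).
Proof.
move=> [bS s1 s2] [bT t1 t2]; have bST := bounded_comp bS bT.
have e : adj (S \o T) =1 adj T \o adj S.
  by move=> v; apply: inner_ext => w; rewrite adjP'//= adjP'// adjP'.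
split=> [//|v|v] /=; rewrite e/=.
  by rewrite (s1 (T v) : adj S (S (T v)) = _) (t1 v : adj T (T v) = _).
by rewrite (t2 (adj S v) : T (adj T _) = _) (s2 v : S (adj S v) = _).
Qed.

Lemma unitary_nsq T v : unitary T -> nsq (T v) = nsq v.
Proof.
move=> [bT e _]; apply: (complexI (R := R)); rewrite -!inner_nsq -adjP//.
by rewrite (e v : adj T (T v) = v).
Qed.

(* tr (Y w Y^dagger) = sum_i sum_k w_k |Y_ik|^2, summed over i first. *)
Lemma tr_conj_diag (Y : op R I) (w : I -> R) : unitary Y ->
  (forall k, 0 <= w k) -> asum w ->
  tr (Y \o diagop (fun k => (w k)%:C) \o adj Y) = (rsum w)%:C.
Proof.
move=> uY w0 sw; have [bY _ _] := uY; have bA := adj_bounded bY.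
have [c wc] : exists c, forall k, cabs (w k)%:C <= c.
  exists (rsum w) => k; rewrite cabs_real ger0_norm// -lee_fin rsum_ge0//.
  rewrite (esumID [set k]) => [|? _]; last by rewrite lee_fin.
  rewrite setTI esum_set1 ?lee_fin// leeDl// esum_ge0// => ? _.
  by rewrite lee_fin.
have bd := diag_bounded wc.
have E i : entry (Y \o diagop (fun k => (w k)%:C) \o adj Y) i i =
    (rsum (fun k => w k * cabs (entry Y i k) ^+ 2))%:C.
  rewrite /entry /= -adjP// -csum_real; apply: eq_csum => k.
  have -> : diagop (fun k0 : I => (w k0)%:C) (adj Y (ket i)) k =
      (w k)%:C * (adj Y (ket i)) k by rewrite (diagE _ _ wc).
  have -> : adj Y (ket i) k = (entry Y i k)^* by rewrite adjE// inner_ketr -(inner_ketl i).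
  by rewrite conjCK rmorphM/= -/(entry Y i k) -conj_mul_cabs; ring.
have colY k : asum (fun i => cabs (entry Y i k) ^+ 2) /\
    rsum (fun i => cabs (entry Y i k) ^+ 2) = 1.
  have e : (fun i => cabs (entry Y i k) ^+ 2) = (fun i => cabs (Y (ket k) i) ^+ 2).
    by apply/funext => i; rewrite entryE.
  rewrite e; split; first exact: l2_sqs.
  rewrite -[LHS]/(nsq (Y (ket k))) unitary_nsq//; apply: (complexI (R := R)).
  by rewrite -inner_nsq inner_ketl ketE eqxx.
have sp : asum (fun p : I * I => w p.1 * cabs (entry Y p.2 p.1) ^+ 2).
  apply: asum_pairP; apply: le_lt_trans sw; apply: le_esum => k _ /=.
  rewrite (eq_esum (b := fun i => (w k)%:E * (cabs (entry Y i k) ^+ 2)%:E)%E); last first.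
    by move=> i _; rewrite -EFinM ger0_norm// mulr_ge0 ?sqr_ge0.
  rewrite esumZ// => [|i]; last by rewrite lee_fin sqr_ge0.
  rewrite -rsum_ge0; [|by move=> i; rewrite sqr_ge0|by have [] := colY k].
  by rewrite (colY k).2 mule1 ger0_norm.
rewrite /tr (_ : (fun i => _) = fun i =>
   (rsum (fun k => w k * cabs (entry Y i k) ^+ 2))%:C); last exact/funext.
rewrite csum_real; congr (_ %:C); rewrite -(rsum_swap sp).
apply: eq_rsum => k; rewrite rsumZ ?(colY k).2 ?mulr1//; by have [] := colY k.
Qed.

End Operators.

#[global] Opaque inner adj mkl2 mxop diagop.

(** * Displacement operators *)

Section Fiber.
Context {R : realType}.

(** The family is spread over the graph of [g] in [I * J], where the two iterated sums are
    exchanged. It serves the antidiagonals of a double series and the outcomes of the residual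
    measurement. *)
Lemma csum_fiber (I J : choiceType) (g : I -> J) (f : I -> R[i]) : csm f ->
  (forall j, csm (fun i => (g i == j)%:R * f i)) /\
  csm (fun j => csum (fun i => (g i == j)%:R * f i)) /\
  csum f = csum (fun j => csum (fun i => (g i == j)%:R * f i)).
Proof.
move=> sf.
have z i j : j != g i -> (g i == j)%:R * f i = 0.
  by rewrite eq_sym => /negbTE ->; rewrite mul0r.
have s1 : csm (fun p : I * J => (g p.1 == p.2)%:R * f p.1).
  apply: csm_pairP => [i /=|].
    by apply: (csm_single (i0 := g i)) => j; exact: z.
  apply: eq_asum sf => i /=.
  rewrite (rsum_single (i0 := g i)) ?eqxx ?mul1r// => j ji.
  by rewrite z// cabs0.
have be : bijective (fun p : J * I => (p.2, p.1)) by exists (fun p => (p.2, p.1)) => -[].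
have s2 : csm (fun p : J * I => (g p.2 == p.1)%:R * f p.2) := (csm_bij _ be).1 s1.
split; first by move=> j; exact: (csm_slice j s2).
split; first exact: (csm_csum s2).
rewrite -(csum_swap s1); apply: eq_csum => i.
by rewrite (csum_single (i0 := g i)) ?eqxx ?mul1r// => j /z.
Qed.

Lemma csum_antidiag (f : nat * nat -> R[i]) : csm f ->
  csm (fun j => \sum_(b < j.+1) f ((j - b)%N, b : nat)) /\
  csum f = csum (fun j => \sum_(b < j.+1) f ((j - b)%N, b : nat)).
Proof.
move=> sf; have [_ [s ->]] := csum_fiber (fun p : nat * nat => (p.1 + p.2)%N) sf.
have e j : csum (fun p : nat * nat => (p.1 + p.2 == j)%N%:R * f p) =
    \sum_(b < j.+1) f ((j - b)%N, b : nat).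
  pose s' := [seq ((j - b)%N, b) | b <- iota 0 j.+1].
  rewrite (csum_fin (s := s')).
  - rewrite big_map -[iota 0 _]/(index_iota 0 j.+1) big_mkord; apply: eq_bigr => b _ /=.
    by rewrite subnK ?eqxx ?mul1r// -ltnS.
  - by rewrite map_inj_uniq ?iota_uniq// => x y [].
  - move=> [a b] ab; case: eqP => //= [abj|_]; last by rewrite mul0r.
    move: ab; rewrite (_ : (a, b) = ((j - b)%N, b)) ?map_f//; last by rewrite -abj addnK.
      by rewrite mem_iota add0n ltnS -abj leq_addl.
split; first by apply: eq_csm s => j; rewrite e.
by apply: eq_csum => j; rewrite e.
Qed.

Lemma asum_series (f : nat -> R) : (forall i, 0 <= f i) -> cvgn (series f) -> asum f.
Proof.
move=> f0 cf; apply: (asum_boundP (c := limn (series f))) => s us.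
pose n := (\max_(i <- s) i).+1.
have sn : {subset s <= iota 0 n}.
  by move=> i si; rewrite mem_iota add0n ltnS /=; exact: leq_bigmax_seq.
have ps : \sum_(i <- s) `|f i| <= series f n.
  rewrite /series/= -[index_iota _ _]/(iota 0 (n - 0)) subn0.
  rewrite [leRHS](bigID (mem s))/= -[leLHS]addr0 lerD ?sumr_ge0//.
  rewrite -[leRHS]big_filter le_eqVlt; apply/orP; left; apply/eqP.
  rewrite (eq_bigr f) => [|i _]; last by rewrite ger0_norm.
  apply: perm_big; apply: uniq_perm => [//||i]; first by rewrite filter_uniq// (iota_uniq 0 n).
  by rewrite mem_filter; have [/sn ->|] := boolP (i \in s).
apply: le_trans ps _; apply: nondecreasing_cvgn_le => //.
by apply/nondecreasing_seqP => k; rewrite /series/= big_nat_recr//= lerDl.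
Qed.

(** The size of the j-th term of the displacement series on a number state: the power of the
    generator contributes x^j sqrt (j!) and the exponential contributes 1 / j!. *)
Definition rootexp (x : R) (j : nat) : R := x ^+ j / Num.sqrt j`!%:R.

Lemma rootexp_ge0 (x : R) j : 0 <= x -> 0 <= rootexp x j.
Proof. by move=> x0; rewrite mulr_ge0 ?exprn_ge0// invr_ge0 sqrtr_ge0. Qed.

(* x^j / sqrt j! is at most the geometric mean of 2^-j and (2 x^2)^j / j!. *)
Lemma asum_rootexp (x : R) : 0 <= x -> asum (rootexp x).
Proof.
move=> x0.
have s1 : asum (fun j => 2^-1 ^+ j : R).
  apply: asum_series; first by move=> i; rewrite exprn_ge0// invr_ge0.
  have -> : GRing.exp 2^-1 = geometric 1 (2^-1 : R).
    by apply/funext => i; rewrite /geometric/= mul1r.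
  apply: is_cvg_geometric_series.
  by rewrite ger0_norm ?invr_ge0// invf_lt1 ?ltr1n.
have s2 : asum (exp_coeff (2 * x ^+ 2)).
  apply: asum_series; last exact: is_cvg_series_exp_coeff.
  by move=> i; rewrite /exp_coeff/= divr_ge0// exprn_ge0// mulr_ge0// sqr_ge0.
apply: asum_le (asumD s1 s2) => j; rewrite ger0_norm ?rootexp_ge0//.
set a := 2^-1 ^+ j; set b := exp_coeff _ j.
have a0 : 0 <= a by rewrite exprn_ge0// invr_ge0.
have b0 : 0 <= b by rewrite /b /exp_coeff/= divr_ge0// exprn_ge0// mulr_ge0// sqr_ge0.
have j0 : 0 < (j`!%:R : R) by rewrite ltr0n fact_gt0.
have e : rootexp x j ^+ 2 = a * b.
  rewrite /rootexp expr_div_n sqr_sqrtr ?(ltW j0)// /a /b /exp_coeff/= mulrA -exprMn.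
  by rewrite mulrA mulVf// mul1r exprAC.
have t0 := rootexp_ge0 j x0.
rewrite -(ler_pXn2r (ltn0Sn 1)) ?nnegrE ?addr_ge0// e.
move: a0 b0; nra.
Qed.

End Fiber.

(** * Powers of tridiagonal operators *)

Section Tridiagonal.
Context {C : comPzRingType} (up dn : nat -> C).

(** At [k = 0] the value [f k.-1] is the spurious [f 0]; in both instances below its coefficient
    contains sqrt 0. *)
Definition tridiag (f : nat -> C) (k : nat) : C := up k * f k.-1 + dn k * f k.+1.

(** From [i], [a] steps reach no index beyond [i + a], so the expansion over basis sequences is
    finite and any larger cutoff [B] will do. *)
Lemma iter_tridiag_expand a f i B : (i + a < B)%N ->
  iter a tridiag f i = \sum_(m < B) iter a tridiag (fun l => (l == m)%:R) i * f m.
Proof.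
elim: a i B => [|a ih] i B iB.
  rewrite /= (bigD1 (Ordinal (leq_ltn_trans (leq_addr _ _) iB)))//= eqxx mul1r.
  rewrite big1 ?addr0// => m mi; case: eqP => [im|]; last by rewrite mul0r.
  by move/eqP: mi; case; exact: val_inj.
rewrite !iterS /tridiag (ih _ B) ?(ih i.+1 B).
- rewrite !mulr_sumr -big_split/=; apply: eq_bigr => m _.
  by rewrite mulrDl !mulrA.
- by rewrite -addSnnS in iB.
- by apply: leq_ltn_trans iB; rewrite leq_add ?leq_pred.
Qed.

Lemma iter_tridiagD a f g i :
  iter a tridiag (fun l => f l + g l) i = iter a tridiag f i + iter a tridiag g i.
Proof.
rewrite !(@iter_tridiag_expand a _ i (i + a).+1)// -big_split/=.
by apply: eq_bigr => m _; rewrite mulrDr.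
Qed.

Lemma iter_tridiagZ a c f i :
  iter a tridiag (fun l => c * f l) i = c * iter a tridiag f i.
Proof.
rewrite !(@iter_tridiag_expand a _ i (i + a).+1)// mulr_sumr.
by apply: eq_bigr => m _; rewrite mulrCA.
Qed.

Lemma iter_tridiag_far a k i : (i + a < k)%N ->
  iter a tridiag (fun l => (l == k)%:R) i = 0.
Proof.
elim: a i => [|a ih] i ik.
  by rewrite addn0 in ik; rewrite /= (ltn_eqF ik).
rewrite iterS /tridiag !ih ?mulr0 ?addr0//.
  by rewrite -addSnnS in ik.
by apply: leq_ltn_trans ik; rewrite leq_add ?leq_pred.
Qed.

End Tridiagonal.

(** * The displacement series and its unitarity *)

Section Displacement.
Context {R : realType}.
Implicit Types (z : R[i]).

Definition dlt (k : nat) : nat -> R[i] := fun l => (l == k)%:R.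

Definition sq (k : nat) : R[i] := (Num.sqrt (k%:R : R))%:C.

Lemma conj_sq k : (sq k)^* = sq k.
Proof. exact: conj_real. Qed.

Lemma disp_genE z : disp_gen z = tridiag (fun k => z * sq k) (fun k => - (z^* * sq k.+1)).
Proof.
by apply/funext => f; apply/funext => k; rewrite /disp_gen /tridiag /creat /annih mulNr !mulrA.
Qed.

(* [r (a^dagger + a)], which dominates [disp_gen z] entrywise when [r = |z|]. *)
Definition majorant_gen (r : R) : (nat -> R) -> nat -> R :=
  tridiag (fun k => r * Num.sqrt k%:R) (fun k => r * Num.sqrt k.+1%:R).

Definition majgen (r : R) (j k i : nat) : R := iter j (majorant_gen r) (fun l => (l == k)%:R) i.

Lemma majgen_ge0 r j k i : 0 <= r -> 0 <= majgen r j k i.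
Proof.
move=> r0; rewrite /majgen; elim: j i => [|j ih] i /=; first by rewrite ler0n.
by rewrite addr_ge0// !mulr_ge0// ?sqrtr_ge0.
Qed.

Lemma cabs_iter_disp_gen z j k i :
  cabs (iter j (disp_gen z) (dlt k) i) <= majgen (cabs z) j k i.
Proof.
rewrite /majgen; elim: j i => [|j ih] i; first by rewrite /= cabs_nat.
rewrite !iterS disp_genE -disp_genE /majorant_gen {1}disp_genE /tridiag.
apply: le_trans (cabsD _ _) _; rewrite !cabsM cabsN cabsM cabs_conj.
rewrite !cabs_real !ger0_norm ?sqrtr_ge0//.
by rewrite lerD// ler_wpM2l ?mulr_ge0 ?sqrtr_ge0 ?cabs_ge0.
Qed.

Lemma majgen_far r j k i : (k + j < i)%N -> majgen r j k i = 0.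
Proof.
rewrite /majgen; elim: j i => [|j ih] i ki /=.
  by rewrite addn0 in ki; rewrite (gtn_eqF ki).
rewrite /majorant_gen /tridiag !ih ?mulr0 ?addr0//.
  by apply: leq_trans (leqW (ltnW ki)); rewrite addnS.
by case: i ki => // i; rewrite addnS ltnS.
Qed.

(** After j steps the support ends at k + j, so the next step meets coefficients at most r sqrt (k +
    j + 1), once from each of the two neighbours. *)
Lemma majgen_bound r j k i : 0 <= r ->
  majgen r j k i <= (2 * r) ^+ j * Num.sqrt (k + j)`!%:R.
Proof.
move=> r0; elim: j i => [|j ih] i.
  rewrite expr0 mul1r addn0 /majgen/=; apply: le_trans (_ : 1 <= _).
    by case: (_ == _); rewrite ?ler01.
  by rewrite -[leLHS]sqrtr1 ler_sqrt ?ltr01// ler1n fact_gt0.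
pose M := (2 * r) ^+ j * Num.sqrt (k + j)`!%:R : R.
have M0 : 0 <= M by rewrite mulr_ge0 ?exprn_ge0 ?mulr_ge0 ?sqrtr_ge0.
have -> : (2 * r) ^+ j.+1 * Num.sqrt (k + j.+1)`!%:R =
    r * Num.sqrt (k + j).+1%:R * M + r * Num.sqrt (k + j).+1%:R * M.
  rewrite addnS factS natrM sqrtrM// exprS /M; ring.
have s0 (x : R) : 0 <= Num.sqrt x by exact: sqrtr_ge0.
rewrite /majgen iterS /majorant_gen /tridiag -/(majorant_gen r) -!/(majgen r j k _).
have sle a b : (a <= b)%N -> Num.sqrt a%:R <= Num.sqrt b%:R :> R.
  by move=> ab; rewrite ler_wsqrtr// ler_nat.
apply: lerD.
  have [ik|ik] := leqP i.-1 (k + j); last first.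
    by rewrite majgen_far// mulr0 (mulr_ge0 (mulr_ge0 r0 (s0 _)) M0).
  apply: ler_pM; [exact: mulr_ge0|exact: majgen_ge0| |exact: ih].
  by rewrite ler_wpM2l// sle// (leq_trans (leqSpred i)).
have [ik|ik] := leqP i.+1 (k + j); last first.
  by rewrite majgen_far// mulr0 (mulr_ge0 (mulr_ge0 r0 (s0 _)) M0).
apply: ler_pM; [exact: mulr_ge0|exact: majgen_ge0| |exact: ih].
by rewrite ler_wpM2l// sle// leqW.
Qed.

Lemma fact_add_le a b : ((a + b)`! <= 2 ^ (a + b) * (a`! * b`!))%N.
Proof.
rewrite -(@bin_fact (a + b) a) ?leq_addr// addKn leq_mul2r; apply/orP; right.
rewrite -[X in (X ^ _)%N]/(1 + 1)%N Pascal.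
have ab : (a < (a + b).+1)%N by rewrite ltnS leq_addr.
by rewrite (bigD1 (Ordinal ab))//= !exp1n !muln1 leq_addr.
Qed.

(** Splitting (k + a + b)! twice by [fact_add_le] makes the bound a product in a and b, hence
    summable over pairs. The first splitting leaves the constant sqrt (2^k k!), and together they
    replace 2 r by 4 r. *)
Lemma majgen_rootexp r k : 0 <= r -> exists x c : R, 0 <= x /\ 0 <= c /\
  forall a b i, majgen r (a + b) k i / (a`!%:R * b`!%:R) <= c * (rootexp x a * rootexp x b).
Proof.
move=> r0; exists (2 * r * 2), (Num.sqrt (2 ^ k * k`!)%N%:R).
have s0 (x : R) : 0 <= Num.sqrt x by exact: sqrtr_ge0.
split; first by rewrite !mulr_ge0.
split=> // a b i.
have fa0 m : 0 < (m`!%:R : R) by rewrite ltr0n fact_gt0.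
have sfa m : 0 < Num.sqrt (m`!%:R : R) by rewrite sqrtr_gt0.
rewrite ler_pdivrMr ?mulr_gt0//.
apply: le_trans (majgen_bound (a + b) k i r0) _.
have : Num.sqrt (k + (a + b))`!%:R <= Num.sqrt (2 ^ k * k`!)%N%:R *
    (2 ^+ (a + b)) * (Num.sqrt a`!%:R * Num.sqrt b`!%:R) :> R.
  have -> : 2 ^+ (a + b) = Num.sqrt ((2 ^ (a + b) * 2 ^ (a + b))%N%:R) :> R.
    by rewrite natrM -expr2 sqrtr_sqr natrX ger0_norm// exprn_ge0.
  rewrite -!sqrtrM ?ler0n// ler_wsqrtr// -!natrM ler_nat.
  apply: leq_trans (fact_add_le _ _) _; rewrite expnD.
  apply: leq_trans (leq_mul (leqnn _) (leq_mul (leqnn _) (fact_add_le a b))) _.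
  by apply/eq_leq; ring.
move=> h; apply: le_trans (ler_wpM2l _ h) _; first by rewrite exprn_ge0 ?mulr_ge0.
have ea m : (m`!%:R : R) = Num.sqrt m`!%:R * Num.sqrt m`!%:R.
  by rewrite -expr2 sqr_sqrtr// ltW.
rewrite /rootexp !exprMn !exprD le_eqVlt; apply/orP; left; apply/eqP.
have -> : (a`!%:R * b`!%:R : R) =
    Num.sqrt a`!%:R * Num.sqrt a`!%:R * (Num.sqrt b`!%:R * Num.sqrt b`!%:R) by rewrite -!ea.
by field; rewrite !gt_eqF.
Qed.

Definition Dterm z m k j : R[i] := j`!%:R^-1 * iter j (disp_gen z) (dlt k) m.

Definition Dmx z m k : R[i] := csum (Dterm z m k).

Lemma fact_cabs j (c : R[i]) : cabs (j`!%:R^-1 * c) = cabs c / j`!%:R.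
Proof.
rewrite cabsM mulrC; congr (_ * _).
have j0 : (j`!%:R : R[i]) != 0 by rewrite pnatr_eq0 -lt0n fact_gt0.
have j0' : (j`!%:R : R) != 0 by rewrite pnatr_eq0 -lt0n fact_gt0.
apply: (mulfI j0'); rewrite mulfV// -{1}[j`!%:R]cabs_nat -cabsM mulfV// cabs1//.
Qed.

Lemma Dterm_csm z m k : csm (Dterm z m k).
Proof.
have [x [c [x0 [c0 h]]]] := majgen_rootexp k (cabs_ge0 z).
apply: csm_le (asumZ c (asum_rootexp x0)) => j.
rewrite fact_cabs; have := h j 0%N m.
rewrite addn0 fact0 mulr1 [rootexp x 0]/rootexp expr0 fact0 sqrtr1 divr1 mulr1.
apply: le_trans; rewrite ler_wpM2r ?invr_ge0 ?ler0n//.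
exact: cabs_iter_disp_gen.
Qed.

Lemma iter_disp_genN z j k i :
  iter j (disp_gen (- z)) (dlt k) i = (-1) ^+ j * iter j (disp_gen z) (dlt k) i.
Proof.
elim: j i => [|j ih] i; first by rewrite mul1r.
rewrite !iterS /disp_gen /creat /annih !ih exprS rmorphN/=; ring.
Qed.

Lemma disp_gen1 z f k : disp_gen z f k =
  z * (sq k * f k.-1) - z^* * (sq k.+1 * f k.+1).
Proof. by []. Qed.

Lemma disp_gen_dlt z k : disp_gen z (dlt k) =
  fun l => z * sq k.+1 * dlt k.+1 l + (- (z^* * sq k)) * dlt k.-1 l.
Proof.
apply/funext => l; rewrite /disp_gen /creat /annih /dlt; congr (_ + _).
  case: l => [|l] /=.
    by rewrite sqrtr0 mul0r !mulr0.
  rewrite eqSS; case: eqP => [->|_]; last by rewrite !mulr0.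
  by rewrite -mulrA.
case: k => [|k] /=; first by rewrite !mulr0 /sq sqrtr0 mulr0 oppr0 mul0r.
by rewrite eqSS; case: eqP => [->|_]; rewrite ?mulr0 ?oppr0// !mulr1.
Qed.

(** The generator is anti-Hermitian. The transposition is an induction that peels off the outermost
    factor on one side and the innermost on the other. *)
Lemma iter_disp_gen_conj z j k i :
  (iter j (disp_gen z) (dlt k) i)^* = iter j (disp_gen (- z)) (dlt i) k.
Proof.
elim: j i k => [|j ih] i k.
  by rewrite /= /dlt conj_nat eq_sym.
rewrite iterS iterSr disp_gen_dlt [in RHS]disp_genE iter_tridiagD !iter_tridiagZ -disp_genE.
rewrite -!ih disp_gen1 conjD !conjN !conjM conjCK !conj_sq.
by ring.
Qed.

Lemma Dmx_conj z m k : (Dmx z m k)^* = Dmx (- z) k m.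
Proof.
rewrite /Dmx -csum_conj; last exact: Dterm_csm.
apply: eq_csum => j; rewrite /Dterm conjM iter_disp_gen_conj; congr (_ * _).
by rewrite fmorphV/= conj_nat.
Qed.

Lemma csum_disp_expand z j (f : nat -> R[i]) i :
  csm (fun m => iter j (disp_gen z) (dlt m) i * f m) /\
  csum (fun m => iter j (disp_gen z) (dlt m) i * f m) = iter j (disp_gen z) f i.
Proof.
have z0 m : m \notin iota 0 (i + j).+1 -> iter j (disp_gen z) (dlt m) i * f m = 0.
  rewrite mem_iota add0n -leqNgt /= => im.
  by rewrite {1}disp_genE iter_tridiag_far ?mul0r.
split; first by apply: csm_fin z0; exact: iota_uniq.
rewrite [in RHS]disp_genE (iter_tridiag_expand _ _ _ (ltnSn (i + j))) -!disp_genE.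
by rewrite (csum_fin (iota_uniq _ _) z0) -[iota 0 _]/(index_iota 0 (i + j).+1) big_mkord.
Qed.

Lemma rsum_majgen r a b i k : 0 <= r ->
  asum (fun m => majgen r a m i * majgen r b k m) /\
  rsum (fun m => majgen r a m i * majgen r b k m) = majgen r (a + b) k i.
Proof.
move=> r0; have z m : m \notin iota 0 (i + a).+1 -> majgen r a m i * majgen r b k m = 0.
  rewrite mem_iota add0n -leqNgt /= => im.
  by rewrite {1}/majgen iter_tridiag_far ?mul0r.
split; first by apply: (asum_fin (s := iota 0 (i + a).+1)) => //; exact: iota_uniq.
rewrite /majgen iterD (iter_tridiag_expand _ _ _ (ltnSn (i + a))).
rewrite (rsum_fin (s := iota 0 (i + a).+1)) ?iota_uniq//.
by rewrite -[iota 0 _]/(index_iota 0 (i + a).+1) big_mkord.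
Qed.

Lemma alternating_fact j : (0 < j)%N ->
  \sum_(b < j.+1) ((j - b)`!%:R^-1 * b`!%:R^-1 * (-1) ^+ b : R[i]) = 0.
Proof.
move=> j0; have f0 m : (m`!%:R : R[i]) != 0 by rewrite pnatr_eq0 -lt0n fact_gt0.
apply: (mulfI (f0 j)); rewrite mulr0 mulr_sumr.
have := exprDn (1 : R[i]) (-1) j; rewrite subrr expr0n (gtn_eqF j0) => /esym e; rewrite -[RHS]e.
apply: eq_bigr => b _; rewrite expr1n mul1r -[RHS]mulr_natl mulrA; congr (_ * _).
have bj : (b <= j)%N by rewrite -ltnS.
have -> : (j`!%:R : R[i]) = 'C(j, b)%:R * (b`!%:R * (j - b)`!%:R).
  by rewrite -!natrM bin_fact.
by field; rewrite !f0.
Qed.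

(* exp(A) exp(-A) = 1, as an absolutely convergent double series. *)
Lemma Dmx_mul z i k :
  csm (fun m => Dmx z i m * Dmx (- z) m k) /\
  csum (fun m => Dmx z i m * Dmx (- z) m k) = (i == k)%:R.
Proof.
pose F (p : nat * (nat * nat)) :=
  Dterm z i p.1 p.2.1 * Dterm (- z) p.1 k p.2.2.
pose F' (q : (nat * nat) * nat) := F (q.2, q.1).
have be : bijective (fun p : nat * (nat * nat) => (p.2, p.1)).
  by exists (fun p => (p.2, p.1)) => -[].
have r0 := cabs_ge0 z.
have bF (ab : nat * nat) m : cabs (F' (ab, m)) <=
    (ab.1`!%:R * ab.2`!%:R)^-1 * (majgen (cabs z) ab.1 m i * majgen (cabs z) ab.2 k m).
  rewrite /F' /F /= cabsM !fact_cabs invfM.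
  have := cabs_iter_disp_gen z ab.1 m i; have := cabs_iter_disp_gen (- z) ab.2 k m.
  rewrite cabsN => h1 h2.
  have -> : forall x y u v : R, x / u * (y / v) = u^-1 / v * (x * y) by move=> *; ring.
  by rewrite ler_wpM2l ?mulr_ge0 ?invr_ge0// ler_pM ?cabs_ge0.
have sF' : csm F'.
  have [x [c [x0 [c0 h]]]] := majgen_rootexp k r0.
  have sx := asum_rootexp x0.
  have sl ab : csm (fun m => F' (ab, m)).
    apply: csm_le (bF ab) _; apply: asumZ; exact: (rsum_majgen _ _ _ _ r0).1.
  apply: csm_pairP => //.
  have sp : asum (fun p : nat * nat => rootexp x p.1 * rootexp x p.2).
    apply: asum_pairP; rewrite (eq_esum (b := fun a =>
      ((rsum (rootexp x))%:E * (`|rootexp x a|)%:E)%E)).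
      rewrite esumZ//; last by apply: rsum_pos => j; exact: rootexp_ge0.
      by rewrite lte_mul_pinfty ?lee_fin//; apply: rsum_pos => j; exact: rootexp_ge0.
    move=> a _; rewrite muleC rsum_ge0// -?esumZ//; last by move=> j; exact: rootexp_ge0.
      apply: eq_esum => b _ /=; rewrite normrM EFinM (ger0_norm (rootexp_ge0 b x0)).
      by rewrite ger0_norm ?rootexp_ge0.
    by move=> b; rewrite lee_fin rootexp_ge0.
  apply: asum_le (asumZ c sp) => ab.
  rewrite ger0_norm; last by apply: rsum_pos => j; exact: cabs_ge0.
  apply: le_trans (h ab.1 ab.2 i); rewrite mulrC.
  have [s e] := rsum_majgen ab.1 ab.2 i k r0.
  rewrite -e -rsumZ//; apply: rsum_le; [exact: sl|exact: asumZ|].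
  by move=> m; exact: bF.
have sF : csm F := (csm_bij F' be).1 sF'.
have eF m : csum (fun ab => F (m, ab)) = Dmx z i m * Dmx (- z) m k.
  by rewrite (csum_prod (Dterm_csm z i m) (Dterm_csm (- z) m k)).
split; first by apply: eq_csm (csm_csum sF) => m; exact: eF.
have -> : csum (fun m => Dmx z i m * Dmx (- z) m k) = csum F'.
  rewrite (csum_bij F' be) (csum_pair sF); apply: eq_csum => m; exact: esym (eF m).
rewrite (csum_pair sF').
(* Summing over m first composes the two powers into one of order a + b, up to the sign (-1)^b; the
   alternating binomial sum then cancels every order but 0. *)
have e2 (ab : nat * nat) : csum (fun m => F' (ab, m)) =
   ab.1`!%:R^-1 * ab.2`!%:R^-1 * (-1) ^+ ab.2 * iter (ab.1 + ab.2) (disp_gen z) (dlt k) i.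
  have [sD eD] := csum_disp_expand z ab.1 (iter ab.2 (disp_gen z) (dlt k)) i.
  rewrite iterD -eD -csumZ//; apply: eq_csum => m; rewrite /F' /F /Dterm /= iter_disp_genN; ring.
have s2 := csm_csum sF'.
have [_ ->] := csum_antidiag s2.
rewrite (csum_single (i0 := 0%N)).
  by rewrite big_ord1 e2 /= fact0 invr1 !mul1r /dlt.
move=> j; rewrite -lt0n => j0.
rewrite (eq_bigr (fun b : 'I_j.+1 => (j - b)`!%:R^-1 * b`!%:R^-1 * (-1) ^+ b *
   iter j (disp_gen z) (dlt k) i)) => [|b _]; last by rewrite e2 /= subnK// -ltnS.
by rewrite -mulr_suml alternating_fact// mul0r.
Qed.

Lemma Dmx_unimx z : unimx (Dmx z).
Proof.
split=> j k.
  have [s e] := Dmx_mul (- z) j k; rewrite opprK in s e.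
  by split; [apply: eq_csm s|rewrite -e; apply: eq_csum] => i; rewrite Dmx_conj.
have [s e] := Dmx_mul z j k.
by split; [apply: eq_csm s|rewrite -e; apply: eq_csum] => i; rewrite conjCK Dmx_conj.
Qed.

Lemma Dmx0 m k : Dmx 0 m k = (m == k)%:R.
Proof.
rewrite /Dmx (csum_single (i0 := 0%N)) => [|[//|j] _].
  by rewrite /Dterm fact0 invr1 mul1r.
by rewrite /Dterm iterS /disp_gen conjC0 !mul0r subrr mulr0.
Qed.

End Displacement.

(** * Product bases and thermal weights *)

Section Tuples.
Context {R : realType}.

Definition tcons n (p : nat * n.-tuple nat) : n.+1.-tuple nat := [tuple of p.1 :: p.2].

Lemma tcons_bij n : bijective (@tcons n).
Proof.
exists (fun t => (thead t, [tuple of behead t])) => [[x t]|t].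
  by congr (_, _); apply: val_inj.
by rewrite /tcons /= [RHS]tuple_eta; apply: val_inj.
Qed.

Lemma behead_tcons n (p : nat * n.-tuple nat) : [tuple of behead (tcons p)] = p.2.
Proof. exact: val_inj. Qed.

Lemma tcons_eq n (p q : nat * n.-tuple nat) :
  (tcons p == tcons q) = (p.1 == q.1) && (p.2 == q.2).
Proof. by rewrite (bij_eq (tcons_bij n)). Qed.

Lemma tnth_tcons0 n (p : nat * n.-tuple nat) : tnth (tcons p) ord0 = p.1.
Proof. by []. Qed.

Lemma tnth_tconsS n (p : nat * n.-tuple nat) i : tnth (tcons p) (lift ord0 i) = tnth p.2 i.
Proof. by rewrite !(tnth_nth 0%N). Qed.

Definition tprod (C : pzSemiRingType) n (f : 'I_n -> nat -> C) (k : n.-tuple nat) : C :=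
  \prod_(i < n) f i (tnth k i).

Lemma tprod_tcons (C : pzSemiRingType) n (f : 'I_n.+1 -> nat -> C) p :
  tprod f (tcons p) = f ord0 p.1 * tprod (fun i => f (lift ord0 i)) p.2.
Proof.
rewrite /tprod big_ord_recl tnth_tcons0; congr (_ * _).
by apply: eq_bigr => i _; rewrite tnth_tconsS.
Qed.

Lemma csum_tprod n (f : 'I_n -> nat -> R[i]) : (forall i, csm (f i)) ->
  csm (tprod f) /\ csum (tprod f) = \prod_(i < n) csum (f i).
Proof.
elim: n f => [|n ih] f sf.
  have z (k : 0.-tuple nat) : k != [tuple] -> tprod f k = 0 by rewrite tuple0 eqxx.
  by rewrite (csum_single z) /tprod !big_ord0; split=> //; exact: csm_single z.
have [s e] := ih (fun i => f (lift ord0 i)) (fun i => sf _).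
have e' : tprod f \o @tcons n = fun p => f ord0 p.1 * tprod (fun i => f (lift ord0 i)) p.2.
  by apply/funext => p; exact: tprod_tcons.
split; first by apply/(csm_bij _ (tcons_bij n)); rewrite e'; exact: csm_prod.
by rewrite (csum_bij _ (tcons_bij n)) e' csum_prod// big_ord_recl e.
Qed.

Lemma csm_real (I : choiceType) (f : I -> R) : asum f <-> csm (fun i => (f i)%:C).
Proof.
split=> [/asum_abs|] sf; first by apply: csm_le sf => i; rewrite cabs_real.
by apply: asum_le sf => i; rewrite cabs_real.
Qed.

Lemma rsum_tprod n (f : 'I_n -> nat -> R) : (forall i, asum (f i)) ->
  asum (tprod f) /\ rsum (tprod f) = \prod_(i < n) rsum (f i).
Proof.
move=> sf; have [s e] := @csum_tprod n (fun i k => (f i k)%:C) (fun i => (csm_real _).1 (sf i)).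
have e' : tprod (fun i k => (f i k)%:C) = fun k => (tprod f k)%:C.
  by apply/funext => k; rewrite /tprod rmorph_prod.
rewrite e' in s e; split; first exact/csm_real.
apply: (complexI (R := R)); rewrite -csum_real e rmorph_prod/=.
by apply: eq_bigr => i _; rewrite csum_real.
Qed.

Lemma prod_tnth_eq n (k l : n.-tuple nat) :
  \prod_(i < n) (tnth k i == tnth l i)%:R = (k == l)%:R :> R[i].
Proof.
have [->|kl] := eqVneq k l; first by rewrite big1// => i _; rewrite eqxx.
suff [i ki] : exists i, tnth k i != tnth l i by rewrite (bigD1 i)//= (negbTE ki) mul0r.
apply/existsP; rewrite -negb_forall; apply: contra kl => /forallP e.
by apply/eqP/eq_from_tnth => i; exact/eqP.
Qed.

Definition tpowmx n (A : nat -> nat -> R[i]) (k l : n.-tuple nat) : R[i] :=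
  \prod_(i < n) A (tnth k i) (tnth l i).

Lemma colortho_tpow n A : colortho A -> colortho (@tpowmx n A).
Proof.
move=> cA j k; have [s e] := csum_tprod (fun i => (cA (tnth j i) (tnth k i)).1).
have e' : tprod (fun i m => (A m (tnth j i))^* * A m (tnth k i)) =
    fun m => (@tpowmx n A m j)^* * tpowmx A m k.
  by apply/funext => m; rewrite /tpowmx rmorph_prod/= -big_split.
rewrite e' in s e; split; rewrite // e -prod_tnth_eq.
by apply: eq_bigr => i _; exact: (cA _ _).2.
Qed.

Lemma unimx_tpow n A : unimx A -> unimx (@tpowmx n A).
Proof.
move=> [cA rA]; split; first exact: colortho_tpow.
have := @colortho_tpow n _ rA; rewrite (_ : tpowmx _ = fun i j => (tpowmx A j i)^*)//.
by apply/funext => i; apply/funext => j; rewrite /tpowmx rmorph_prod.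
Qed.

Definition tensmx n (A : nat -> nat -> R[i]) (B : n.-tuple nat -> n.-tuple nat -> R[i])
    (k l : n.+1.-tuple nat) : R[i] :=
  A (head 0%N k) (head 0%N l) * B [tuple of behead k] [tuple of behead l].

Lemma tensmx_tcons n A B (p q : nat * n.-tuple nat) :
  tensmx A B (tcons p) (tcons q) = A p.1 q.1 * B p.2 q.2.
Proof. by congr (_ * B _ _); apply: val_inj. Qed.

Lemma colortho_tens n A B : colortho A -> colortho B -> colortho (@tensmx n A B).
Proof.
move=> cA cB j k.
have [[jj jK Kj] [kk kK Kk]] := (tcons_bij n, tcons_bij n).
rewrite -(Kj j) -(Kj k); move: (jj j) (jj k) => {jK Kj kK Kk jj kk} {}j {}k.
have [[sA eA] [sB eB]] := (cA j.1 k.1, cB j.2 k.2).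
have e : (fun i => (tensmx A B i (tcons j))^* * tensmx A B i (tcons k)) \o @tcons n =
    fun p => ((A p.1 j.1)^* * A p.1 k.1) * ((B p.2 j.2)^* * B p.2 k.2).
  by apply/funext => p /=; rewrite !tensmx_tcons conjM; ring.
split; first by apply: (csm_bij _ (tcons_bij n)).2; rewrite e; exact: (csm_prod sA sB).
by rewrite (csum_bij _ (tcons_bij n)) e (csum_prod sA sB) eA eB tcons_eq -natrM mulnb.
Qed.

Lemma unimx_tens n A B : unimx A -> unimx B -> unimx (@tensmx n A B).
Proof.
move=> [cA rA] [cB rB]; split; first exact: colortho_tens.
have := @colortho_tens n _ _ rA rB; rewrite (_ : tensmx _ _ = fun i j => (tensmx A B j i)^*)//.
by apply/funext => i; apply/funext => j; rewrite /tensmx conjM.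
Qed.

Lemma colortho_id (I : choiceType) : colortho (fun i j : I => (i == j)%:R : R[i]).
Proof.
move=> j k; have z i : i != j -> ((i == j)%:R : R[i])^* * (i == k)%:R = 0.
  by move=> /negbTE ->; rewrite conj_nat mul0r.
by rewrite (csum_single z) eqxx conj_nat mul1r; split=> //; exact: csm_single z.
Qed.

Lemma unimx_id (I : choiceType) : unimx (fun i j : I => (i == j)%:R : R[i]).
Proof.
split; first exact: colortho_id.
rewrite (_ : (fun i j => _) = fun i j : I => (i == j)%:R); first exact: colortho_id.
by apply/funext => i; apply/funext => j; rewrite conj_nat eq_sym.
Qed.

End Tuples.

Section Thermal.
Context {R : realType}.
Implicit Types (z : R[i]) (N : R).

(* [thw N] and [tw N] are the eigenvalues of the thermal state and of its tensor power. *)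
Definition thw N (k : nat) : R := (N + 1)^-1 * (N / (N + 1)) ^+ k.

Lemma thw_ge0 N k : 0 < N -> 0 <= thw N k.
Proof.
move=> /ltW N0; have N1 : 0 <= N + 1 by rewrite addr_ge0.
by rewrite mulr_ge0 ?exprn_ge0 ?divr_ge0 ?invr_ge0.
Qed.

Lemma ratio_lt1 N : 0 < N -> 0 < N / (N + 1) < 1.
Proof.
move=> N0; have N1 : 0 < N + 1 by rewrite addr_gt0.
by rewrite divr_gt0//= ltr_pdivrMr// mul1r ltrDl.
Qed.

Lemma rsum_geometric (a x : R) : 0 <= a -> 0 <= x < 1 ->
  asum (fun k => a * x ^+ k) /\ rsum (fun k => a * x ^+ k) = a * (1 - x)^-1.
Proof.
move=> a0 /andP[x0 x1].
have c : series (geometric a x) @ \oo --> a * (1 - x)^-1.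
  by apply: cvg_geometric_series; rewrite ger0_norm.
have s : asum (geometric a x).
  apply: asum_series; last by apply/cvg_ex; eexists; exact: c.
  by move=> i; rewrite /geometric/= mulr_ge0 ?exprn_ge0.
split=> //; have := series_cvg_rsum s => /(cvg_unique _)/(_ c); apply.
exact: norm_hausdorff.
Qed.

Lemma rsum_thw N : 0 < N -> asum (thw N) /\ rsum (thw N) = 1.
Proof.
move=> N0; have N1 : 0 < N + 1 by rewrite addr_gt0.
have /andP[r0 r1] := ratio_lt1 N0.
have i0 : 0 <= (N + 1)^-1 by rewrite invr_ge0 ltW.
have r01 : 0 <= N / (N + 1) < 1 by rewrite (ltW r0).
have [s e] := rsum_geometric i0 r01.
split=> //; rewrite [LHS]e; field.
by rewrite !gt_eqF// (_ : N + 1 - N = 1) ?ltr01//; ring.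
Qed.

Definition tw N n : n.-tuple nat -> R := tprod (fun=> thw N).

Lemma tw_ge0 N n (k : n.-tuple nat) : 0 < N -> 0 <= tw N k.
Proof. by move=> N0; rewrite prodr_ge0// => i _; exact: thw_ge0. Qed.

Lemma rsum_tw N n : 0 < N -> asum (@tw N n) /\ rsum (@tw N n) = 1.
Proof.
move=> N0; have [s e] := rsum_tprod (fun i : 'I_n => (rsum_thw N0).1).
by split=> //; rewrite e big1// => i _; exact: (rsum_thw N0).2.
Qed.

Lemma le_rsum (I : choiceType) (w : I -> R) k : (forall i, 0 <= w i) -> asum w ->
  cabs (w k)%:C <= rsum w.
Proof.
move=> w0 sw; rewrite cabs_real ger0_norm// -lee_fin rsum_ge0//.
rewrite (esumID [set k]) => [|? _]; last by rewrite lee_fin.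
rewrite setTI esum_set1 ?lee_fin// leeDl// esum_ge0// => ? _.
by rewrite lee_fin.
Qed.

Lemma thw_le1 N k : 0 < N -> cabs (thw N k)%:C <= 1.
Proof.
move=> N0; have [s e] := rsum_thw N0; rewrite -e; apply: le_rsum => // i.
exact: thw_ge0.
Qed.

Lemma tw_le1 N n (k : n.-tuple nat) : 0 < N -> cabs (tw N k)%:C <= 1.
Proof.
move=> N0; have [s e] := rsum_tw n N0; rewrite -e; apply: le_rsum => // i.
exact: tw_ge0.
Qed.

Lemma thermalE N : thermal N = diagop (fun k => (thw N k)%:C).
Proof. by []. Qed.

Lemma entry_conj_diag (I : choiceType) (Y : op R I) (w : I -> R[i]) (c : R) k l :
  bounded_op Y -> (forall i, cabs (w i) <= c) ->
  bounded_op (Y \o diagop w \o adj Y) /\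
  csm (fun m => entry Y k m * w m * (entry Y l m)^*) /\
  entry (Y \o diagop w \o adj Y) k l = csum (fun m => entry Y k m * w m * (entry Y l m)^*).
Proof.
move=> bY wc; have bA := adj_bounded bY; have bd := diag_bounded wc.
have bYd := bounded_comp bY bd.
split; first exact: bounded_comp.
have [s ->] := entry_comp (adj Y) k l bYd.
have e m : entry (Y \o diagop w) k m * entry (adj Y) m l =
    entry Y k m * w m * (entry Y l m)^*.
  rewrite entry_adj//; congr (_ * _).
  have [_ ->] := entry_comp (diagop w) k m bY.
  rewrite (csum_single (i0 := m)) => [|j jm]; rewrite (entry_diag _ _ wc).
    by rewrite eqxx mulr1.
  by rewrite (negbTE jm) !mulr0.
by split; [apply: eq_csm s|apply: eq_csum].
Qed.

Lemma entry_rho z N k l : 0 < N ->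
  csm (fun m => Dmx z k m * (thw N m)%:C * (Dmx z l m)^*) /\
  entry (rho z N) k l = csum (fun m => Dmx z k m * (thw N m)%:C * (Dmx z l m)^*).
Proof.
move=> N0; have [bD eD] := unimx_bounded (Dmx_unimx z).
have [_ [s e]] := entry_conj_diag k l bD (fun m => thw_le1 m N0).
have ee m : entry (mxop (Dmx z)) k m * (thw N m)%:C * (entry (mxop (Dmx z)) l m)^* =
  Dmx z k m * (thw N m)%:C * (Dmx z l m)^* by rewrite !eD.
by split; [apply: eq_csm s|rewrite [LHS]e; apply: eq_csum].
Qed.

(** The product of n sums is one sum over n-tuples. From here on the tensor power is a single
    diagonal operator conjugated by a unitary. *)
Lemma tpow_rho n z N : 0 < N ->
  @tpow R n (rho z N) =1 mxop (tpowmx (Dmx z)) \o diagop (fun k => (tw N k)%:C) \o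
    adj (mxop (tpowmx (Dmx z))).
Proof.
move=> N0; have [bD eD] := unimx_bounded (@unimx_tpow _ n _ (Dmx_unimx z)).
have H k l := entry_conj_diag k l bD (fun m => tw_le1 m N0).
apply: mxop_bounded => [|k l]; first by have [] := H [tuple of nseq n 0%N] [tuple of nseq n 0%N].
have [_ [_ ->]] := H k l.
have [s e] := csum_tprod (fun i => (entry_rho z (tnth k i) (tnth l i) N0).1).
transitivity (\prod_(i < n) csum (fun m =>
  Dmx z (tnth k i) m * (thw N m)%:C * (Dmx z (tnth l i) m)^*)).
  by apply: eq_bigr => i _; exact: (entry_rho _ _ _ N0).2.
rewrite -e; apply: eq_csum => m; rewrite !eD /tprod /tpowmx /tw /tprod.
by rewrite rmorph_prod/= [X in _ = _ * X]rmorph_prod/= -!big_split.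
Qed.

Lemma tpow_thermal n N : 0 < N ->
  @tpow R n (thermal N) =1 diagop (fun k => (tw N k)%:C).
Proof.
move=> N0; have b := diag_bounded (fun k : n.-tuple nat => tw_le1 k N0).
apply: mxop_bounded => // k l.
rewrite (entry_diag _ _ (fun k : n.-tuple nat => tw_le1 k N0)).
rewrite -prod_tnth_eq rmorph_prod/= -big_split/=; apply: eq_bigr => i _.
by rewrite thermalE (entry_diag _ _ (fun k => thw_le1 k N0)).
Qed.

Lemma entry_tpow_thermal n N (k l : n.-tuple nat) : 0 < N ->
  entry (@tpow R n (thermal N)) k l = (tw N k)%:C * (k == l)%:R.
Proof.
move=> N0; rewrite /entry tpow_thermal//.
exact: (entry_diag k l (fun k : n.-tuple nat => tw_le1 k N0)).
Qed.

Definition Dfirst n z := @tensmx R n (Dmx z) (fun i j => (i == j)%:R).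

Lemma Dfirst_unimx n z : unimx (@Dfirst n z).
Proof. by apply: unimx_tens; [exact: Dmx_unimx|exact: unimx_id]. Qed.

(** The diagonal is the same as in [tpow_rho], so the transformation law of the state reduces to an
    intertwining of displacements. *)
Lemma tens_rho n z N : 0 < N ->
  @tens R n.+1 (rho z N) (@tpow R n (thermal N)) =1
    mxop (@Dfirst n z) \o diagop (fun k => (tw N k)%:C) \o adj (mxop (@Dfirst n z)).
Proof.
move=> N0; have [bD eD] := unimx_bounded (@Dfirst_unimx n z).
have H k l := entry_conj_diag k l bD (fun m => tw_le1 m N0).
apply: mxop_bounded => [|k l].
  by have [] := H [tuple of nseq n.+1 0%N] [tuple of nseq n.+1 0%N].
have [_ [_ ->]] := H k l.
have [g gK Kg] := tcons_bij n; rewrite -(Kg k) -(Kg l).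
move: (g k) (g l) => {gK Kg g} {}k {}l.
rewrite (csum_bij _ (tcons_bij n)).
have [s e] := entry_rho z k.1 l.1 N0.
pose t2 m := (k.2 == m)%:R * (tw N m)%:C * (l.2 == m)%:R : R[i].
have z2 m : m != k.2 -> t2 m = 0.
  by rewrite eq_sym /t2 => /negbTE ->; rewrite !mul0r.
have E m : entry (mxop (@Dfirst n z)) (tcons k) (tcons m) * (tw N (tcons m))%:C *
    (entry (mxop (@Dfirst n z)) (tcons l) (tcons m))^* =
    (Dmx z k.1 m.1 * (thw N m.1)%:C * (Dmx z l.1 m.1)^*) * t2 m.2.
  rewrite !eD /Dfirst !tensmx_tcons /tw tprod_tcons rmorphM/= conjM conj_nat /t2.
  by ring.
transitivity (csum (fun m : nat * n.-tuple nat =>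
   (Dmx z k.1 m.1 * (thw N m.1)%:C * (Dmx z l.1 m.1)^*) * t2 m.2)); last first.
  by apply: eq_csum => m; rewrite -E.
rewrite (csum_prod s (csm_single z2)) (csum_single z2) -e /t2 eqxx mul1r.
by rewrite (eq_sym l.2) entry_tpow_thermal// !behead_tcons.
Qed.

Lemma tens_proj n s : @tens R n.+1 idfun (@proj_total R n s) =1
  diagop (fun k : n.+1.-tuple nat => (sumn (behead k) == s)%:R).
Proof.
have b1 m (k : m.-tuple nat) : cabs ((sumn k == s)%:R : R[i]) <= 1.
  by rewrite cabs_nat; case: (_ == _); rewrite ?ler01.
have b2 (k : n.+1.-tuple nat) : cabs ((sumn (behead k) == s)%:R : R[i]) <= 1.
  by rewrite cabs_nat; case: (_ == _); rewrite ?ler01.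
apply: mxop_bounded; first exact: diag_bounded b2.
move=> k l; rewrite (entry_diag _ _ b2) entry_id (entry_diag _ _ (@b1 n)).
have [g gK Kg] := tcons_bij n; rewrite -(Kg k) -(Kg l).
move: (g k) (g l) => {gK Kg g} {}k {}l.
by rewrite mulrCA; congr (_ * _); rewrite !behead_tcons tcons_eq -natrM mulnb.
Qed.

End Thermal.

(** * The passive unitary *)

Section LinearSubstitution.
Import -(notations) mpoly.
Context {F : comNzRingType} {n : nat}.
Implicit Types (p q : mpoly n F) (k l m : multinom n).

Definition pX (i : 'I_n) : mpoly n F := mpolyX F (mnm1 i).

Lemma mpoly_alg_ind (P : mpoly n F -> Prop) :
  P 0 -> P 1 -> (forall p q, P p -> P q -> P (p + q)) ->
  (forall p q, P p -> P q -> P (p * q)) -> (forall c p, P p -> P (c *: p)) ->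
  (forall i, P (pX i)) -> forall p, P p.
Proof.
move=> P0 P1 PD PM PZ PX; elim/mpolyind => // c m p _ _ Pp; apply: PD => //.
apply: PZ; rewrite mpolyXE_id; elim/big_ind: _ => // i _.
by elim: (m i) => [|j ih]; rewrite ?expr0// exprS; apply: PM => //; exact: PX.
Qed.

Variable V : 'I_n -> 'I_n -> F.

Definition lin (i : 'I_n) : mpoly n F := \sum_j V i j *: pX j.

Definition sigma : mpoly n F -> mpoly n F := comp_mpoly [tuple lin i | i < n].

Lemma sigma0 : sigma 0 = 0. Proof. exact: comp_mpoly0. Qed.
Lemma sigma1 : sigma 1 = 1. Proof. exact: comp_mpoly1. Qed.
Lemma sigmaD p q : sigma (p + q) = sigma p + sigma q. Proof. exact: comp_mpolyD. Qed.
Lemma sigmaB p q : sigma (p - q) = sigma p - sigma q. Proof. exact: comp_mpolyB. Qed.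
Lemma sigmaZ c p : sigma (c *: p) = c *: sigma p. Proof. exact: comp_mpolyZ. Qed.
Lemma sigmaM p q : sigma (p * q) = sigma p * sigma q.
Proof. exact: (rmorphM (comp_mpoly [tuple lin i | i < n])). Qed.
Lemma sigmaX i : sigma (pX i) = lin i.
Proof. by rewrite /sigma /pX comp_mpolyXU -tnth_nth tnth_mktuple. Qed.
Lemma sigma_sum (T : Type) (s : seq T) (G : T -> mpoly n F) :
  sigma (\sum_(t <- s) G t) = \sum_(t <- s) sigma (G t).
Proof.
elim: s => [|t s ih]; first by rewrite !big_nil sigma0.
by rewrite !big_cons sigmaD ih.
Qed.
Lemma sigmaE p : sigma p = \sum_(m <- msupp p) mcoeff m p *: sigma (mpolyX F m).
Proof. exact: comp_mpolyEX. Qed.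
Lemma sigma_mX k : sigma (mpolyX F k) = \prod_(i < n) lin i ^+ k i.
Proof. by rewrite /sigma comp_mpolyX; apply: eq_bigr => i _; rewrite tnth_mktuple. Qed.
Local Opaque sigma.

Lemma sigma_invol : (forall i j, \sum_a V i a * V a j = (i == j)%:R) ->
  forall p, sigma (sigma p) = p.
Proof.
move=> Vinv; elim/mpoly_alg_ind => [||p q hp hq|p q hp hq|c p hp|i].
- by rewrite !sigma0.
- by rewrite !sigma1.
- by rewrite (sigmaD p q) (sigmaD (sigma p)) hp hq.
- by rewrite (sigmaM p q) (sigmaM (sigma p)) hp hq.
- by rewrite (sigmaZ c p) (sigmaZ c (sigma p)) hp.
rewrite sigmaX sigma_sum.
transitivity (\sum_l (\sum_j V i j * V j l) *: pX l); last first.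
  rewrite (bigD1 i)//= [X in _ + X]big1 => [|j ji]; rewrite Vinv.
    by rewrite eqxx scale1r addr0.
  by rewrite eq_sym (negbTE ji) scale0r.
under [RHS]eq_bigr do rewrite scaler_suml.
rewrite exchange_big/=; apply: eq_bigr => j _.
rewrite sigmaZ sigmaX scaler_sumr; apply: eq_bigr => l _.
by rewrite scalerA.
Qed.

Lemma mderiv_pX a b : mderiv a (pX b) = (b == a)%:R%:A.
Proof.
rewrite /pX mderivX mnm1E; case: eqP => [->|_]; last by rewrite !scale0r.
rewrite (_ : mnm_sub _ _ = mnm0) ?mpolyX0//.
by apply/mnmP => c; rewrite mnmBE mnm0E subnn.
Qed.

(** The chain rule: both sides obey the same product rule, so the variables decide. It tells how
    annihilation operators transform. *)
Lemma mderiv_sigma j p : mderiv j (sigma p) = \sum_i V i j *: sigma (mderiv i p).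
Proof.
elim/mpoly_alg_ind: p => [||p q hp hq|p q hp hq|c p hp|i].
- by rewrite sigma0 raddf0 big1// => i _; rewrite raddf0 sigma0 scaler0.
- rewrite sigma1 -mpolyC1 mderivC big1// => i _; by rewrite mderivC sigma0 scaler0.
- rewrite (sigmaD p q) (mderivD j) hp hq -big_split; apply: eq_bigr => i _.
  by rewrite mderivD sigmaD scalerDr.
- rewrite (sigmaM p q) mderivM hp hq mulr_suml mulr_sumr -big_split.
  apply: eq_bigr => i _ /=.
  by rewrite mderivM sigmaD !sigmaM scalerDr -scalerAl -scalerAr.
- rewrite (sigmaZ c p) (mderivZ j) hp scaler_sumr; apply: eq_bigr => i _.
  by rewrite mderivZ sigmaZ !scalerA mulrC.
rewrite sigmaX /lin raddf_sum/=.
rewrite (bigD1 j)//= [X in _ + X]big1 => [|a ja]; last first.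
  by rewrite mderivZ mderiv_pX (negbTE ja) scale0r scaler0.
rewrite (bigD1 i)//= [X in _ = _ + X]big1 => [|a ia]; last first.
  by rewrite mderiv_pX eq_sym (negbTE ia) scale0r sigma0 scaler0.
by rewrite mderivZ !mderiv_pX !eqxx scale1r sigma1 !addr0.
Qed.

(** The degree is the total photon number: this is what makes the unitary passive. *)
Lemma sigma_homog k m : mdeg m != mdeg k -> mcoeff m (sigma (mpolyX F k)) = 0.
Proof.
pose mf : measure n := mdeg; apply: (@dhomog_nemf_coeff _ _ mf).
have hX i : pX i \is ishomog1 1 mf by rewrite dhomogX /= mdeg1.
have hl i : lin i \is ishomog1 1 mf by apply: rpred_sum => j _; apply: rpredZ.
rewrite sigma_mX mdegE; elim/big_rec2: _ => [|i d p _ hp]; first exact: dhomog1.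
apply: dhomogM => //; have := dhomogMn (k i) (hl i); by rewrite mul1n.
Qed.

Definition mfact m : nat := \prod_(i < n) (m i)`!.

Lemma mfact_gt0 m : (0 < mfact m)%N.
Proof. by rewrite prodn_gt0// => i; exact: fact_gt0. Qed.

Lemma mfactS i m : mfact (mnm_add (mnm1 i) m) = ((m i).+1 * mfact m)%N.
Proof.
rewrite /mfact (bigD1 i)//= [in RHS](bigD1 i)//= mnmDE mnm1E eqxx factS mulnA.
by congr (_ * _)%N; apply: eq_bigr => j ji; rewrite mnmDE mnm1E eq_sym (negbTE ji).
Qed.

Lemma mnm1_sub i m : (0 < m i)%N -> m = mnm_add (mnm1 i) (mnm_sub m (mnm1 i)).
Proof.
move=> mi; apply/mnmP => j; rewrite mnmDE mnmBE mnm1E; case: eqP => [<-|_].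
  by rewrite subnKC.
by rewrite subn0.
Qed.

Lemma mcoeff_pXM i p m : mcoeff m (pX i * p) =
  (0 < m i)%:R * mcoeff (mnm_sub m (mnm1 i)) p.
Proof.
have [mi|mi] := posnP (m i).
  rewrite mul0r memN_msupp_eq0// mulrC (perm_mem (msuppMX _ _)).
  apply/mapP => -[m' _ /(congr1 (fun m : multinom n => m i))].
  by rewrite mnmDE mnm1E eqxx mi.
by rewrite {1}(mnm1_sub mi) mul1r [pX i * p]mulrC mcoeffMX.
Qed.

(* <X^l, sigma X^k> for the Fischer pairing <X^l, X^k> = l! [l = k]. *)
Definition fischer l k : F := (mfact l)%:R * mcoeff l (sigma (mpolyX F k)).

(** Raising [l] differentiates the substituted monomial, which the chain rule expands; in
    [fischer_Sr] raising [k] multiplies by a variable, which multiplicativity expands. *)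
Lemma fischer_Sl i l k : fischer (mnm_add (mnm1 i) l) k =
  \sum_j V j i * ((k j)%:R * fischer l (mnm_sub k (mnm1 j))).
Proof.
have e := mcoeff_deriv i l (sigma (mpolyX F k)).
rewrite (_ : mnm_add l _ = mnm_add (mnm1 i) l) in e; last first.
  by apply/mnmP => j; rewrite !mnmDE addnC.
rewrite /fischer mfactS mulnC natrM -mulrA [(l i).+1%:R * _]mulr_natl -e mderiv_sigma.
rewrite raddf_sum mulr_sumr; apply: eq_bigr => j _ /=.
by rewrite mderivX sigmaZ !mcoeffZ; ring.
Qed.

Lemma fischer_Sr i l k : fischer l (mnm_add (mnm1 i) k) =
  \sum_j V i j * ((l j)%:R * fischer (mnm_sub l (mnm1 j)) k).
Proof.
rewrite /fischer mpolyXD sigmaM -/(pX i) sigmaX mulr_suml raddf_sum mulr_sumr.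
apply: eq_bigr => j _ /=; rewrite -scalerAl mcoeffZ mcoeff_pXM.
have [lj|lj] := posnP (l j); first by rewrite lj !(mul0r, mulr0).
rewrite /= mul1r {1}(mnm1_sub lj) mfactS natrM (_ : (mnm_sub l _ j).+1 = l j); first by ring.
by rewrite mnmBE mnm1E eqxx subn1 prednK.
Qed.

(** For symmetric [V] the recursions [fischer_Sl] and [fischer_Sr] are mirror images, so induction
    on the degree of [l] applies. In degree 0, homogeneity kills both sides unless [k] is 0 as
    well. *)
Lemma fischer_sym : (forall i j, V i j = V j i) -> forall l k, fischer l k = fischer k l.
Proof.
move=> Vsym l; move: {2}(mdeg l) (erefl (mdeg l)) => d; elim: d l => [|d ih] l.
  move=> /eqP; rewrite mdeg_eq0 => /eqP -> k.
  rewrite /fischer mpolyX0 sigma1 -[X in mcoeff k X]mpolyX0 mcoeffX.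
  have [<-|k0] := eqVneq mnm0 k; first by rewrite mpolyX0 sigma1 -mpolyX0 mcoeffX eqxx.
  by rewrite mulr0 sigma_homog ?mulr0// mdeg0 eq_sym mdeg_eq0 eq_sym.
move=> dl k; have [i li] : exists i, (0 < l i)%N.
  apply/existsP; apply: contra_eqT dl => /existsPn l0.
  by rewrite mdegE big1// => i _; apply/eqP; have := l0 i; rewrite lt0n negbK.
rewrite (mnm1_sub li) fischer_Sl fischer_Sr; apply: eq_bigr => j _.
rewrite ih 1?Vsym//; move: dl; rewrite {1}(mnm1_sub li) mdegD mdeg1 => -[].
done.
Qed.

Lemma sigma_real (S : subringClosed F) : (forall i j, V i j \in S) ->
  forall k m, mcoeff m (sigma (mpolyX F k)) \in S.
Proof.
move=> VS k; apply/mpolyOverP; rewrite sigma_mX.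
apply: rpred_prod => i _; apply: rpredX; apply: rpred_sum => j _.
by apply: mpolyOverZ => //; exact: mpolyOverX.
Qed.

End LinearSubstitution.

Section Bargmann.
Import -(notations) mpoly.
Context {R : realType} {n : nat}.
Implicit Types (z : R[i]) (k l : n.-tuple nat) (p q : mpoly n R[i]).

Local Notation mm := (@Multinom n).

Definition nf k : R := Num.sqrt (mfact (mm k))%:R.

(* The Bargmann correspondence: [|k>] is the normalized monomial [X^k / sqrt (k!)], on which
   [a^dagger_i] and [a_i] act as multiplication by [X_i] and as [d/dX_i]. *)
Definition cf p k : R[i] := (nf k)%:C * mcoeff (mm k) p.

Definition setk k (i : 'I_n) x : n.-tuple nat :=
  [tuple (if j == i then x else tnth k j) | j < n].

Lemma nf_gt0 k : 0 < nf k.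
Proof. by rewrite sqrtr_gt0 ltr0n mfact_gt0. Qed.

Lemma nf_sq k : (nf k)%:C * (nf k)%:C = (mfact (mm k))%:R :> R[i].
Proof. by rewrite -rmorphM/= -expr2 sqr_sqrtr// rmorph_nat. Qed.

Lemma tnth_setk k i x j : tnth (setk k i x) j = if j == i then x else tnth k j.
Proof. by rewrite tnth_mktuple. Qed.

Lemma setk_id k i : setk k i (tnth k i) = k.
Proof. by apply: eq_from_tnth => j; rewrite tnth_setk; case: eqP => [->|]. Qed.

Lemma mnm_setS k i x : mm (setk k i x.+1) = mnm_add (mnm1 i) (mm (setk k i x)).
Proof.
apply/mnmP => j; rewrite mnmDE mnm1E !multinomE !tnth_setk [j == i]eq_sym.
by case: (i == j).
Qed.

Lemma nf_setS k i x : nf (setk k i x.+1) = Num.sqrt x.+1%:R * nf (setk k i x).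
Proof.
by rewrite /nf -sqrtrM ?ler0n// mnm_setS mfactS natrM multinomE tnth_setk eqxx.
Qed.

Lemma cf_X i p k : cf (pX i * p) k = sq (tnth k i) * cf p (setk k i (tnth k i).-1).
Proof.
rewrite /cf mcoeff_pXM multinomE; case ki: (tnth k i) => [|x] /=.
  by rewrite /sq sqrtr0 !mul0r mulr0.
have {1 2}-> : k = setk k i x.+1 by rewrite -ki setk_id.
rewrite nf_setS mnm_setS mul1r (_ : mnm_sub _ _ = mm (setk k i x)).
  by rewrite rmorphM/= -mulrA.
by apply/mnmP => j; rewrite mnmBE mnmDE addKn.
Qed.

Lemma cf_d i p k : cf (mderiv i p) k = sq (tnth k i).+1 * cf p (setk k i (tnth k i).+1).
Proof.
rewrite /cf nf_setS mnm_setS setk_id mcoeff_deriv multinomE.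
rewrite (_ : mnm_add (mm k) _ = mnm_add (mnm1 i) (mm k)); last first.
  by apply/mnmP => j; rewrite !mnmDE addnC.
have -> c : c *+ (tnth k i).+1 = (sq (tnth k i).+1 * sq (tnth k i).+1) * c :> R[i].
  by rewrite -rmorphM/= -expr2 sqr_sqrtr ?ler0n// -[LHS]mulr_natl rmorph_nat.
by rewrite rmorphM/= -/(sq _); ring.
Qed.

Lemma cfD p q k : cf (p + q) k = cf p k + cf q k.
Proof. by rewrite /cf mcoeffD mulrDr. Qed.

Lemma cfZ c p k : cf (c *: p) k = c * cf p k.
Proof. by rewrite /cf mcoeffZ mulrCA. Qed.

Lemma cfB p q k : cf (p - q) k = cf p k - cf q k.
Proof. by rewrite /cf mcoeffB mulrBr. Qed.

Lemma cf_sum (T : Type) (s : seq T) (G : T -> mpoly n R[i]) k :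
  cf (\sum_(t <- s) G t) k = \sum_(t <- s) cf (G t) k.
Proof.
elim: s => [|t s ih]; first by rewrite !big_nil /cf mcoeff0 mulr0.
by rewrite !big_cons cfD ih.
Qed.

Lemma cf_fin p : exists s : seq (n.-tuple nat), uniq s /\
  forall k, k \notin s -> cf p k = 0.
Proof.
exists (map (@multinom_val n) (msupp p)); split.
  by rewrite map_inj_uniq ?msupp_uniq//; exact: val_inj.
move=> k ks; rewrite /cf memN_msupp_eq0 ?mulr0//; apply: contra ks => ks.
by apply/mapP; exists (mm k).
Qed.

(** The generator of the common displacement of all modes, in the polynomial model; [Gfun] is the
    same operator on coordinates. *)
Definition Gpoly z p : mpoly n R[i] :=
  \sum_(i < n) (z *: (pX i * p) - z^* *: mderiv i p).

Definition Gfun z (f : n.-tuple nat -> R[i]) k : R[i] :=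
  \sum_(i < n) disp_gen z (fun x => f (setk k i x)) (tnth k i).

Lemma cf_G z p : cf (Gpoly z p) = Gfun z (cf p).
Proof.
apply/funext => k; rewrite /Gpoly cf_sum; apply: eq_bigr => i _.
by rewrite cfB !cfZ cf_X cf_d disp_gen1.
Qed.

Lemma cf_iterG z j p : cf (iter j (Gpoly z) p) = iter j (Gfun z) (cf p).
Proof. by elim: j => //= j <-; rewrite cf_G. Qed.

Definition Pn k : mpoly n R[i] := (nf k)^-1%:C *: mpolyX R[i] (mm k).

Definition et k : n.-tuple nat -> R[i] := fun l => (l == k)%:R.

Lemma nfV k : (nf k)^-1%:C * (nf k)%:C = 1 :> R[i].
Proof. by rewrite -rmorphM/= mulVf ?gt_eqF ?nf_gt0. Qed.

Lemma cf_Pn k : cf (Pn k) = et k.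
Proof.
apply/funext => l; rewrite cfZ /cf mcoeffX /et eq_sym.
have -> : (mm l == mm k) = (l == k) by [].
case: eqP => [->|_]; last by rewrite !mulr0.
by rewrite mulr1 nfV.
Qed.

Variable V : 'I_n -> 'I_n -> R.
Hypothesis Vsym : forall i j, V i j = V j i.
Hypothesis Vinv : forall i j, \sum_a V i a * V a j = (i == j)%:R.

Let VC i j : R[i] := (V i j)%:C.

(* A passive unitary is a linear substitution of the variables of the polynomial model. *)
Definition us l k : R[i] := cf (sigma VC (Pn k)) l.

Lemma usE l k : us l k = (nf l)^-1%:C * (nf k)^-1%:C * fischer VC (mm l) (mm k).
Proof.
rewrite /us /Pn sigmaZ cfZ /cf /fischer -nf_sq.
have := nfV l; move: (nf l)^-1%:C (nf l)%:C (nf k)^-1%:C (mcoeff _ _) => a b c x ab.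
by transitivity (a * b * (c * (b * x))); [rewrite ab mul1r|ring].
Qed.

Lemma us_def l k : us l k = cf (sigma VC (Pn k)) l.
Proof. by []. Qed.

Lemma us_sym l k : us l k = us k l.
Proof.
rewrite (usE l k) (usE k l) (fischer_sym (V := VC)); last by move=> i j; rewrite /VC Vsym.
by congr (_ * _); exact: mulrC.
Qed.

Lemma us_conj l k : (us l k)^* = us l k.
Proof.
have cr (x : R) : (x%:C)^* = x%:C by exact: conj_real.
rewrite (usE l k) /fischer !conjM !cr; congr (_ * _).
rewrite conj_nat; congr (_ * _); apply/CrealP.
by apply: sigma_real => i j; apply/CrealP; exact: cr.
Qed.

Lemma us_total l k : sumn l != sumn k -> us l k = 0.
Proof.
have sE (t : n.-tuple nat) : sumn t = mdeg (mm t).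
  by rewrite mdegE sumnE big_tuple; apply: eq_bigr => i _; rewrite multinomE.
by rewrite !sE => lk; rewrite /us /Pn sigmaZ cfZ /cf sigma_homog// !mulr0.
Qed.

(** Columns are finite because they are polynomials, rows by symmetry. Hence [us] can be exchanged
    with exponential series without any estimate. *)
Lemma us_fin l : exists s : seq (n.-tuple nat), uniq s /\ forall k, k \notin s -> us l k = 0.
Proof.
have [s [us0 sP]] := cf_fin (sigma VC (Pn l)).
exists s; split; first exact: us0.
by move=> k ks; apply: etrans (us_sym l k) (sP k ks).
Qed.

Lemma cf_sigma p l : csm (fun m => us l m * cf p m) /\
  csum (fun m => us l m * cf p m) = cf (sigma VC p) l.
Proof.
pose s := map (@multinom_val n) (msupp p).
have us0 : uniq s by rewrite map_inj_uniq ?msupp_uniq//; exact: val_inj.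
have z m : m \notin s -> us l m * cf p m = 0.
  move=> ms; rewrite /cf memN_msupp_eq0 ?mulr0//; apply: contra ms => ms.
  by apply/mapP; exists (mm m).
split; first exact: csm_fin z.
rewrite (csum_fin us0 z) big_map sigmaE cf_sum; apply: eq_bigr => m _.
rewrite cfZ /us /Pn sigmaZ cfZ /cf (_ : mm (multinom_val m) = m); last exact: val_inj.
have := nfV (multinom_val m); set a := (nf _)^-1%:C; set b := (nf _)%:C => ab.
transitivity ((a * b) * (mcoeff m p * ((nf l)%:C * mcoeff (mm l) (sigma VC (mpolyX R[i] m)))));
  last by rewrite ab mul1r.
by ring.
Qed.

Lemma us_invol l k : csum (fun m => us l m * us m k) = (l == k)%:R.
Proof.
rewrite (cf_sigma (sigma VC (Pn k)) l).2 sigma_invol ?cf_Pn// => i j.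
under eq_bigr do rewrite -rmorphM.
by rewrite -rmorph_sum/= Vinv rmorph_nat.
Qed.

End Bargmann.

#[global] Opaque us.

(** * Exponentials of sums of generators on different modes *)

Section ExpSum.
Context {R : realType}.
Implicit Types (z : R[i]).

Lemma setk_tcons0 n (p : nat * n.-tuple nat) y : setk (tcons p) ord0 y = tcons (y, p.2).
Proof.
apply: eq_from_tnth => j; rewrite tnth_setk; case: (unliftP ord0 j) => [j'|] ->.
  by rewrite !tnth_tconsS.
by rewrite eqxx.
Qed.

Lemma setk_tconsS n (p : nat * n.-tuple nat) i y :
  setk (tcons p) (lift ord0 i) y = tcons (p.1, setk p.2 i y).
Proof.
apply: eq_from_tnth => j; rewrite tnth_setk; case: (unliftP ord0 j) => [j'|] ->.
  by rewrite !tnth_tconsS tnth_setk (inj_eq lift_inj).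
by rewrite !tnth_tcons0.
Qed.

Lemma Gfun_tcons n z (f : n.+1.-tuple nat -> R[i]) p : Gfun z f (tcons p) =
  disp_gen z (fun y => f (tcons (y, p.2))) p.1 + Gfun z (fun t => f (tcons (p.1, t))) p.2.
Proof.
rewrite /Gfun big_ord_recl tnth_tcons0; congr (_ + _).
  by congr (disp_gen _ _ _); apply/funext => y; rewrite setk_tcons0.
apply: eq_bigr => i _; rewrite tnth_tconsS; congr (disp_gen _ _ _).
by apply/funext => y; rewrite setk_tconsS.
Qed.

Lemma disp_gen_sum z N (c : 'I_N -> R[i]) (f : 'I_N -> nat -> R[i]) x :
  disp_gen z (fun y => \sum_b c b * f b y) x = \sum_b c b * disp_gen z (f b) x.
Proof.
rewrite disp_gen1 !mulr_sumr -sumrB; apply: eq_bigr => b _.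
by rewrite disp_gen1; ring.
Qed.

Lemma Gfun_sum n z N (c : 'I_N -> R[i]) (f : 'I_N -> n.-tuple nat -> R[i]) x :
  Gfun z (fun y => \sum_b c b * f b y) x = \sum_b c b * Gfun z (f b) x.
Proof.
rewrite /Gfun; under eq_bigr do rewrite disp_gen_sum.
by rewrite exchange_big; apply: eq_bigr => b _; rewrite mulr_sumr.
Qed.

Lemma binom_step (C : pzRingType) (t : nat -> nat -> C) j :
  \sum_(b < j.+1) 'C(j, b)%:R * (t (j - b).+1 b + t (j - b)%N b.+1) =
  \sum_(b < j.+2) 'C(j.+1, b)%:R * t (j.+1 - b)%N b.
Proof.
rewrite [RHS]big_ord_recl.
under [in RHS]eq_bigr do rewrite lift0 subSS binS natrD mulrDl.
rewrite /= bin0 subn0 mul1r.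
under eq_bigr do rewrite mulrDr.
rewrite !big_split/= addrA; congr (_ + _).
rewrite [LHS]big_ord_recl; under [in LHS]eq_bigr do rewrite lift0.
rewrite /= bin0 subn0 mul1r; congr (_ + _).
rewrite [RHS]big_ord_recr/= bin_small ?ltnSn// mul0r addr0.
by apply: eq_bigr => b _; rewrite subnSK.
Qed.

(** The generator of the first mode commutes with that of the others, so the powers of their sum
    obey the binomial formula; [binom_step] is its induction step. *)
Lemma Gfun_leibniz n z j k (p : nat * n.-tuple nat) :
  iter j (Gfun z) (et (tcons k)) (tcons p) =
  \sum_(b < j.+1) 'C(j, b)%:R *
    (iter (j - b) (disp_gen z) (dlt k.1) p.1 * iter b (Gfun z) (et k.2) p.2).
Proof.
elim: j p => [|j ih] p.
  by rewrite big_ord1 /= bin0 mul1r /et tcons_eq -natrM mulnb.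
rewrite iterS Gfun_tcons.
have -> : (fun y => iter j (Gfun z) (et (tcons k)) (tcons (y, p.2))) = fun y =>
    \sum_(b < j.+1) ('C(j, b)%:R * iter b (Gfun z) (et k.2) p.2) *
       iter (j - b) (disp_gen z) (dlt k.1) y.
  apply/funext => y; rewrite ih; apply: eq_bigr => b _ /=.
  by rewrite [iter (j - b) _ _ _ * _]mulrC mulrA.
have -> : (fun t => iter j (Gfun z) (et (tcons k)) (tcons (p.1, t))) = fun t =>
    \sum_(b < j.+1) ('C(j, b)%:R * iter (j - b) (disp_gen z) (dlt k.1) p.1) *
       iter b (Gfun z) (et k.2) t.
  by apply/funext => y; rewrite ih; apply: eq_bigr => b _ /=; rewrite mulrA.
rewrite disp_gen_sum Gfun_sum -big_split/=.
rewrite -(binom_step (fun a b => iter a (disp_gen z) (dlt k.1) p.1 *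
   iter b (Gfun z) (et k.2) p.2)).
by apply: eq_bigr => b _; rewrite !iterS; ring.
Qed.

Definition Gterm n z (m k : n.-tuple nat) j : R[i] := j`!%:R^-1 * iter j (Gfun z) (et k) m.

(* exp(A + B) = exp A (x) exp B for generators acting on different modes. *)
Lemma csum_Gterm n z (m k : n.-tuple nat) :
  csm (Gterm z m k) /\ csum (Gterm z m k) = tpowmx (Dmx z) m k.
Proof.
elim: n m k => [|n ih] m k.
  have z0 j : j != 0%N -> Gterm z m k j = 0.
    by case: j => // j _; rewrite /Gterm iterS /Gfun big_ord0 mulr0.
  split; first exact: csm_single z0.
  rewrite (csum_single z0) /Gterm /tpowmx big_ord0 fact0 invr1 mul1r /= /et.
  by rewrite (tuple0 m) (tuple0 k) eqxx.
have [g gK Kg] := tcons_bij n; rewrite -(Kg k) -(Kg m).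
move: (g k) (g m) => {gK Kg g} {}k {}m.
have [s e] := ih m.2 k.2.
have sD := Dterm_csm z m.1 k.1.
have [s' e'] := csum_antidiag (csm_prod sD s).
have E j : \sum_(b < j.+1) Dterm z m.1 k.1 (j - b) * Gterm z m.2 k.2 b =
    Gterm z (tcons m) (tcons k) j.
  rewrite /Gterm Gfun_leibniz mulr_sumr; apply: eq_bigr => b _.
  rewrite /Dterm; have bj : (b <= j)%N by rewrite -ltnS.
  have f0 i : (i`!%:R : R[i]) != 0 by rewrite pnatr_eq0 -lt0n fact_gt0.
  have -> : ('C(j, b)%:R : R[i]) = j`!%:R / (b`!%:R * (j - b)`!%:R).
    by rewrite -(bin_fact bj) !natrM mulfK// mulf_neq0.
  by field; rewrite !f0.
split; first by apply: eq_csm s' => j; exact: E.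
rewrite -(eq_csum E) -e' csum_prod// e /tpowmx big_ord_recl !tnth_tcons0.
by congr (_ * _); apply: eq_bigr => i _; rewrite !tnth_tconsS.
Qed.

Lemma csum_swap_fin (I J : choiceType) (s : seq I) (f : I -> J -> R[i]) : uniq s ->
  (forall i, i \notin s -> f i = fun=> 0) -> (forall i, csm (f i)) ->
  csum (fun i => csum (f i)) = csum (fun j => csum (fun i => f i j)).
Proof.
move=> us fs sf; rewrite (csum_fin us) => [|i /fs ->]; last exact: csum0.
rewrite -csum_sum//; apply: eq_csum => j.
by rewrite (csum_fin us)// => i /fs ->.
Qed.

End ExpSum.

(** The reason why a passive unitary commutes with the product of thermal states. *)
Lemma tw_sumn {R : realType} (N : R) n (k l : n.-tuple nat) : sumn k = sumn l -> tw N k = tw N l.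
Proof.
have E (t : n.-tuple nat) : tw N t = (N + 1)^-1 ^+ n * (N / (N + 1)) ^+ sumn t.
  rewrite /tw /tprod big_split/= prodr_const card_ord; congr (_ * _).
  by rewrite sumnE big_tuple -(big_morph _ (exprD _) (expr0 _)).
by rewrite !E => ->.
Qed.

(** With U W = W' U, and U commuting with the diagonal, U moves inwards until it meets its adjoint.
    The hypotheses are on entries, which is what can be computed; the relation between adjoints
    follows by pairing with vectors. *)
Lemma intertwine_conj {R : realType} {I : choiceType} (U W W' : op R I) (w : I -> R[i]) (c : R) :
  bounded_op U -> bounded_op W -> bounded_op W' -> (forall i, cabs (w i) <= c) ->
  U \o adj U =1 idfun ->
  (forall l k, csum (fun m => entry U l m * entry W m k) =
               csum (fun m => entry W' l m * entry U m k)) ->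
  (forall l k, entry U l k * w k = w l * entry U l k) ->
  U \o (W \o diagop w \o adj W) \o adj U =1 W' \o diagop w \o adj W'.
Proof.
move=> bU bW bW' wc UUa eUW eUd; have bd := diag_bounded wc.
have ed i j := entry_diag i j wc.
have H1 : U \o W =1 W' \o U.
  apply: bounded_ext => [||l k]; [exact: (bounded_comp bU bW)|exact: (bounded_comp bW' bU)|].
  have [_ ->] := entry_comp W l k bU; have [_ ->] := entry_comp U l k bW'.
  exact: eUW.
have H2 : U \o diagop w =1 diagop w \o U.
  apply: bounded_ext => [||l k]; [exact: (bounded_comp bU bd)|exact: (bounded_comp bd bU)|].
  have [_ ->] := entry_comp (diagop w) l k bU; have [_ ->] := entry_comp U l k bd.
  rewrite (csum_single (i0 := k)) => [|m mk]; last by rewrite ed (negbTE mk) !mulr0.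
  rewrite (csum_single (i0 := l)) => [|m ml]; last by rewrite ed eq_sym (negbTE ml) mulr0 mul0r.
  by rewrite !ed !eqxx !mulr1 eUd.
have H3 v : adj W (adj U v) = adj U (adj W' v).
  apply: inner_ext.
  move=> x.
  have e1 := adjP' x (adj U v) bW.
  have e2 := adjP' (W x) v bU.
  apply: etrans e1 _.
  apply: etrans e2 _.
  rewrite (adjP' x (adj W' v) bU).
  rewrite (adjP' (U x) v bW').
  by rewrite (H1 x : U (W x) = W' (U x)).
move=> v /=; rewrite H3 (H1 _ : U (W _) = W' (U _)) (H2 _ : U (diagop w _) = diagop w (U _)).
by rewrite (UUa _ : U (adj U _) = _).
Qed.

(** * From a common displacement to a displacement of the first mode *)

Section Intertwining.
Import -(notations) mpoly.
Context {R : realType} {n' : nat}.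
Local Notation n := n'.+1.
Variable V : 'I_n -> 'I_n -> R.
Hypothesis Vsym : forall i j, V i j = V j i.
Hypothesis Vinv : forall i j, \sum_a V i a * V a j = (i == j)%:R.
Hypothesis Vrow : forall i, V ord0 i = (Num.sqrt n%:R)^-1.
Implicit Types (z : R[i]) (k l m : n.-tuple nat) (p q : mpoly n R[i]).

Let VC i j : R[i] := (V i j)%:C.
Let s : R := Num.sqrt n%:R.

Lemma srt_gt0 : 0 < s.
Proof. by rewrite sqrtr_gt0 ltr0n. Qed.

Definition G1 z p : mpoly n R[i] := z *: (pX ord0 * p) - z^* *: mderiv ord0 p.

(** The first row of [V] is constant, so the column sums of [V] are [s] times the first row of its
    square, which is the identity. *)
Lemma sum_lin : \sum_i lin VC i = s%:C *: pX ord0.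
Proof.
rewrite /lin exchange_big/=.
transitivity (\sum_j (s * (ord0 == j)%:R)%:C *: (pX j : mpoly n R[i])).
  apply: eq_bigr => j _; rewrite -scaler_suml /VC -rmorph_sum/=; congr (_%:C *: _).
  rewrite -Vinv mulr_sumr; apply: eq_bigr => i _.
  by rewrite Vrow mulrA mulfV ?mul1r// gt_eqF// srt_gt0.
rewrite (bigD1 ord0)//= big1 => [|j j0]; first by rewrite mulr1 addr0.
by rewrite eq_sym (negbTE j0) mulr0 scale0r.
Qed.

(** Creation part: [sum_lin]. Annihilation part: the chain rule read backwards, the first column of
    [V] being constant with entries [s^-1]. *)
Lemma sigma_G z p : sigma VC (Gpoly z p) = G1 (s%:C * z) (sigma VC p).
Proof.
rewrite /Gpoly sigma_sum.
transitivity (\sum_(i < n) (z *: (lin VC i * sigma VC p) - z^* *: sigma VC (mderiv i p))).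
  by apply: eq_bigr => i _; rewrite sigmaB !sigmaZ sigmaM sigmaX.
rewrite sumrB -!scaler_sumr -mulr_suml sum_lin /G1; congr (_ - _).
  by rewrite -scalerAl scalerA mulrC.
rewrite mderiv_sigma conjM conj_real scaler_sumr -scalerA scaler_sumr scaler_sumr.
apply: eq_bigr => i _; rewrite !scalerA; congr (_ *: _).
rewrite mulrAC [_ * VC i ord0](_ : _ = 1) ?mul1r// /VC -rmorphM/= Vsym Vrow.
by rewrite mulfV// gt_eqF// srt_gt0.
Qed.

Lemma sigma_iterG z j p :
  sigma VC (iter j (Gpoly z) p) = iter j (G1 (s%:C * z)) (sigma VC p).
Proof. by elim: j => //= j <-; rewrite sigma_G. Qed.

Lemma cf_iterG1 z j q (t : nat * n'.-tuple nat) : cf (iter j (G1 z) q) (tcons t) =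
  iter j (disp_gen z) (fun y => cf q (tcons (y, t.2))) t.1.
Proof.
case: t => x t /=; elim: j x => //= j ih x; rewrite cfB !cfZ cf_X cf_d tnth_tcons0 !setk_tcons0 /=.
by rewrite disp_gen1 !ih.
Qed.

(** Together with [Dfirst_us], this writes the two sides of the intertwining as the same series of
    iterated generators in the polynomial model, up to the scaling of [z]. *)
Lemma us_tpow z l k :
  csum (fun m => us V l m * tpowmx (Dmx z) m k) =
  csum (fun j => j`!%:R^-1 * cf (iter j (G1 (s%:C * z)) (sigma VC (Pn k))) l).
Proof.
have [r [ur rz]] := us_fin Vsym l.
transitivity (csum (fun m => csum (fun j => us V l m * Gterm z m k j))).
  apply: eq_csum => m; have [sG <-] := csum_Gterm z m k.
  by rewrite csumZ.
rewrite (csum_swap_fin ur) => [|m /rz e|m]; last 2 first.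
- by apply/funext => j; rewrite e mul0r.
- by apply: csmZ; exact: (csum_Gterm z m k).1.
apply: eq_csum => j; rewrite -sigma_iterG.
have [sC <-] := cf_sigma V (iter j (Gpoly z) (Pn k)) l.
rewrite -csumZ//; apply: eq_csum => m.
by rewrite /Gterm cf_iterG cf_Pn mulrCA.
Qed.

Lemma Dfirst_us z l k :
  csm (fun m => Dfirst z l m * us V m k) /\
  csum (fun m => Dfirst z l m * us V m k) =
  csum (fun j => j`!%:R^-1 * cf (iter j (G1 z) (sigma VC (Pn k))) l).
Proof.
have [r [ur rz]] := cf_fin (sigma VC (Pn k)).
have z0 m : m \notin r -> Dfirst z l m * us V m k = 0.
  by move=> /rz; rewrite us_def => ->; rewrite mulr0.
have sF := csm_fin ur z0; split; first exact: sF.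
have [g gK Kg] := tcons_bij n'; move: sF; rewrite -(Kg l); move: (g l) => {gK Kg g z0} {}l sF.
rewrite (csum_bij _ (tcons_bij n')) csum_pair; last exact/(csm_bij _ (tcons_bij n')).
pose f (m0 : nat) (j : nat) := Dterm z l.1 m0 j * us V (tcons (m0, l.2)) k.
transitivity (csum (fun m0 : nat => csum (f m0))).
  apply: eq_csum => m0 /=; rewrite (csum_single (i0 := l.2)) => [|m' ml] /=; last first.
    by rewrite /Dfirst tensmx_tcons eq_sym (negbTE ml) mulr0 mul0r.
  rewrite /Dfirst tensmx_tcons eqxx mulr1 /= csumZr//; exact: Dterm_csm.
rewrite (csum_swap_fin (s := undup [seq tnth t ord0 | t : n.-tuple nat <- r])) =>
  [||m0 hm|m0]; last 3 first.
- exact: undup_uniq.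
- apply/funext => j; rewrite /f us_def rz ?mulr0//; apply: contra hm => hm.
  by rewrite mem_undup; apply/mapP; exists (tcons (m0, l.2)).
- by apply: csmZr; exact: Dterm_csm.
apply: eq_csum => j; rewrite cf_iterG1.
have [sC <-] := csum_disp_expand z j (fun y => cf (sigma VC (Pn k)) (tcons (y, l.2))) l.1.
rewrite -csumZ//; apply: eq_csum => m.
by rewrite /f /Dterm us_def mulrA.
Qed.

Lemma us_unimx : unimx (us V).
Proof.
have H : colortho (us V).
  move=> j k; have e i : (us V i j)^* * us V i k = us V j i * us V i k.
    by congr (_ * _); rewrite us_conj//; exact: us_sym.
  split; last by rewrite (eq_csum e) us_invol.
  have [s' e'] := cf_sigma V (sigma VC (Pn k)) j.
  by apply: eq_csm s' => i; rewrite e.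
split; first exact: H.
rewrite (_ : (fun i j => _) = us V)//; apply/funext => i; apply/funext => j.
by rewrite us_conj//; exact: us_sym.
Qed.

Definition mixU : modes R n := mxop (us V).

Lemma mixU_unitary : unitary mixU.
Proof. exact: unimx_unitary us_unimx. Qed.

Lemma mixU_rho z (N : R) : 0 < N ->
  mixU \o @tpow R n (rho z N) \o adj mixU =1
  @tens R n (rho (s%:C * z) N) (@tpow R n' (thermal N)).
Proof.
move=> N0; have [bU eU] := unimx_bounded us_unimx.
have [_ _ UUa] := mixU_unitary.
have [bW eW] := unimx_bounded (@unimx_tpow _ n _ (Dmx_unimx z)).
have [bW' eW'] := unimx_bounded (@Dfirst_unimx _ n' (s%:C * z)).
have K1 l k : csum (fun m => entry mixU l m * entry (mxop (@tpowmx R n (Dmx z))) m k) =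
    csum (fun m => entry (mxop (@Dfirst R n' (s%:C * z))) l m * entry mixU m k).
  transitivity (csum (fun m => us V l m * tpowmx (Dmx z) m k)).
    by apply: eq_csum => m; rewrite eU eW.
  rewrite us_tpow -(Dfirst_us _ _ _).2.
  by apply: eq_csum => m; rewrite eU eW'.
have K2 l k : entry mixU l k * (tw N k)%:C = (tw N l)%:C * entry mixU l k.
  rewrite eU; have [lk|lk] := eqVneq (sumn l) (sumn k).
    by rewrite (tw_sumn N lk) mulrC.
  by rewrite us_total// mulr0 mul0r.
have K := intertwine_conj bU bW bW' (fun k => tw_le1 k N0) UUa K1 K2.
move=> v.
apply: etrans _ (esym (tens_rho _ N0 v)).
apply: etrans _ (K v).
have T := tpow_rho z N0 (adj (mxop (us V)) v).
exact: (congr1 mixU T).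
Qed.

End Intertwining.

(* The reflection exchanging the first axis with the diagonal. *)
Section Householder.
Context {R : realType} {n' : nat}.
Local Notation n := n'.+2.

Let a : R := (Num.sqrt n%:R)^-1.
(** The first axis minus the unit diagonal vector. Its squared length is 2 (1 - a), hence the
    denominator in [reflection]. *)
Let v (i : 'I_n) : R := (i == ord0)%:R - a.

Definition reflection (i j : 'I_n) : R := (i == j)%:R - v i * v j / (1 - a).

Lemma reflection_sym i j : reflection i j = reflection j i.
Proof. by rewrite /reflection eq_sym (mulrC (v i)). Qed.

Let na : n%:R * a ^+ 2 = 1.
Proof.
by rewrite /a exprVn sqr_sqrtr ?ler0n// mulfV// pnatr_eq0.
Qed.

(** Two modes at least: with one mode the axis is the diagonal and [v] vanishes. *)
Let a1 : 1 - a != 0.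
Proof.
rewrite subr_eq0 eq_sym; apply/eqP => ae; move/eqP: na.
by rewrite ae expr1n mulr1 pnatr_eq1.
Qed.

Lemma reflection_row i : reflection ord0 i = a.
Proof.
have v0 : v ord0 = 1 - a by rewrite /v eqxx.
by rewrite /reflection v0 eq_sym mulrAC mulfV// mul1r /v subKr.
Qed.

Lemma reflection_invol i j : \sum_b reflection i b * reflection b j = (i == j)%:R.
Proof.
have vv : \sum_b v b * v b = 2 * (1 - a).
  under eq_bigr do rewrite /v mulrBl !mulrBr.
  rewrite !sumrB.
  rewrite (bigD1 ord0)//= big1 => [|b /negbTE ->]; last by rewrite mul0r.
  rewrite -mulr_suml (bigD1 ord0)//= big1 => [|b /negbTE ->//].
  rewrite -mulr_sumr (bigD1 ord0)//= big1 => [|b /negbTE ->//].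
  have -> : \sum_(b < n) a * a = 1 by rewrite sumr_const card_ord -mulr_natl -expr2.
  by ring.
have delta (f : 'I_n -> R) k : \sum_b (k == b)%:R * f b = f k.
  rewrite (bigD1 k)//= big1 => [|b bk]; first by rewrite eqxx mul1r addr0.
  by rewrite eq_sym (negbTE bk) mul0r.
transitivity (\sum_b ((i == b)%:R * reflection b j - v i / (1 - a) * ((j == b)%:R * v b)
    + v i * v j / (1 - a) ^+ 2 * (v b * v b))).
  by apply: eq_bigr => b _; rewrite /reflection (eq_sym j); field.
by rewrite big_split sumrB/= delta -!mulr_sumr delta vv /reflection; field.
Qed.

End Householder.

(** * The law of the residual photon number *)

Section Mixture.
Import HBNNSimple.
Context {R : realType}.

(** [outcome_law] is a bare set function. An integral evaluates it on measurable sets only, so a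
    measure that agrees with it there can take its place. *)
Lemma eq_setfun_integral d (T : measurableType d) (mu1 mu2 : set T -> \bar R) (f : T -> \bar R) :
  (forall A, measurable A -> mu1 A = mu2 A) ->
  (\int[mu1]_x f x = \int[mu2]_x f x)%E.
Proof.
move=> e; rewrite /integral.
have es (h : {nnsfun T >-> R}) : sintegral mu1 h = sintegral mu2 h.
  by apply: eq_fsbigr => x _; rewrite e.
by congr (ereal_sup _ - ereal_sup _)%E; apply: eq_imagel => h _; exact: es.
Qed.

(** Passes to the index type [nat], over which series of measures are formed. *)
Lemma esum_pickle (I : countType) (a : I -> \bar R) : (forall i, 0 <= a i)%E ->
  \esum_(i in setT) a i =
  \esum_(j in setT) (if pickle_inv j is Some i then a i else 0%E).
Proof.
move=> a0; pose b j := if @pickle_inv I j is Some i then a i else 0%E.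
transitivity (\esum_(i in [set: I]) b (pickle i)).
  by apply: eq_esum => i _; rewrite /b pickleK_inv.
rewrite -(@esum_image _ _ _ setT pickle b); last by move=> x y _ _; exact: (pcan_inj pickleK).
rewrite esum_mkcond; apply: eq_esum => j _.
case: ifPn => // /negP jn; case e: (pickle_inv j) => [i|]; rewrite /b ?e//.
have := @pickle_invK I j; rewrite e /= => ij.
by exfalso; apply: jn; rewrite inE; exists i.
Qed.

(** Used for the plug-in estimator, with a Dirac mass for each tuple, and at z = 0, with the outcome
    law in each number state. *)
Lemma integral_mixture d (T : measurableType d) (I : countType) (w : I -> R)
    (mu : I -> {measure set T -> \bar R}) (law : set T -> \bar R) (f : T -> \bar R) :
  (forall i, 0 <= w i) ->
  (forall A, measurable A -> law A = \esum_(i in setT) ((w i)%:E * mu i A)%E) ->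
  measurable_fun setT f -> (forall x, 0 <= f x)%E ->
  (\int[law]_x f x = \esum_(i in setT) ((w i)%:E * \int[mu i]_x f x))%E.
Proof.
move=> w0 lawE mf f0.
pose nu (j : nat) : {measure set T -> \bar R} :=
  if @pickle_inv I j is Some i then mscale (NngNum (w0 i)) (mu i) else mzero.
rewrite (@eq_setfun_integral _ _ _ (mseries nu 0)); last first.
  move=> A mA; rewrite lawE// esum_pickle; last by move=> i; rewrite mule_ge0// lee_fin.
  rewrite /mseries nneseries_esumT//; apply: eq_esum => j _.
  by rewrite /nu; case: (pickle_inv j).
rewrite ge0_integral_measure_series// esum_pickle; last first.
  by move=> i; rewrite mule_ge0 ?lee_fin// integral_ge0.
rewrite nneseries_esumT; last by move=> j; exact: integral_ge0.
apply: eq_esum => j _; rewrite /nu; case: (pickle_inv j) => [i|].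
  by rewrite ge0_integral_mscale.
by rewrite integral_measure_zero.
Qed.

End Mixture.

Section ResidualLaw.
Context {R : realType} {m : nat}.
Local Notation n := m.+1.
Variable U : modes R n.
Hypothesis unitU : unitary U.
Variable t : nat -> R.

Definition tail_weight (c : nat -> R) (k : n.-tuple nat) : R[i] := (c (sumn (behead k)))%:C.

Definition hit (B : set R) (s : nat) : R := \1_B (t s).

Lemma hit_ge0 B s : 0 <= hit B s.
Proof. by rewrite /hit indicE ler0n. Qed.

Lemma hit_le1 B s : hit B s <= 1.
Proof. by rewrite /hit indicE lern1; case: (_ \in _). Qed.

Lemma tail_weight_le1 B k : cabs (tail_weight (hit B) k) <= 1.
Proof. by rewrite cabs_real ger0_norm ?hit_ge0 ?hit_le1. Qed.

Lemma inner_diag (I : choiceType) (u v : l2 R I) (d : I -> R[i]) (c : R) :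
  (forall i, cabs (d i) <= c) -> inner u (diagop d v) = csum (fun i => d i * ((u i)^* * v i)).
Proof.
by move=> dc; apply: eq_csum => i; rewrite (diagE v i dc) mulrCA.
Qed.

Lemma residual_measE s v : residual_meas U s v =
  adj U (diagop (fun k : n.-tuple nat => (sumn (behead k) == s)%:R) (U v)).
Proof. by rewrite /residual_meas /= tens_proj. Qed.

(** Grouping the coordinates by residual photon number collapses the sum over outcomes into one
    diagonal operator conjugated by [U]. *)
Lemma postprocessE B v : postprocess (residual_meas U) t B v =
  adj U (diagop (tail_weight (hit B)) (U v)).
Proof.
have [bU _ _] := unitU.
rewrite -[RHS]mkl2_val; congr mkl2; apply/funext => i.
have d1 s (k : n.-tuple nat) : cabs ((sumn (behead k) == s)%:R : R[i]) <= 1.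
  by rewrite cabs_nat; case: (_ == _); rewrite ?ler01.
pose g (k : n.-tuple nat) := tail_weight (hit B) k * ((U (ket i) k)^* * U v k).
have sg : csm g.
  apply: csm_le (inner_csm (U (ket i)) (U v)) => k.
  by rewrite cabsM ler_piMl ?cabs_ge0// tail_weight_le1.
have [_ [_ e]] := csum_fiber (fun k : n.-tuple nat => sumn (behead k)) sg.
rewrite (adjE _ _ bU) (inner_diag _ _ (tail_weight_le1 B)) [RHS]e.
apply: eq_csum => s; rewrite l2scaleE residual_measE (adjE _ _ bU) (inner_diag _ _ (d1 s)).
rewrite -csumZ; last first.
  apply: csm_le (inner_csm (U (ket i)) (U v)) => k.
  by rewrite cabsM ler_piMl ?cabs_ge0.
apply: eq_csum => k; rewrite /g /tail_weight -/(hit B s).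
by case: eqP => [->|_]; rewrite ?mul1r// !mul0r mulr0.
Qed.

Lemma hit_bigcup (F : (set R)^nat) s : trivIset setT F ->
  asum (fun j => hit (F j) s) /\ rsum (fun j => hit (F j) s) = hit (\bigcup_j F j) s.
Proof.
move=> tF; rewrite /hit.
have [[j _ Fj]|nF] := pselect ((\bigcup_j F j) (t s)); last first.
  rewrite (_ : (fun j => _) = fun=> 0).
    by rewrite indicE memNset// rsum0; split=> //; exact: asum0.
  by apply/funext => i; rewrite indicE memNset// => Fi; apply: nF; exists i.
have z i : i != j -> (\1_(F i) (t s) : R) = 0.
  move=> ij; rewrite indicE memNset// => Fi; move/eqP: ij; apply.
  by apply: (tF i j) => //; exists (t s).
rewrite (rsum_single z) !indicE !mem_set//; last by exists j.
by split=> //; exact: asum_single z.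
Qed.

Lemma series_cvg_csum (f : nat -> R[i]) : csm f ->
  (series f : nat -> R[i]^o) @ \oo --> (csum f : R[i]^o).
Proof.
(* A positive element of [R[i]] is real, so its imaginary part [e2] is 0. *)
move=> sf; apply/cvgrPdist_lt => /= -[e1 e2] /[dup] e0; rewrite ltcE /= => /andP[/eqP e20 e10].
have e4 : 0 < e1 / 2 by rewrite divr_gt0.
have := series_cvg_rsum (csm_Re sf); have := series_cvg_rsum (csm_Im sf).
move=> /cvgrPdist_lt/(_ _ e4) h1 /cvgrPdist_lt/(_ _ e4) h2.
rewrite -[e2]/(e2) e20; near=> N; rewrite cabsE [X in _ < X](_ : _ = e1%:C)// ltcR.
apply: le_lt_trans (cabs_le_ReIm _) _.
have eR : complex.Re (csum f - series f N) =
    complex.Re (csum f) - series (fun i => complex.Re (f i)) N.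
  by rewrite raddfB/=; congr (_ - _); rewrite /series/= raddf_sum.
have eI : complex.Im (csum f - series f N) =
    complex.Im (csum f) - series (fun i => complex.Im (f i)) N.
  by rewrite raddfB/=; congr (_ - _); rewrite /series/= raddf_sum.
rewrite eR eI; have -> : e1 = e1 / 2 + e1 / 2 by field.
apply: ltrD; near: N; [exact: h2|exact: h1].
Unshelve. all: by end_near. Qed.

Lemma inner_postprocess B u v :
  csm (fun k => (U u k)^* * U v k) /\
  inner u (postprocess (residual_meas U) t B v) =
  csum (fun k => tail_weight (hit B) k * ((U u k)^* * U v k)).
Proof.
have [bU _ _] := unitU; split; first exact: inner_csm.
by rewrite postprocessE (adjP' _ _ bU) (inner_diag _ _ (tail_weight_le1 B)).
Qed.

Lemma postprocess_povm : povm (postprocess (residual_meas U) t).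
Proof.
have [bU U1 U2] := unitU; have bA := adj_bounded bU.
split.
- move=> B mB; split.
    have bd := diag_bounded (tail_weight_le1 B).
    apply: (eq_bounded (S := adj U \o (diagop (tail_weight (hit B)) \o U))).
      by move=> v; rewrite postprocessE.
    exact: (bounded_comp bA (bounded_comp bd bU)).
  move=> v; have [_ ->] := inner_postprocess B v v.
  rewrite (eq_csum (g := fun k : n.-tuple nat =>
    (hit B (sumn (behead k)) * cabs (U v k) ^+ 2)%:C)); last first.
    by move=> k; rewrite conj_mul_cabs /tail_weight -rmorphM.
  rewrite csum_real lecR; apply: rsum_pos => k.
  by rewrite mulr_ge0 ?hit_ge0 ?sqr_ge0.
- move=> F mF tF u v.
  pose g k := (U u k)^* * U v k.
  have sg : csm g := (inner_postprocess setT u v).1.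
  pose f k j := tail_weight (hit (F j)) k * g k.
  have sf : csm (fun p => f p.1 p.2).
    have e k j : cabs (f k j) = cabs (g k) * hit (F j) (sumn (behead k)).
      by rewrite /f cabsM cabs_real ger0_norm ?hit_ge0// mulrC.
    have sc (k : n.-tuple nat) := hit_bigcup (sumn (behead k)) tF.
    apply: csm_pairP => [k|] /=.
      by apply: csm_le (asumZ (cabs (g k)) (sc k).1) => j; rewrite e.
    have er k : rsum (fun j => cabs (f k j)) =
        cabs (g k) * hit (\bigcup_j F j) (sumn (behead k)).
      by rewrite (eq_rsum (e k)) -(sc k).2; exact: rsumZ (sc k).1.
    apply: asum_le sg => k; rewrite er.
    by rewrite ger0_norm ?mulr_ge0 ?hit_ge0 ?cabs_ge0// ler_piMr ?cabs_ge0 ?hit_le1.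
  have be : bijective (fun p : nat * n.-tuple nat => (p.2, p.1)).
    by exists (fun p => (p.2, p.1)) => -[].
  have s2 := csm_csum ((csm_bij _ be).1 sf).
  have -> : (fun k => inner u (postprocess (residual_meas U) t (F k) v)) =
      fun j => csum (fun k => f k j).
    by apply/funext => j; rewrite (inner_postprocess _ _ _).2.
  have -> : inner u (postprocess (residual_meas U) t (\bigcup_k F k) v) =
      csum (fun j => csum (fun k => f k j)).
    rewrite -(csum_swap sf) (inner_postprocess _ _ _).2; apply: eq_csum => k.
    have [sc ec] := hit_bigcup (sumn (behead k)) tF.
    rewrite /f /tail_weight -ec -csum_real csumZr//.
    exact: (csm_real _).1.
  exact: series_cvg_csum.
move=> v; rewrite postprocessE.
have -> : diagop (tail_weight (hit setT)) (U v) = U v.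
  apply: l2P => k; rewrite (diagE _ _ (tail_weight_le1 setT)).
  by rewrite /tail_weight /hit indicT mul1r.
exact: U1.
Qed.

Hypothesis rhoU : forall z N, 0 < N ->
  U \o @tpow R n (rho z N) \o adj U =1
  @tens R n (rho ((Num.sqrt n%:R)%:C * z) N) (@tpow R n.-1 (thermal N)).

(** The point where the law loses its dependence on z: only the first mode is displaced, and a
    function of the residual photon number does not see it. *)
Lemma tail_commute (c : nat -> R) (b : R) z : (forall k, cabs (tail_weight c k) <= b) ->
  adj (mxop (@Dfirst R m z)) \o diagop (tail_weight c) =1
  diagop (tail_weight c) \o adj (mxop (@Dfirst R m z)).
Proof.
move=> cb; have [bD eD] := unimx_bounded (@Dfirst_unimx R m z).
have bd := diag_bounded cb; have bA := adj_bounded bD.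
apply: bounded_ext => [||l k]; [exact: (bounded_comp bA bd)|exact: (bounded_comp bd bA)|].
have [_ ->] := entry_comp (diagop (tail_weight c)) l k bA.
have [_ ->] := entry_comp (adj (mxop (@Dfirst R m z))) l k bd.
have ed i j := entry_diag i j cb.
rewrite (csum_single (i0 := k)) => [|j jk]; last by rewrite ed (negbTE jk) !mulr0.
rewrite (csum_single (i0 := l)) => [|j jl]; last by rewrite ed eq_sym (negbTE jl) mulr0 mul0r.
rewrite !ed !eqxx !mulr1 (entry_adj _ _ bD) eD /Dfirst /tensmx.
have [e|ne] := eqVneq [tuple of behead k] [tuple of behead l].
  have -> : tail_weight c k = tail_weight c l.
    by rewrite /tail_weight -[behead k]/(val [tuple of behead k]) e.
  by rewrite mulrC.
by rewrite (_ : false%:R = 0)// mulr0 conjC0 mul0r mulr0.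
Qed.

(** The unitary [adj U \o W] diagonalizes both the state and the effect, so the trace is the sum of
    the products of their eigenvalues; the first mode sums to 1. *)
Lemma postprocess_law z N B : 0 < N ->
  outcome_law z N (postprocess (residual_meas U) t) B =
  (rsum (fun k : m.-tuple nat => tw N k * hit B (sumn k)))%:E.
Proof.
move=> N0; have [bU U1 U2] := unitU; have bA := adj_bounded bU.
set z' := (Num.sqrt n%:R)%:C * z.
have uD := unimx_unitary (@Dfirst_unimx R m z').
set W := mxop (@Dfirst R m z') in uD *.
have bW : bounded_op W by case: uD.
pose w (k : n.-tuple nat) := tw N k * hit B (sumn (behead k)).
have uY := unitary_comp (unitary_adj unitU) uD.
have w0 k : 0 <= w k by rewrite mulr_ge0 ?tw_ge0 ?hit_ge0.
have [sw ew] : asum w /\ rsum w = rsum (fun k : m.-tuple nat => tw N k * hit B (sumn k)).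
  have [st et] := rsum_tw m N0; have [s1 e1] := rsum_thw N0.
  have s2 : asum (fun k : m.-tuple nat => tw N k * hit B (sumn k)).
    apply: asum_le st => k; rewrite ger0_norm ?mulr_ge0 ?tw_ge0 ?hit_ge0//.
    by rewrite ler_piMr ?tw_ge0 ?hit_le1.
  have e : w \o @tcons m = fun p => thw N p.1 * (tw N p.2 * hit B (sumn p.2)).
    by apply/funext => p; rewrite /w /= /tw tprod_tcons mulrA.
  have sp : asum (w \o @tcons m).
    rewrite e; apply/csm_real.
    apply: eq_csm (csm_prod ((csm_real _).1 s1) ((csm_real _).1 s2)) => p.
    by rewrite -rmorphM.
  split; first exact/(asum_bij _ (tcons_bij m)).
  rewrite (rsum_bij _ (tcons_bij m)) rsum_pair// e/=.
  rewrite (eq_rsum (g := fun i =>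
    rsum (fun k : m.-tuple nat => tw N k * hit B (sumn k)) * thw N i)).
    by rewrite rsumZ// e1 mulr1.
  by move=> i; rewrite rsumZ// mulrC.
have Y1 v : adj (adj U \o W) v = adj W (U v).
  apply: inner_ext => x; have [bY _ _] := uY.
  apply: etrans (adjP' x v bY) _; apply: etrans _ (esym (adjP' x (U v) bW)).
  exact: adjP.
have T v : @tpow R n (rho z N) v = adj U (W (diagop (fun k => (tw N k)%:C) (adj W (U v)))).
  have h := rhoU z N0 (U v).
  have {}h := etrans h (tens_rho z' N0 (U v)).
  apply: etrans (congr1 (adj U) h).
  apply: etrans _ (esym (U1 _)) => /=.
  by congr (tpow _ _); apply: esym; exact: U1.
rewrite /outcome_law -ew; congr (_%:E).
suff -> : @tpow R n (rho z N) \o postprocess (residual_meas U) t B =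
    (adj U \o W) \o diagop (fun k => (w k)%:C) \o adj (adj U \o W).
  by rewrite (tr_conj_diag uY w0 sw).
apply/funext => v; apply: etrans (T (postprocess (residual_meas U) t B v)) _.
apply: etrans _ (congr1 (fun x => adj U (W (diagop (fun k => (w k)%:C) x))) (esym (Y1 v))).
apply: (@congr1 _ _ (fun x => adj U (W x))); rewrite (postprocessE B v).
have e1 : U (adj U (diagop (tail_weight (hit B)) (U v))) = diagop (tail_weight (hit B)) (U v).
  exact: U2.
have e2 : adj W (diagop (tail_weight (hit B)) (U v)) = diagop (tail_weight (hit B)) (adj W (U v)).
  exact: (tail_commute z' (tail_weight_le1 B) (U v)).
rewrite e1 e2; apply: l2P => k.
rewrite (diagE _ _ (fun k => tw_le1 k N0)) (diagE _ _ (tail_weight_le1 B)).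
have wb k' : cabs (w k')%:C <= rsum w := le_rsum k' w0 sw.
apply: etrans _ (esym (diagE (adj W (U v)) k wb)).
by rewrite mulrA -rmorphM.
Qed.

Lemma postprocess_risk psi z N : 0 < N ->
  risk psi z N (postprocess (residual_meas U) t) =
  \esum_(k in [set: m.-tuple nat]) (tw N k * (t (sumn k) - psi N) ^+ 2)%:E.
Proof.
move=> N0; rewrite /risk.
have mf : measurable_fun [set: R] (fun x => ((x - psi N) ^+ 2)%:E).
  by apply/measurable_EFinP; apply: measurable_funX; exact: measurable_funB.
have f0 (x : R) : (0 <= ((x - psi N) ^+ 2)%:E)%E by rewrite lee_fin sqr_ge0.
rewrite (integral_mixture (I := m.-tuple nat) (w := @tw R N m)
  (mu := fun k : m.-tuple nat => \d_(t (sumn k)))) //.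
- apply: eq_esum => k _; rewrite integral_dirac//.
  by rewrite diracT mul1e EFinM.
- by move=> k; exact: tw_ge0.
move=> A mA; rewrite postprocess_law// rsum_ge0.
- by apply: eq_esum => k _; rewrite EFinM; congr (_ * _)%E.
- by move=> k; rewrite mulr_ge0 ?tw_ge0 ?hit_ge0.
have [st _] := rsum_tw m N0; apply: asum_le st => k.
rewrite ger0_norm ?mulr_ge0 ?tw_ge0 ?hit_ge0//.
by rewrite ler_piMr ?tw_ge0 ?hit_le1.
Qed.

End ResidualLaw.

(** * The lower bound *)

Section PovmLaw.
Context {R : realType} {I : choiceType}.
Variable M : set R -> op R I.

Section Law.
Hypothesis hM : povm M.
Variable i : I.

Definition diag_mass (B : set R) : R := complex.Re (entry (M B) i i).

Lemma diag_mass_ge0 B : measurable B -> 0 <= diag_mass B.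
Proof.
move=> mB; have [h _ _] := hM; have [_ p] := h B mB.
by have := p (ket i); rewrite lecE => /andP[].
Qed.

Lemma diag_mass_setT : diag_mass setT = 1.
Proof.
have [_ _ h] := hM; rewrite /diag_mass entryE h.
by rewrite ketE eqxx.
Qed.

Lemma diag_mass_cvg (F : (set R)^nat) : (forall j, measurable (F j)) -> trivIset setT F ->
  series (fun j => diag_mass (F j)) @ \oo --> diag_mass (\bigcup_j F j).
Proof.
move=> mF tF; have [_ h _] := hM.
apply/cvgrPdist_lt => e e0; have e0' : 0 < e%:C :> R[i] by rewrite ltcR.
have /cvgrPdist_lt/(_ _ e0') := h F mF tF (ket i) (ket i).
apply: filterS => n; rewrite cabsE ltcR; apply: le_lt_trans.
apply: le_trans (Re_le_cabs _); rewrite raddfB/=.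
have -> : complex.Re (series (fun j => inner (ket i) (M (F j) (ket i))) n) =
    series (fun j => diag_mass (F j)) n by rewrite /series/= raddf_sum.
exact: lexx.
Qed.

(** Additivity on a constant sequence of empty sets yields a convergent series with constant
    terms. *)
Lemma diag_mass_set0 : diag_mass set0 = 0.
Proof.
have m0 (j : nat) : measurable (set0 : set R) by exact: measurable0.
have t0 : trivIset setT (fun _ : nat => set0 : set R) by exact: trivIset_set0.
have /cvgP/cvg_series_cvg_0 h := diag_mass_cvg m0 t0.
by apply: cvg_unique h => //; exact: cvg_cst.
Qed.

End Law.

(* Additivity of [M] is only known on measurable sets, hence the junk value elsewhere. *)
Definition diag_law (hM : povm M) (i : I) (B : set R) : \bar R :=
  if `[< measurable B >] then (diag_mass i B)%:E else 0%E.

Section Measure.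
Hypothesis hM : povm M.
Variable i : I.

Lemma diag_lawE B : measurable B -> diag_law hM i B = (diag_mass i B)%:E.
Proof. by move=> mB; rewrite /diag_law; case: asboolP. Qed.

Let diag_law0 : diag_law hM i set0 = 0%E.
Proof. by rewrite diag_lawE// diag_mass_set0. Qed.

Let diag_law_ge0 B : (0 <= diag_law hM i B)%E.
Proof. by rewrite /diag_law; case: asboolP => // mB; rewrite lee_fin diag_mass_ge0. Qed.

Let diag_law_additive : semi_sigma_additive (diag_law hM i).
Proof.
move=> F mF tF mU; rewrite diag_lawE//.
have -> : (fun n => \sum_(0 <= j < n) diag_law hM i (F j))%E =
    EFin \o series (fun j => diag_mass i (F j)).
  apply/funext => n /=; rewrite -sumEFin; apply: eq_bigr => j _.
  exact: diag_lawE.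
apply/fine_cvgP; split; first exact: nearW.
by rewrite (_ : fine \o _ = series (fun j => diag_mass i (F j)))//; exact: diag_mass_cvg.
Qed.

HB.instance Definition _ := isMeasure.Build _ _ _ (diag_law hM i)
  diag_law0 diag_law_ge0 diag_law_additive.

Lemma diag_law_setT : diag_law hM i setT = 1%E.
Proof. by rewrite diag_lawE// diag_mass_setT. Qed.

End Measure.
End PovmLaw.

(** * Second moments and Jensen's inequality *)

Section Jensen.
Context {R : realType}.
Variable mu : {measure set R -> \bar R}.
Hypothesis mu1 : mu setT = 1%E.

Lemma integrable_of_second_moment (p : R) :
  (\int[mu]_x ((x - p) ^+ 2)%:E < +oo)%E -> mu.-integrable setT (fun x : R => (x - p)%:E).
Proof.
move=> h.
have mf : measurable_fun [set: R] (fun x : R => x - p) by exact: measurable_funB.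
have mf2 : measurable_fun [set: R] (fun x => ((x - p) ^+ 2)%:E).
  by apply/measurable_EFinP; exact: measurable_funX.
have ic : mu.-integrable setT (fun _ : R => 1%:E : \bar R).
  apply/integrableP; split; first exact: measurable_cst.
  under eq_integral do rewrite abse1.
  by rewrite integral_cst// mul1e mu1 ltry.
have is2 : mu.-integrable setT (fun x : R => ((x - p) ^+ 2)%:E).
  apply/integrableP; split => //; apply: le_lt_trans h.
  rewrite le_eqVlt; apply/orP; left; apply/eqP; apply: eq_integral => x _.
  by rewrite /= ger0_norm ?sqr_ge0.
have isum := integrableD measurableT ic is2.
apply: le_integrable isum => //; first exact/measurable_EFinP.
move=> x _ /=; rewrite lee_fin [leRHS]ger0_norm ?addr_ge0 ?sqr_ge0//.
have := sqr_ge0 (`|x - p| - 1); rewrite -(real_normK (num_real (x - p))); nra.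
Qed.

Definition mean : R := fine (\int[mu]_x x%:E).

(** [c * x - d] is the tangent to (x - p)^2 at the mean: it lies below the parabola, and its
    integral is its value at the mean. *)
Lemma jensen_sq (p : R) : mu.-integrable setT (fun x : R => x%:E) ->
  (((mean - p) ^+ 2)%:E <= \int[mu]_x ((x - p) ^+ 2)%:E)%E.
Proof.
move=> ix; set c := 2 * (mean - p); set d := mean ^+ 2 - p ^+ 2.
have ic (b : R) : mu.-integrable setT (fun _ : R => b%:E : \bar R).
  apply/integrableP; split; first exact: measurable_cst.
  rewrite integral_cst// mu1 mule1; exact: ltry.
have il : mu.-integrable setT (fun x : R => (c%:E * x%:E - d%:E)%E).
  by apply: integrableB => //; exact: integrableZl.
have e : (\int[mu]_x (c%:E * x%:E - d%:E) = ((mean - p) ^+ 2)%:E)%E.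
  rewrite integralB//; last exact: integrableZl.
  rewrite integralZl// integral_cst// mu1 mule1.
  have fm : (\int[mu]_x x%:E = mean%:E)%E by rewrite fineK//; exact: integrable_fin_num.
  by rewrite fm -EFinM -EFinB /c /d; congr (_%:E); ring.
rewrite -e.
have mf2 : measurable_fun [set: R] (fun x => ((x - p) ^+ 2)%:E).
  by apply/measurable_EFinP; apply: measurable_funX; exact: measurable_funB.
have [fin|] := boolP (\int[mu]_x ((x - p) ^+ 2)%:E < +oo)%E; last first.
  by rewrite -leNgt leye_eq => /eqP ->; rewrite leey.
apply: le_integral => //.
  apply/integrableP; split => //; apply: le_lt_trans fin.
  rewrite le_eqVlt; apply/orP; left; apply/eqP; apply: eq_integral => x _.
  by rewrite /= ger0_norm ?sqr_ge0.
move=> x _; rewrite -EFinM -EFinB lee_fin /c /d.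
have := sqr_ge0 (x - mean); rewrite -subr_ge0; nra.
Qed.

End Jensen.

Lemma le_esum_term (R : realType) (I : choiceType) (f : I -> \bar R) (k : I) :
  (forall i, 0 <= f i)%E -> (f k <= \esum_(i in setT) f i)%E.
Proof.
move=> f0; rewrite (esumID [set k])// setTI esum_set1//.
by rewrite leeDl// esum_ge0.
Qed.

(** * Reduction to a classical estimator at z = 0 *)

Section RiskAtZero.
Context {R : realType} {n : nat}.

Lemma tpow_rho0 N : 0 < N -> @tpow R n (rho 0 N) = @tpow R n (thermal N).
Proof.
move=> N0; congr mxop; apply/funext => k; apply/funext => l; apply: eq_bigr => i _.
rewrite (entry_rho 0 (tnth k i) (tnth l i) N0).2 thermalE.
rewrite (entry_diag _ _ (fun k => thw_le1 k N0)).
rewrite (csum_single (i0 := tnth k i)) => [|j jk]; rewrite !Dmx0.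
  by rewrite eqxx mul1r conj_nat eq_sym.
by rewrite eq_sym (negbTE jk) mul0r mul0r.
Qed.

Variable M : set R -> op R (n.-tuple nat).
Hypothesis hM : povm M.

Lemma outcome_law0 N B : 0 < N -> measurable B ->
  outcome_law 0 N M B = \esum_(k in [set: n.-tuple nat]) ((tw N k)%:E * diag_law hM k B)%E.
Proof.
move=> N0 mB; have [h1 h2 h3] := hM; have [bB pB] := h1 B mB.
have ee (k : n.-tuple nat) : entry (@tpow R n (rho 0 N) \o M B) k k =
    (tw N k * diag_mass M k B)%:C.
  rewrite tpow_rho0//.
  have -> : @tpow R n (thermal N) = diagop (fun k => (tw N k)%:C).
    by apply/funext => v; exact: tpow_thermal.
  have bd := diag_bounded (fun k : n.-tuple nat => tw_le1 k N0).
  have [_ ->] := entry_comp (M B) k k bd.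
  rewrite (csum_single (i0 := k)) => [|j jk];
    rewrite (entry_diag _ _ (fun k : n.-tuple nat => tw_le1 k N0)).
    rewrite eqxx mulr1 rmorphM/=; congr (_ * _).
    have := pB (ket k); rewrite lecE => /andP[/eqP e _].
    by rewrite /diag_mass /entry; move: e; case: (inner _ _) => a b /= ->.
  by rewrite eq_sym (negbTE jk) mulr0 mul0r.
rewrite /outcome_law /tr (eq_csum ee) csum_real/= rsum_ge0.
- by apply: eq_esum => k _; rewrite diag_lawE.
- by move=> k; rewrite mulr_ge0 ?tw_ge0 ?diag_mass_ge0.
have [st _] := rsum_tw n N0; apply: asum_le st => k.
rewrite ger0_norm ?mulr_ge0 ?tw_ge0 ?diag_mass_ge0//.
rewrite ler_piMr ?tw_ge0// -lee_fin -(diag_lawE hM k mB) -(diag_law_setT hM k).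
by apply: le_measure; rewrite ?inE//.
Qed.

Lemma risk0 psi N : 0 < N ->
  risk psi 0 N M = \esum_(k in [set: n.-tuple nat])
    ((tw N k)%:E * \int[diag_law hM k]_x ((x - psi N) ^+ 2)%:E)%E.
Proof.
move=> N0; rewrite /risk.
apply: (integral_mixture (I := n.-tuple nat) (w := @tw R N n)
  (mu := fun k : n.-tuple nat => diag_law hM k)).
- by move=> k; exact: tw_ge0.
- by move=> A mA; exact: outcome_law0.
- by apply/measurable_EFinP; apply: measurable_funX; exact: measurable_funB.
by move=> x; rewrite lee_fin sqr_ge0.
Qed.

Lemma tw_gt0 N (k : n.-tuple nat) : 0 < N -> 0 < tw N k :> R.
Proof.
move=> N0; apply: prodr_gt0 => i _; rewrite mulr_gt0 ?invr_gt0 ?exprn_gt0 ?divr_gt0//;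
  by rewrite addr_gt0.
Qed.

(* Jensen reduces a measurement with worst risk at most [W] to its conditional means at [z = 0]. *)
Lemma mean_sq_risk (psi : R -> R) (K : set R) (W : R) : K `<=` [set N | 0 < N] -> K !=set0 ->
  (worst_risk psi K M <= W%:E)%E ->
  exists f : n.-tuple nat -> R, forall N, K N ->
    asum (fun k => tw N k * (f k - psi N) ^+ 2) /\
    rsum (fun k => tw N k * (f k - psi N) ^+ 2) <= W.
Proof.
move=> K0 [N1 KN1] hW.
have rW N : K N -> (\esum_(k in [set: n.-tuple nat])
    ((tw N k)%:E * \int[diag_law hM k]_x ((x - psi N) ^+ 2)%:E) <= W%:E)%E.
  move=> KN; rewrite -risk0; last exact: K0.
  by apply: le_trans hW; apply: ereal_sup_ubound; exists (0, N).
have I0 N k : (0 <= \int[diag_law hM k]_x ((x - psi N) ^+ 2)%:E)%E.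
  by apply: integral_ge0 => x _; rewrite lee_fin sqr_ge0.
(* One point of [K] settles integrability for all number states, since each has positive thermal
   weight. *)
have fin k : (\int[diag_law hM k]_x ((x - psi N1) ^+ 2)%:E < +oo)%E.
  rewrite ltNge leye_eq; apply/negP => /eqP e.
  have : (W%:E < +oo)%E by exact: ltry.
  rewrite ltNge => /negP; apply; apply: le_trans (rW _ KN1).
  have w0 := tw_gt0 k (K0 _ KN1).
  have e' : ((tw N1 k)%:E * \int[diag_law hM k]_x ((x - psi N1) ^+ 2)%:E = +oo)%E.
    by rewrite e gt0_muley ?lte_fin.
  rewrite -e'; pose g (k : n.-tuple nat) :=
    ((tw N1 k)%:E * \int[diag_law hM k]_x ((x - psi N1) ^+ 2)%:E)%E.
  apply: (@le_esum_term _ _ g k) => j; apply: mule_ge0; last exact: I0.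
  by rewrite lee_fin; apply: ltW; apply: tw_gt0; exact: K0.
have int k : (diag_law hM k).-integrable setT (fun x : R => x%:E).
  have i1 := integrable_of_second_moment (diag_law_setT hM k) (fin k).
  have ic : (diag_law hM k).-integrable setT (fun _ : R => (psi N1)%:E : \bar R).
    apply/integrableP; split; first exact: measurable_cst.
    by rewrite integral_cst//= diag_law_setT mule1; exact: ltry.
  have := integrableD measurableT i1 ic; apply: eq_integrable => // x _ /=.
  by rewrite -EFinD subrK.
exists (fun k => mean (diag_law hM k)) => N KN.
have N0 : 0 < N := K0 N KN.
have p0 k : 0 <= tw N k * (mean (diag_law hM k) - psi N) ^+ 2.
  by rewrite mulr_ge0 ?tw_ge0 ?sqr_ge0.
have le : (\esum_(k in [set: n.-tuple nat]) (tw N k * (mean (diag_law hM k) - psi N) ^+ 2)%:E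
    <= W%:E)%E.
  apply: le_trans (rW _ KN); apply: le_esum => k _; rewrite EFinM.
  apply: lee_wpmul2l; first by rewrite lee_fin tw_ge0.
  exact: (jensen_sq (diag_law_setT hM k) (psi N) (int k)).
have s : asum (fun k => tw N k * (mean (diag_law hM k) - psi N) ^+ 2).
  by apply/(asum_ge0E p0); apply: le_lt_trans le _; exact: ltry.
by split=> //; rewrite -lee_fin rsum_ge0.
Qed.

End RiskAtZero.

(** * The Chapman-Robbins inequality *)

Section ChapmanRobbins.
Context {R : realType} {I : choiceType}.
Variables (w f : I -> R) (c W : R).
Hypotheses (w0 : forall k, 0 < w k) (sw : asum w) (w1 : rsum w = 1).
Hypotheses (sf : asum (fun k => w k * (f k - c) ^+ 2))
  (fW : rsum (fun k => w k * (f k - c) ^+ 2) <= W).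

Lemma sqrt_weight k : Num.sqrt (w k) ^+ 2 = w k.
Proof. by rewrite sqr_sqrtr ?ltW. Qed.

Lemma sqrt_weight_neq0 k : Num.sqrt (w k) != 0.
Proof. by rewrite gt_eqF// sqrtr_gt0. Qed.

(** Cauchy-Schwarz for sqrt w (f - c) and v / sqrt w. With v = w it bounds the bias, with v = w' - w
    it gives Chapman-Robbins. The centre [c] is the target value and not the mean of [f], so the
    second moment is the risk itself. *)
Lemma asum_score (v : I -> R) : asum (fun k => v k ^+ 2 / w k) ->
  asum (fun k => v k * (f k - c)) /\
  rsum (fun k => v k * (f k - c)) ^+ 2 <= W * rsum (fun k => v k ^+ 2 / w k).
Proof.
move=> sv; pose a k := Num.sqrt (w k) * (f k - c); pose b k := v k / Num.sqrt (w k).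
have ea : (fun k => a k ^+ 2) = fun k => w k * (f k - c) ^+ 2.
  by apply/funext => k; rewrite exprMn sqrt_weight.
have eb : (fun k => b k ^+ 2) = fun k => v k ^+ 2 / w k.
  by apply/funext => k; rewrite expr_div_n sqrt_weight.
have eab : (fun k => a k * b k) = fun k => v k * (f k - c).
  by apply/funext => k; rewrite /a /b; field; exact: sqrt_weight_neq0.
have [] := @rsum_cauchy R I a b; rewrite ?ea ?eb ?eab// => s h.
split=> //; apply: (@le_trans _ _ (rsum (fun k => `|a k * b k|) ^+ 2)).
  rewrite -eab -(real_normK (num_real (rsum _))) lerXn2r ?nnegrE ?rsum_pos//.
  by apply: ler_rsum_norm; rewrite eab.
apply: le_trans h _; apply: ler_wpM2r => //; apply: rsum_pos => k.
by rewrite divr_ge0 ?sqr_ge0 ?ltW.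
Qed.

Lemma asum_expectation (v : I -> R) : asum v -> asum (fun k => v k ^+ 2 / w k) ->
  asum (fun k => v k * f k) /\ rsum (fun k => v k * f k) - c * rsum v =
    rsum (fun k => v k * (f k - c)).
Proof.
move=> sv sv2; have [s _] := asum_score sv2.
have e : (fun k => v k * f k) = fun k => v k * (f k - c) + c * v k.
  by apply/funext => k; ring.
rewrite e; split; first by apply: asumD => //; exact: asumZ.
by rewrite rsumD ?rsumZ ?addrK//; exact: asumZ.
Qed.

Lemma expectation_bias :
  asum (fun k => w k * f k) /\ (rsum (fun k => w k * f k) - c) ^+ 2 <= W.
Proof.
have e : (fun k => w k ^+ 2 / w k) = w.
  by apply/funext => k; rewrite expr2 mulfK// gt_eqF.
have [] := @asum_expectation w; rewrite ?e// w1 mulr1 => s ->; split=> //.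
by have [] := @asum_score w; rewrite e// w1 mulr1.
Qed.

(** The centre [c] drops out because w' - w has sum 0, and the sum of (w' - w)^2 / w is X - 1. *)
Lemma chapman_robbins (w' : I -> R) (X : R) : asum w' -> rsum w' = 1 ->
  asum (fun k => w' k ^+ 2 / w k) -> rsum (fun k => w' k ^+ 2 / w k) = X ->
  (rsum (fun k => w' k * f k) - rsum (fun k => w k * f k)) ^+ 2 <= W * (X - 1).
Proof.
move=> sw' w'1 sX eX; pose v k := w' k - w k.
have ev : (fun k => v k ^+ 2 / w k) = fun k => w' k ^+ 2 / w k - (2 * w' k - w k).
  by apply/funext => k; rewrite /v; field; rewrite gt_eqF.
have s2 : asum (fun k => 2 * w' k - w k) by apply: asumB => //; exact: asumZ.
have sv2 : asum (fun k => v k ^+ 2 / w k) by rewrite ev; exact: asumB.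
have sv : asum v by exact: asumB.
have v0 : rsum v = 0 by rewrite rsumB// w1 w'1 subrr.
have [s h] := asum_score sv2; have [s' e] := asum_expectation sv sv2.
have [swf _] := expectation_bias; have [sw'f _] := asum_expectation sw' sX.
have -> : rsum (fun k => w' k * f k) - rsum (fun k => w k * f k) = rsum (fun k => v k * (f k - c)).
  by rewrite -e v0 mulr0 subr0 -rsumB//; apply: eq_rsum => k; rewrite mulrBl.
apply: le_trans h _; rewrite ev !rsumB ?rsumZ//; last exact: asumZ.
by rewrite eX w1 w'1 (_ : _ - (_ - _) = X - 1)//; ring.
Qed.

End ChapmanRobbins.

(** * Chi-square distance of thermal weights and its accumulation *)

Section ThermalRatio.
Context {R : realType}.
Implicit Types N : R.

(** The terms are geometric with ratio [x], and 1 - x has the sign of N (N + 1) - (N' - N)^2, hence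
    the last hypothesis. *)
Lemma rsum_thw_ratio N (N' : R) : 0 < N -> 0 < N' -> (N' - N) ^+ 2 < N * (N + 1) ->
  asum (fun k => thw N' k ^+ 2 / thw N k) /\
  rsum (fun k => thw N' k ^+ 2 / thw N k) =
    N * (N + 1) / (N * (N + 1) - (N' - N) ^+ 2).
Proof.
move=> N0 N'0 h; have N1 : 0 < N + 1 by rewrite addr_gt0.
have N'1 : 0 < N' + 1 by rewrite addr_gt0.
pose a := (N + 1) / (N' + 1) ^+ 2; pose x := (N' / (N' + 1)) ^+ 2 * ((N + 1) / N).
have e : (fun k => thw N' k ^+ 2 / thw N k) = fun k => a * x ^+ k.
  apply/funext => k; rewrite /thw /a /x !exprMn -!exprM !exprVn.
  rewrite !exprM; field.
  by rewrite !expf_neq0 ?gt_eqF.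
have a0 : 0 <= a by rewrite divr_ge0 ?sqr_ge0 ?ltW.
have x0 : 0 <= x by rewrite mulr_ge0 ?sqr_ge0// divr_ge0 ?ltW.
have ex : 1 - x = (N * (N + 1) - (N' - N) ^+ 2) / (N * (N' + 1) ^+ 2).
  by rewrite /x; field; rewrite !gt_eqF.
have x1 : x < 1.
  by rewrite -subr_gt0 ex divr_gt0 ?subr_gt0// mulr_gt0 ?exprn_gt0.
have x01 : 0 <= x < 1 by rewrite x0.
have [s es] := rsum_geometric a0 x01.
rewrite e; split=> //; rewrite es ex /a; field.
by rewrite !gt_eqF ?subr_gt0.
Qed.

Lemma rsum_tw_ratio n N (N' : R) : 0 < N -> 0 < N' -> (N' - N) ^+ 2 < N * (N + 1) ->
  asum (fun k : n.-tuple nat => tw N' k ^+ 2 / tw N k) /\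
  rsum (fun k : n.-tuple nat => tw N' k ^+ 2 / tw N k) =
    (N * (N + 1) / (N * (N + 1) - (N' - N) ^+ 2)) ^+ n.
Proof.
move=> N0 N'0 h; have [s e] := rsum_thw_ratio N0 N'0 h.
have [st et] := rsum_tprod (fun _ : 'I_n => s).
have ee : (fun k : n.-tuple nat => tw N' k ^+ 2 / tw N k) =
    tprod (fun _ : 'I_n => fun k => thw N' k ^+ 2 / thw N k).
  apply/funext => k; rewrite /tw /tprod -prodrXl -prodfV -big_split/=.
  by apply: eq_bigr => i _.
by rewrite ee; split=> //; rewrite et prodr_const card_ord e.
Qed.

(* Bernoulli: [(1 - u)^n >= 1 - n u]. *)
Lemma thermal_chi2 n N N' (V h : R) : 0 < N -> 0 < N' -> 0 < V -> V <= N * (N + 1) ->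
  h = (N' - N) ^+ 2 -> n.+1%:R * h < V ->
  asum (fun k : n.+1.-tuple nat => tw N' k ^+ 2 / tw N k) /\
  rsum (fun k : n.+1.-tuple nat => tw N' k ^+ 2 / tw N k) - 1 <= n.+1%:R * h / (V - n.+1%:R * h).
Proof.
move=> N0 N'0 V0 VN eh hV; set q := N * (N + 1) in VN *.
have h0 : 0 <= h by rewrite eh sqr_ge0.
have hn : h <= n.+1%:R * h by rewrite ler_peMl// ler1n.
have q0 : 0 < q by exact: lt_le_trans VN.
have hq : h < q by apply: le_lt_trans hn _; exact: lt_le_trans VN.
have hq' : (N' - N) ^+ 2 < N * (N + 1) by rewrite -eh.
have [s e] := rsum_tw_ratio n.+1 N0 N'0 hq'; split=> //; rewrite e -eh -/q.
have u : h / q <= h / V by rewrite ler_wpM2l// lef_pV2.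
have V1 : 0 < V - n.+1%:R * h by rewrite subr_gt0.
have b (x : R) (m : nat) : 0 <= x <= 1 -> 1 - m%:R * x <= (1 - x) ^+ m.
  move=> /andP[x0 x1]; elim: m => [|m ih]; first by rewrite mul0r subr0 expr0.
  rewrite exprS; apply: le_trans (ler_wpM2l _ ih); last by rewrite subr_ge0.
  rewrite -natr1; have : 0 <= m%:R * x * x by rewrite !mulr_ge0.
  nra.
have hV1 : h < V by exact: le_lt_trans hV.
have hV01 : 0 <= h / V <= 1.
  by rewrite divr_ge0 ?(ltW V0)//= ler_pdivrMr// mul1r ltW.
have B := b _ n.+1 hV01.
have -> : q / (q - h) = (1 - h / q)^-1.
  by rewrite -(divff (lt0r_neq0 q0)) -mulrBl invf_div.
have p0 : 0 < 1 - n.+1%:R * (h / V) by rewrite subr_gt0 mulrA ltr_pdivrMr// mul1r.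
have le1 : 1 - n.+1%:R * (h / V) <= (1 - h / q) ^+ n.+1.
  apply: le_trans B _; apply: lerXn2r; rewrite ?nnegrE ?subr_ge0 ?(andP hV01).2//.
    by rewrite ltW// ltr_pdivrMr// mul1r.
  by rewrite lerD2l lerN2.
rewrite exprVn lerBlDr; apply: (@le_trans _ _ (1 - n.+1%:R * (h / V))^-1).
  by rewrite lef_pV2 ?posrE// (lt_le_trans p0).
rewrite le_eqVlt; apply/orP; left; apply/eqP; field.
by rewrite nat1r !gt_eqF.
Qed.

Lemma telescope_bound (g : nat -> R) (e : R) n :
  (forall j, (j < n)%N -> `|g j.+1 - g j| <= e) -> `|g n - g 0%N| <= n%:R * e.
Proof.
elim: n => [|n ih] h; first by rewrite subrr normr0 mul0r.
have -> : g n.+1 - g 0%N = (g n.+1 - g n) + (g n - g 0%N) by ring.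
rewrite (le_trans (ler_normD _ _))// -natr1 mulrDl mul1r addrC lerD ?h//.
by apply: ih => j jn; apply: h; exact: ltnW.
Qed.

Lemma sqr_le_sqrt (x y : R) : x ^+ 2 <= y -> `|x| <= Num.sqrt y.
Proof. by move=> xy; rewrite -sqrtr_sqr ler_wsqrtr. Qed.

(* Chapman-Robbins on each of [n + 1] equal subintervals of [[a, b]]. *)
Lemma increment_bound n (a b W : R) (psi : R -> R) (f : n.+1.-tuple nat -> R) (V := a * (a + 1)) :
  0 < a -> a < b -> (b - a) ^+ 2 < n.+1%:R * V ->
  (forall N, a <= N <= b -> asum (fun k => tw N k * (f k - psi N) ^+ 2) /\
    rsum (fun k => tw N k * (f k - psi N) ^+ 2) <= W) ->
  (psi b - psi a) ^+ 2 <= n.+1%:R * W *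
    (2 / Num.sqrt n.+1%:R + (b - a) * Num.sqrt (V - (b - a) ^+ 2 / n.+1%:R)^-1) ^+ 2.
Proof.
move=> a0 ab dV hW; set d := b - a in dV *.
(* The number of modes, also the number of steps, becomes an opaque real, which [field] treats as an
   atom. *)
have [m em] : {m : R | m = n.+1%:R} by exists n.+1%:R.
rewrite -em in dV *.
have d0 : 0 < d by rewrite subr_gt0.
have m0 : 0 < m by rewrite em ltr0Sn.
have md : m * (d ^+ 2 / m ^+ 2) = d ^+ 2 / m by field; rewrite gt_eqF.
have V0 : 0 < V by rewrite mulr_gt0// addr_gt0.
have D0 : 0 < V - d ^+ 2 / m by rewrite subr_gt0 ltr_pdivrMr// mulrC.
have tw0 N : 0 < N -> forall k : n.+1.-tuple nat, 0 < tw N k :> R.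
  by move=> N0 k; exact: tw_gt0.
have inN N : a <= N <= b -> 0 < N by move=> /andP[aN _]; exact: lt_le_trans aN.
pose E N := rsum (fun k : n.+1.-tuple nat => tw N k * f k).
have bias N : a <= N <= b -> `|E N - psi N| <= Num.sqrt W.
  move=> aNb; have N0 := inN _ aNb; have [s1 e1] := rsum_tw n.+1 N0; have [s2 e2] := hW _ aNb.
  by have [_ h] := expectation_bias (tw0 _ N0) s1 e1 s2 e2; exact: sqr_le_sqrt.
have W0 : 0 <= W.
  have [|s2 e2] := hW a; first by rewrite lexx ltW.
  apply: le_trans e2; apply: rsum_pos => k.
  by rewrite mulr_ge0 ?sqr_ge0// ltW// tw0.
pose p j := a + d * j%:R / m.
have pin j : (j <= n.+1)%N -> a <= p j <= b.
  move=> jn; rewrite /p lerDl divr_ge0 ?mulr_ge0 ?(ltW d0) ?(ltW m0)//= -lerBrDl -/d.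
  by rewrite ler_pdivrMr// ler_wpM2l ?(ltW d0)// em ler_nat.
have step j : (j < n.+1)%N -> `|E (p j.+1) - E (p j)| <=
    Num.sqrt W * (d * Num.sqrt m^-1 * Num.sqrt (V - d ^+ 2 / m)^-1).
  move=> jn; have i1 := pin _ (ltnW jn); have i2 := pin _ jn.
  have N0 := inN _ i1; have N1 := inN _ i2.
  have [s1 e1] := rsum_tw n.+1 N0; have [s2 e2] := rsum_tw n.+1 N1.
  have [s3 e3] := hW _ i1.
  have eh : d ^+ 2 / m ^+ 2 = (p j.+1 - p j) ^+ 2.
    by rewrite /p -[j.+1%:R]natr1; field; rewrite gt_eqF.
  have Vp : V <= p j * (p j + 1).
    by move: i1 => /andP[i1 _]; apply: ler_pM; rewrite ?lerD2r ?addr_ge0 ?(ltW a0).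
  have hV : n.+1%:R * (d ^+ 2 / m ^+ 2) < V by rewrite -em md -subr_gt0.
  have [s4 e4] := thermal_chi2 N0 N1 V0 Vp eh hV.
  have := chapman_robbins (tw0 _ N0) s1 e1 s3 e3 s2 e2 s4 erefl.
  move=> /sqr_le_sqrt h; apply: le_trans h _.
  rewrite sqrtrM// ler_wpM2l ?sqrtr_ge0// -{1}(ger0_norm (ltW d0)).
  rewrite -sqrtr_sqr -!sqrtrM ?sqr_ge0//; last first.
    by rewrite mulr_ge0 ?sqr_ge0// invr_ge0 ltW.
  by apply: ler_wsqrtr; apply: le_trans e4 _; rewrite -em md.
have tele := telescope_bound (g := E \o p) step.
have p0 : p 0%N = a by rewrite /p mulr0 mul0r addr0.
have pn : p n.+1 = b by rewrite /p -em mulfK ?gt_eqF// /d addrC subrK.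
rewrite /= p0 pn -em in tele.
have ia : a <= a <= b by rewrite lexx ltW.
have ib : a <= b <= b by rewrite lexx andbT ltW.
have key : `|psi b - psi a| <= Num.sqrt W * Num.sqrt m *
    (2 / Num.sqrt m + d * Num.sqrt (V - d ^+ 2 / m)^-1).
  (* The two biases cost 2 sqrt W and the chain is of order sqrt (m W), hence the term 2 / sqrt
     m. *)
  have -> : psi b - psi a = (E b - E a) - (E b - psi b) + (E a - psi a) by ring.
  apply: le_trans (ler_normD _ _) _; apply: le_trans (lerD (ler_normB _ _) (bias a ia)) _.
  apply: le_trans (lerD (lerD tele (bias b ib)) (lexx _)) _.
  rewrite le_eqVlt; apply/orP; left; apply/eqP.
  have sm : m = Num.sqrt m ^+ 2 by rewrite sqr_sqrtr ?ltW.
  move: (Num.sqrt (V - _)^-1) => x; rewrite sqrtrV ?(ltW m0)// [X in X * (_ * _)]sm.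
  by field; rewrite gt_eqF// sqrtr_gt0.
rewrite -(real_normK (num_real (psi b - psi a))).
have -> : m * W = (Num.sqrt W * Num.sqrt m) ^+ 2.
  by rewrite exprMn !sqr_sqrtr ?(ltW m0)// mulrC.
by rewrite -exprMn; apply: lerXn2r (key); rewrite nnegrE// (le_trans _ key).
Qed.

End ThermalRatio.

(** * The upper bound *)

Section Calculus.
Context {R : realType}.
Implicit Types (f df : R -> R) (x y a b l C : R).

Lemma has_deriv_ge0_near f x l e : has_deriv_ge0 f x l -> 0 < e ->
  exists2 d, 0 < d & forall y, 0 <= y -> `|y - x| < d ->
    `|f y - f x - l * (y - x)| <= e * `|y - x|.
Proof.
move=> /cvgrPdist_lt h e0; have := h e e0.
rewrite near_withinE => /nbhs_ballP[d d0 hd]; exists d => //= y y0 yd.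
have [->|yx] := eqVneq y x; first by rewrite !subrr mulr0 subrr normr0 mulr0.
have yx0 : y - x != 0 by rewrite subr_eq0.
have yb : ball x d y by rewrite /ball/= distrC.
have /ltW := hd y yb yx y0; rewrite distrC.
rewrite -(ler_pM2r (x := `|y - x|)) ?normr_gt0// -normrM => h'.
apply: le_trans h'; rewrite le_eqVlt; apply/orP; left; apply/eqP; congr `|_|.
by field.
Qed.

Lemma has_deriv_ge0_sub f x l c : has_deriv_ge0 f x l ->
  has_deriv_ge0 (fun y => f y - c * y) x (l - c).
Proof.
move=> h; apply/cvgrPdist_lt => e e0; move/cvgrPdist_lt: h => /(_ e e0).
rewrite !near_withinE; apply: filterS => y hy yx y0.
have := hy yx y0; rewrite (_ : l - c - _ = l - (f y - f x) / (y - x))//.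
by field; rewrite subr_eq0.
Qed.

(* Composing with the norm extends a function on [[0, +oo[] to a continuous one on the line. *)
Lemma deriv_continuous_norm f df : (forall x, 0 <= x -> has_deriv_ge0 f x (df x)) ->
  continuous (fun x => f `|x|).
Proof.
move=> fd x; apply/cvgrPdist_lt => e e0.
have [d d0 hd] := has_deriv_ge0_near (fd _ (normr_ge0 x)) ltr01.
pose c := 1 + `|df `|x| |.
have c0 : 0 < c by rewrite ltr_pwDl.
near=> y.
have yd : `|x - y| < d by near: y; apply: cvgr_dist_lt.
have ye : `|x - y| < e / c by near: y; apply: cvgr_dist_lt => //; exact: divr_gt0.
have nn : `| `|y| - `|x| | <= `|x - y| by rewrite (distrC x); exact: ler_dist_dist.
have h := hd `|y| (normr_ge0 y) (le_lt_trans nn yd).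
set u := `|y| - `|x| in nn h; rewrite distrC.
have -> : f `|y| - f `|x| = (f `|y| - f `|x| - df `|x| * u) + df `|x| * u by ring.
apply: le_lt_trans (ler_normD _ _) _; apply: le_lt_trans (lerD h (lexx _)) _.
rewrite normrM -mulrDl -/c; move: ye; rewrite ltr_pdivlMr// mulrC; apply: le_lt_trans.
by rewrite ler_pM2l.
Unshelve. all: by end_near. Qed.

Lemma deriv_is_derive_norm f df x : (forall x, 0 <= x -> has_deriv_ge0 f x (df x)) ->
  0 < x -> is_derive x 1 (fun x => f `|x|) (df x).
Proof.
move=> fd x0.
have c : h^-1 *: (f `|h *: (1 : R) + x| - f `|x|) @[h --> 0^'] --> df x.
  apply/cvgrPdist_lt => e e0; have e2 : 0 < e / 2 by rewrite divr_gt0.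
  have [d d0 hd] := has_deriv_ge0_near (fd _ (ltW x0)) e2.
  near=> h.
  have h0 : h != 0 by near: h; exact: nbhs_dnbhs_neq.
  have hx : `|h| < x by near: h; exact: dnbhs0_lt.
  have hdl : `|h| < d by near: h; exact: dnbhs0_lt.
  have hx0 : 0 < h + x.
    by move: hx; rewrite ltr_norml => /andP[]; rewrite ltrNl -subr_gt0 opprK addrC.
  rewrite /GRing.scale/= mulr1 (gtr0_norm hx0) (gtr0_norm x0).
  have := hd (h + x) (ltW hx0); rewrite addrK => /(_ hdl) H.
  rewrite distrC (_ : _ - df x = h^-1 * (f (h + x) - f x - df x * h)); last by field.
  rewrite normrM normfV mulrC ltr_pdivrMr ?normr_gt0//; apply: le_lt_trans H _.
  by rewrite ltr_pM2r ?normr_gt0// ltr_pdivrMr// ltr_pMr// ltr1n.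
by apply: DeriveDef; [apply/cvg_ex; exists (df x)|apply: cvg_lim].
Unshelve. all: by end_near. Qed.

Lemma mean_value_ineq f df a b C : (forall x, 0 <= x -> has_deriv_ge0 f x (df x)) ->
  0 <= a -> a <= b -> (forall z, a <= z <= b -> `|df z| <= C) ->
  `|f b - f a| <= C * (b - a).
Proof.
move=> fd a0 ab dC.
have [||c cab e] := @MVT_segment R (fun x => f `|x|) df a b ab.
- move=> x; rewrite in_itv/= => /andP[ax _].
  by apply: deriv_is_derive_norm fd _; exact: le_lt_trans ax.
- exact/continuous_subspaceT/(deriv_continuous_norm fd).
move: e; rewrite (ger0_norm a0) (ger0_norm (le_trans a0 ab)) => ->.
by rewrite normrM (ger0_norm (_ : 0 <= b - a)) ?subr_ge0// ler_wpM2r ?subr_ge0// dC.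
Qed.

Lemma mean_value_dist f df C x y : (forall x, 0 <= x -> has_deriv_ge0 f x (df x)) ->
  0 <= x -> 0 <= y -> (forall z, 0 <= z -> `|z - x| <= `|y - x| -> `|df z| <= C) ->
  `|f y - f x| <= C * `|y - x|.
Proof.
move=> fd x0 y0 h; have [xy|/ltW yx] := leP x y.
  rewrite (ger0_norm (_ : 0 <= y - x)) ?subr_ge0//.
  apply: (mean_value_ineq fd) => // z /andP[xz zy]; apply: h; first exact: le_trans xz.
  by rewrite !ger0_norm ?subr_ge0// lerD2r.
rewrite (distrC y) (ger0_norm (_ : 0 <= x - y)) ?subr_ge0// in h *.
rewrite distrC; apply: (mean_value_ineq fd) => // z /andP[yz zx].
apply: h; first exact: le_trans yz.
by rewrite distrC ger0_norm ?subr_ge0// lerD2l lerN2.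
Qed.

(** Subtracting the linear part leaves a function with derivative at most C |y - x|, to which the
    mean value inequality applies. This gives [C] instead of C / 2, which affects only the
    lower-order term of the risk. *)
Lemma taylor_bound f df ddf C x y :
  (forall x, 0 <= x -> has_deriv_ge0 f x (df x)) ->
  (forall x, 0 <= x -> has_deriv_ge0 df x (ddf x)) ->
  (forall x, 0 <= x -> `|ddf x| <= C) -> 0 <= x -> 0 <= y ->
  `|f y - f x - df x * (y - x)| <= C * (y - x) ^+ 2.
Proof.
move=> fd dfd ddC x0 y0.
have C0 : 0 <= C by apply: le_trans (ddC 0 (lexx _)).
have gd z : 0 <= z -> has_deriv_ge0 (fun y => f y - df x * y) z (df z - df x).
  by move=> z0; exact/has_deriv_ge0_sub/fd.
have := @mean_value_dist _ _ (C * `|y - x|) x y gd x0 y0.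
rewrite (_ : f y - df x * y - _ = f y - f x - df x * (y - x)); last by ring.
rewrite -mulrA -expr2 real_normK ?num_real//; apply => z z0 zx.
apply: le_trans (_ : C * `|z - x| <= _); last by rewrite ler_wpM2l.
by apply: (mean_value_dist dfd) => // u u0 _; exact: ddC.
Qed.

End Calculus.

(** * Central moments of geometric variables and of their sums *)

Section Moments.
Context {R : realType}.
Implicit Types N : R.

Lemma thwS N k : 0 < N -> thw N k.+1 = N / (N + 1) * thw N k.
Proof. by move=> N0; rewrite /thw exprS mulrCA. Qed.

(* Pascal's rule and the geometric weights give [E C(K, j + 1) = N E C(K, j)]. *)
Lemma series_thw_bin N j : 0 < N ->
  series (fun k => thw N k * 'C(k, j)%:R) @ \oo --> N ^+ j.
Proof.
move=> N0; have N1 : 0 < N + 1 by rewrite addr_gt0.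
have r0 : 0 < N / (N + 1) by rewrite divr_gt0.
have T0 i k : 0 <= thw N k * 'C(k, i)%:R by rewrite mulr_ge0// thw_ge0.
have nd i : nondecreasing_seq (series (fun k => thw N k * 'C(k, i)%:R)).
  by apply/nondecreasing_seqP => n; rewrite /series/= big_nat_recr//= lerDl.
elim: j => [|j ih].
  have E : (fun k => thw N k * 'C(k, 0)%:R) = thw N by apply/funext => k; rewrite bin0 mulr1.
  by rewrite E expr0; have [s <-] := rsum_thw N0; exact: series_cvg_rsum.
pose S i := series (fun k => thw N k * 'C(k, i)%:R).
have SS n : S j.+1 n.+1 = N / (N + 1) * (S j.+1 n + S j n).
  rewrite /S /series/= big_nat_recl//= bin0n mulr0 add0r -big_split/= mulr_sumr.
  by apply: eq_bigr => k _; rewrite thwS// binS natrD; ring.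
(* As the partial sums increase, [SS] bounds S_(j+1)(n) by N / (N + 1) times S_(j+1)(n) + S_j(n),
   and this is solved for S_(j+1)(n). The limit then exists and solves the same relation with
   equality. *)
have bd n : S j.+1 n <= N ^+ j.+1.
  have h1 : S j.+1 n <= S j.+1 n.+1 by apply: nd.
  have h2 : S j n <= N ^+ j.
    have := nondecreasing_cvgn_le (nd j) (cvgP _ ih) n.
    by rewrite (cvg_lim (@norm_hausdorff _ _) ih).
  have := ler_wpM2l (ltW N1) h1; have := ler_wpM2l (ltW N0) h2; rewrite SS exprS.
  have -> x : (N + 1) * (N / (N + 1) * x) = N * x by field; rewrite gt_eqF.
  lra.
have cS : cvgn (S j.+1).
  apply: nondecreasing_is_cvgn; first exact: nd.
  by exists (N ^+ j.+1); move=> _ [n _ <-].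
have c1 : S j.+1 n.+1 @[n --> \oo] --> limn (S j.+1) by rewrite (cvg_shiftS (S j.+1)).
have c2 : S j.+1 n.+1 @[n --> \oo] --> N / (N + 1) * (limn (S j.+1) + N ^+ j).
  have -> : (fun n => S j.+1 n.+1) = fun n => N / (N + 1) * (S j.+1 n + S j n).
    by apply/funext.
  by apply: cvgMr; apply: cvgD.
have e := cvg_unique (@norm_hausdorff _ _) c1 c2.
suff -> : N ^+ j.+1 = limn (S j.+1) by [].
move: e; move: (limn _) => L e; have : L * (N + 1) = N * (L + N ^+ j).
  by rewrite {1}e mulrAC divfK// gt_eqF.
by rewrite exprS; lra.
Qed.

Lemma rsum_thw_bin N j : 0 < N ->
  asum (fun k => thw N k * 'C(k, j)%:R) /\ rsum (fun k => thw N k * 'C(k, j)%:R) = N ^+ j.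
Proof.
move=> N0; have c := @series_thw_bin N j N0.
have s : asum (fun k => thw N k * 'C(k, j)%:R).
  apply: asum_series; last by apply/cvg_ex; exists (N ^+ j).
  by move=> k; rewrite mulr_ge0// thw_ge0.
split=> //; have := series_cvg_rsum s => /(cvg_unique _)/(_ c); apply.
exact: norm_hausdorff.
Qed.

Lemma rsum_thw_lin N (c : nat -> R) m (f : nat -> R) : 0 < N ->
  (forall k, f k = \sum_(0 <= i < m) c i * 'C(k, i)%:R) ->
  asum (fun k => thw N k * f k) /\
  rsum (fun k => thw N k * f k) = \sum_(0 <= i < m) c i * N ^+ i.
Proof.
move=> N0 fE.
have e : (fun k => thw N k * f k) =
    fun k => \sum_(0 <= i < m) c i * (thw N k * 'C(k, i)%:R).
  by apply/funext => k; rewrite fE mulr_sumr; apply: eq_bigr => i _; rewrite mulrCA.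
have s i := asumZ (c i) (rsum_thw_bin i N0).1.
rewrite e; split; first exact: asum_sum.
rewrite rsum_sum//; apply: eq_bigr => i _; rewrite rsumZ; last exact: (rsum_thw_bin i N0).1.
by rewrite (rsum_thw_bin i N0).2.
Qed.

Lemma bin_real k : [/\ 'C(k, 1)%:R = k%:R :> R, 'C(k, 2)%:R = k%:R * (k%:R - 1) / 2 :> R,
  'C(k, 3)%:R = k%:R * (k%:R - 1) * (k%:R - 2) / 6 :> R &
  'C(k, 4)%:R = k%:R * (k%:R - 1) * (k%:R - 2) * (k%:R - 3) / 24 :> R].
Proof.
elim: k => [|k [e1 e2 e3 e4]]; first by rewrite !bin0n/= !mul0r.
by split; rewrite ?bin1// binS natrD ?e1 ?e2 ?e3 ?e4 ?bin0 -?natr1; field.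
Qed.

(** The powers (k - N)^j are expanded over the binomials C(k, i), whose means are N^i; the numerals
    in the proof are the coordinates in that basis. *)
Lemma thw_central N : 0 < N ->
  [/\ forall j, (j < 5)%N -> asum (fun k => thw N k * (k%:R - N) ^+ j),
    rsum (fun k => thw N k * (k%:R - N) ^+ 1) = 0,
    rsum (fun k => thw N k * (k%:R - N) ^+ 2) = N * (N + 1) &
    rsum (fun k => thw N k * (k%:R - N) ^+ 4) =
      9 * (N * (N + 1)) ^+ 2 + N * (N + 1)].
Proof.
move=> N0.
have L (c0 c1 c2 c3 c4 : R) (f : nat -> R) :
    (forall k, f k = c0 + c1 * 'C(k, 1)%:R + c2 * 'C(k, 2)%:R +
      c3 * 'C(k, 3)%:R + c4 * 'C(k, 4)%:R) ->
    asum (fun k => thw N k * f k) /\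
    rsum (fun k => thw N k * f k) = c0 + c1 * N + c2 * N ^+ 2 + c3 * N ^+ 3 + c4 * N ^+ 4.
  move=> fE; have [k|s ->] := @rsum_thw_lin N (nth 0 [:: c0; c1; c2; c3; c4]) 5 f N0.
    by rewrite fE unlock/= bin0 mulr1 addr0 !addrA.
  by split=> //; rewrite unlock/= addr0 expr0 mulr1 !addrA.
have [|s0 _] := L 1 0 0 0 0 (fun k => (k%:R - N) ^+ 0); first by move=> k; ring.
have [|s1 e1] := L (- N) 1 0 0 0 (fun k => (k%:R - N) ^+ 1).
  by move=> k; have [-> -> -> ->] := bin_real k; field.
have [|s2 e2] := L (N ^+ 2) (1 - 2 * N) 2 0 0 (fun k => (k%:R - N) ^+ 2).
  by move=> k; have [-> -> -> ->] := bin_real k; field.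
have [|s3 _] := L (- N ^+ 3) (1 - 3 * N + 3 * N ^+ 2) (6 - 6 * N) 6 0 (fun k => (k%:R - N) ^+ 3).
  by move=> k; have [-> -> -> ->] := bin_real k; field.
have [|s4 e4] := L (N ^+ 4) (1 - 4 * N + 6 * N ^+ 2 - 4 * N ^+ 3)
    (14 - 24 * N + 12 * N ^+ 2) (36 - 24 * N) 24 (fun k => (k%:R - N) ^+ 4).
  by move=> k; have [-> -> -> ->] := bin_real k; field.
split; [by do 5?case|rewrite e1; ring|rewrite e2; ring|rewrite e4; ring].
Qed.

Lemma rsum_prod (I J : choiceType) (f : I -> R) (g : J -> R) : asum f -> asum g ->
  asum (fun p : I * J => f p.1 * g p.2) /\
  rsum (fun p : I * J => f p.1 * g p.2) = rsum f * rsum g.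
Proof.
move=> sf sg; have s : asum (fun p : I * J => f p.1 * g p.2).
  apply/csm_real; apply: eq_csm (csm_prod ((csm_real _).1 sf) ((csm_real _).1 sg)) => p.
  by rewrite -rmorphM.
split=> //; rewrite rsum_pair// -rsumZr//; apply: eq_rsum => i /=.
by rewrite rsumZ.
Qed.

Definition ctr N m (k : m.-tuple nat) : R := (sumn k)%:R - m%:R * N.

Lemma ctr_tcons N m (p : nat * m.-tuple nat) :
  ctr N (tcons p) = (p.1%:R - N) + ctr N p.2.
Proof. by rewrite /ctr /= natrD -natr1; ring. Qed.

Lemma tw_moment_step N m j : 0 < N -> (j < 5)%N ->
  (forall i, (i < 5)%N -> asum (fun k : m.-tuple nat => tw N k * ctr N k ^+ i)) ->
  asum (fun k : m.+1.-tuple nat => tw N k * ctr N k ^+ j) /\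
  rsum (fun k : m.+1.-tuple nat => tw N k * ctr N k ^+ j) =
    \sum_(0 <= i < j.+1) 'C(j, i)%:R * (rsum (fun k => thw N k * (k%:R - N) ^+ (j - i)) *
      rsum (fun k : m.-tuple nat => tw N k * ctr N k ^+ i)).
Proof.
move=> N0 j5 s; have [s1 _ _ _] := thw_central N0.
pose g i (p : nat * m.-tuple nat) :=
  (thw N p.1 * (p.1%:R - N) ^+ (j - i)) * (tw N p.2 * ctr N p.2 ^+ i).
have e : (fun k : m.+1.-tuple nat => tw N k * ctr N k ^+ j) \o @tcons m =
    fun p => \sum_(0 <= i < j.+1) 'C(j, i)%:R * g i p.
  apply/funext => p /=; rewrite ctr_tcons exprDn /tw tprod_tcons -/(tw N p.2) mulr_sumr big_mkord.
  by apply: eq_bigr => i _; rewrite /g -mulr_natl; ring.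
have sg i : (i < j.+1)%N -> asum (g i) /\ rsum (g i) =
    rsum (fun k => thw N k * (k%:R - N) ^+ (j - i)) *
    rsum (fun k : m.-tuple nat => tw N k * ctr N k ^+ i).
  move=> ij; apply: rsum_prod; [apply: s1|apply: s].
    by apply: leq_ltn_trans (leq_subr _ _) j5.
  exact: leq_ltn_trans j5.
(* [asum_sum] and [rsum_sum] ask for summability at every index, but the moments are controlled only
   below order 5; hence the extension by 0. *)
pose h i p := if (i < j.+1)%N then 'C(j, i)%:R * g i p else 0.
have sh i : asum (h i).
  have [ij|/negbTE ij] := boolP (i < j.+1)%N.
    by apply: eq_asum (asumZ 'C(j, i)%:R (sg i ij).1) => p; rewrite /h ij.
  by apply: eq_asum (asum0 _) => p; rewrite /h ij.
have e' : (fun p => \sum_(0 <= i < j.+1) 'C(j, i)%:R * g i p) =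
    fun p => \sum_(0 <= i < j.+1) h i p.
  by apply/funext => p; rewrite !big_mkord; apply: eq_bigr => i _; rewrite /h ltn_ord.
split; first by apply/(asum_bij _ (tcons_bij m)); rewrite e e'; exact: asum_sum.
rewrite (rsum_bij _ (tcons_bij m)) e e' rsum_sum// !big_mkord; apply: eq_bigr => i _.
have [si ei] := sg i (ltn_ord i).
by rewrite /h ltn_ord rsumZ// ei.
Qed.

(** The exact fourth moment is m (9 v^2 + v) + 3 m (m - 1) v^2. The constant 12 is crude but stable
    under adding a mode; only the order m^2 matters. *)
Lemma tw_central N m (v := N * (N + 1)) : 0 < N ->
  [/\ forall j, (j < 5)%N -> asum (fun k : m.-tuple nat => tw N k * ctr N k ^+ j),
    rsum (fun k : m.-tuple nat => tw N k * ctr N k ^+ 1) = 0,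
    rsum (fun k : m.-tuple nat => tw N k * ctr N k ^+ 2) = m%:R * v &
    rsum (fun k : m.-tuple nat => tw N k * ctr N k ^+ 4) <= m%:R ^+ 2 * (12 * v ^+ 2 + v)].
Proof.
move=> N0; have v0 : 0 <= v by rewrite mulr_ge0 ?addr_ge0 ?ltW.
have [t1 e1 e2 e4] := thw_central N0; have [st et] := rsum_thw N0.
elim: m => [|m [s f1 f2 f4]].
  have E j : (fun k : 0.-tuple nat => tw N k * ctr N k ^+ j) = fun=> (j == 0%N)%:R.
    apply/funext => k; rewrite tuple0 /tw /tprod big_ord0 mul1r /ctr/= mul0r subrr.
    by rewrite expr0n.
  split => [j _|||]; rewrite E ?rsum0 ?mul0r//; last by rewrite expr0n mul0r.
  by apply: (asum_single (i0 := [tuple])) => k; rewrite tuple0 eqxx.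
have [s0 f0] := rsum_tw m N0.
have F0 : rsum (fun k : m.-tuple nat => tw N k * ctr N k ^+ 0) = 1.
  by rewrite -f0; apply: eq_rsum => k; rewrite expr0 mulr1.
have T0 : rsum (fun k => thw N k * (k%:R - N) ^+ 0) = 1.
  by rewrite -et; apply: eq_rsum => k; rewrite expr0 mulr1.
have S j : (j < 5)%N -> _ := fun j5 => tw_moment_step N0 j5 s.
split => [j j5|||]; first exact: (S j j5).1.
- by rewrite (S 1%N isT).2 unlock/= F0 T0 f1 e1; ring.
- by rewrite (S 2%N isT).2 unlock/= F0 T0 f1 e1 f2 e2 -/v -[m.+1%:R]natr1 bin0 binn; ring.
rewrite (S 4%N isT).2 unlock/= F0 T0 f1 e1 f2 e2 e4 -/v.
rewrite -[m.+1%:R]natr1 !bin0 !bin1 binn (_ : 'C(4, 2) = 6%N)// (_ : 'C(4, 3) = 4%N)//.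
have m0 : 0 <= m%:R :> R by exact: ler0n.
have mv : 0 <= m%:R * v by exact: mulr_ge0.
have mv2 : 0 <= m%:R * v ^+ 2 by rewrite mulr_ge0 ?sqr_ge0.
have v2 := sqr_ge0 v.
move: f4; move: (rsum _) (rsum _) => x y; lra.
Qed.

End Moments.

(** * Rates of order 1 / n for extended reals *)

Section Rate.
Context {R : realType}.
Implicit Types (a b : nat -> \bar R).

(** Convergence of n a_n to [A], phrased so that upper and lower bounds can come from different
    arguments and eventual finiteness is automatic. *)
Definition near_rate (A : R) a := forall e : R, 0 < e ->
  \forall n \near \oo, (((A - e) / n%:R)%:E <= a n <= ((A + e) / n%:R)%:E)%E.

Lemma near_rate_fin A a : near_rate A a -> \forall n \near \oo, a n \is a fin_num.
Proof.
move=> /(_ _ ltr01); apply: filterS => n /andP[a1 a2].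
by rewrite fin_numE -ltNye -ltey (lt_le_trans _ a1) ?ltNyr// (le_lt_trans a2) ?ltry.
Qed.

Lemma near_rate_eq_o_inv (A : R) a b : near_rate A a -> near_rate A b -> eq_o_inv a b.
Proof.
move=> ra rb; have fa := near_rate_fin ra; have fb := near_rate_fin rb.
exists (fun n => fine (a n) - fine (b n)); last first.
  near=> n; have fan : a n \is a fin_num by near: n.
  have fbn : b n \is a fin_num by near: n.
  by rewrite -{1}(fineK fan) -{1}(fineK fbn) -EFinD addrC subrK.
apply/eqoP => e e0; have e2 : 0 < e / 2 by rewrite divr_gt0.
near=> n; have fan : a n \is a fin_num by near: n.
have fbn : b n \is a fin_num by near: n.
have : (((A - e / 2) / n%:R)%:E <= a n <= ((A + e / 2) / n%:R)%:E)%E by near: n; exact: ra.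
have : (((A - e / 2) / n%:R)%:E <= b n <= ((A + e / 2) / n%:R)%:E)%E by near: n; exact: rb.
rewrite -(fineK fan) -(fineK fbn) !lee_fin => /andP[b1 b2] /andP[a1 a2].
rewrite (ger0_norm (_ : 0 <= n%:R^-1)) ?invr_ge0// /= ler_norml.
have h (x : R) : e * x = 2 * (e / 2 * x) by field.
move: a1 a2 b1 b2; rewrite !mulrDl mulNr h; lra.
Unshelve. all: by end_near. Qed.

End Rate.

(** * Risk bounds uniform over K *)

Section Smooth.
Context {R : realType}.
Variables (K : set R) (psi dpsi ddpsi : R -> R) (C b : R).
Hypotheses (Kpos : K `<=` [set N | 0 < N]) (Kb : forall N, K N -> N <= b) (b0 : 0 <= b).
Hypothesis psid : forall x, 0 <= x -> has_deriv_ge0 psi x (dpsi x).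
Hypothesis dpsid : forall x, 0 <= x -> has_deriv_ge0 dpsi x (ddpsi x).
Hypothesis ddC : forall x, 0 <= x -> `|ddpsi x| <= C.

Let g N := dpsi N ^+ 2 * (N * (N + 1)).
Let A := sup [set g N | N in K].

Let C0 : 0 <= C.
Proof. by apply: le_trans (ddC (lexx 0)). Qed.

(** Makes [sup] a genuine least upper bound: [K] is bounded by [b], where |dpsi| is at most |dpsi 0|
    + C b. *)
Lemma has_sup_information : K !=set0 -> has_sup [set g N | N in K].
Proof.
move=> [N KN]; split; first by exists (g N); exists N.
pose L := `|dpsi 0| + C * b.
exists (L ^+ 2 * (b * (b + 1))) => _ [x Kx <-]; rewrite /g.
have x0 : 0 <= x by apply: ltW; exact: Kpos.
have xb := Kb Kx.
have h : `|dpsi x| <= L.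
  have -> : dpsi x = dpsi 0 + (dpsi x - dpsi 0) by ring.
  apply: le_trans (ler_normD _ _) _; rewrite lerD2l.
  apply: le_trans (_ : C * `|x - 0| <= _).
    by apply: (mean_value_dist dpsid) => // z z0 _; exact: ddC.
  by rewrite subr0 ger0_norm// ler_wpM2l.
apply: ler_pM; rewrite ?sqr_ge0 ?mulr_ge0 ?addr_ge0//.
  by rewrite -(real_normK (num_real (dpsi x))) lerXn2r ?nnegrE// (le_trans _ h).
by apply: ler_pM; rewrite ?addr_ge0// lerD2r.
Qed.

Lemma information_le_sup N : K N -> g N <= A.
Proof.
move=> KN; apply: ub_le_sup; last by exists N.
by have [] := has_sup_information (ex_intro _ N KN).
Qed.

(* [(u + v)^2 <= (1 + e) u^2 + (1 + 1/e) v^2] with u the linear term of the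
   Taylor expansion at N and v its remainder. *)
Lemma plugin_sq_error (e x y : R) : 0 < e -> 0 <= x -> 0 <= y ->
  (psi y - psi x) ^+ 2 <= (1 + e) * dpsi x ^+ 2 * (y - x) ^+ 2 +
    (1 + e^-1) * C ^+ 2 * (y - x) ^+ 4.
Proof.
move=> e0 x0 y0; have := taylor_bound psid dpsid ddC x0 y0.
set u := dpsi x * (y - x); set v := psi y - psi x - u => h.
have -> : psi y - psi x = u + v by rewrite /v; ring.
have hv : v ^+ 2 <= C ^+ 2 * (y - x) ^+ 4.
  rewrite (_ : C ^+ 2 * _ = (C * (y - x) ^+ 2) ^+ 2); last by ring.
  by rewrite -(real_normK (num_real v)) lerXn2r ?nnegrE// mulr_ge0 ?sqr_ge0.
have e1 : 0 <= 1 + e^-1 by rewrite addr_ge0// invr_ge0 ltW.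
have h2 : (1 + e^-1) * v ^+ 2 <= (1 + e^-1) * C ^+ 2 * (y - x) ^+ 4.
  by rewrite -[leRHS]mulrA ler_wpM2l.
have -> : (1 + e) * dpsi x ^+ 2 * (y - x) ^+ 2 = (1 + e) * u ^+ 2.
  by rewrite /u; ring.
apply: le_trans (lerD (lexx _) h2).
have : 0 <= e * (u - e^-1 * v) ^+ 2 by rewrite mulr_ge0 ?sqr_ge0 ?ltW.
have -> : e * (u - e^-1 * v) ^+ 2 = e * u ^+ 2 - 2 * u * v + e^-1 * v ^+ 2.
  by field; rewrite gt_eqF.
lra.
Qed.

Lemma plugin_risk_bound m (e N : R) : (0 < m)%N -> 0 < e -> 0 < N ->
  (\esum_(k in [set: m.-tuple nat])
    (tw N k * (psi ((sumn k)%:R / m%:R) - psi N) ^+ 2)%:E <=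
  ((1 + e) * g N / m%:R + (1 + e^-1) * C ^+ 2 *
    (12 * (N * (N + 1)) ^+ 2 + N * (N + 1)) / m%:R ^+ 2)%:E)%E.
Proof.
move=> m0 e0 N0; have M0 : 0 < m%:R :> R by rewrite ltr0n.
have [s _ e2 e4] := @tw_central R N m N0; have s2 := s 2%N isT; have s4 := s 4%N isT.
pose a1 := (1 + e) * dpsi N ^+ 2 / m%:R ^+ 2; pose a2 := (1 + e^-1) * C ^+ 2 / m%:R ^+ 4.
pose h (k : m.-tuple nat) := a1 * (tw N k * ctr N k ^+ 2) + a2 * (tw N k * ctr N k ^+ 4).
have a20 : 0 <= a2.
  apply: divr_ge0; last by rewrite exprn_ge0// ltW.
  by apply: mulr_ge0; [rewrite addr_ge0// invr_ge0 ltW|exact: sqr_ge0].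
have le k : tw N k * (psi ((sumn k)%:R / m%:R) - psi N) ^+ 2 <= h k.
  have y0 : 0 <= (sumn k)%:R / m%:R :> R by rewrite divr_ge0.
  have := ler_wpM2l (tw_ge0 k N0) (plugin_sq_error e0 (ltW N0) y0).
  move=> hk; apply: le_trans hk _; rewrite le_eqVlt; apply/orP; left; apply/eqP.
  have -> : (sumn k)%:R / m%:R - N = ctr N k / m%:R by rewrite /ctr; field; rewrite gt_eqF.
  by rewrite /h /a1 /a2; field; rewrite !gt_eqF.
have t0 k : 0 <= tw N k * (psi ((sumn k)%:R / m%:R) - psi N) ^+ 2.
  by rewrite mulr_ge0 ?tw_ge0 ?sqr_ge0.
have sh : asum h by apply: asumD; exact: asumZ.
have st : asum (fun k : m.-tuple nat => tw N k * (psi ((sumn k)%:R / m%:R) - psi N) ^+ 2).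
  by apply: asum_le sh => k; rewrite ger0_norm.
rewrite -rsum_ge0// lee_fin; apply: le_trans (rsum_le st sh le) _.
rewrite /h rsumD ?rsumZ//; try exact: asumZ.
rewrite e2; apply: le_trans (lerD (lexx _) (ler_wpM2l a20 e4)) _.
rewrite le_eqVlt; apply/orP; left; apply/eqP; rewrite /a1 /a2 /g.
by field; rewrite !gt_eqF.
Qed.

Lemma plugin_worst_bound m (U : modes R m.+2) (e : R)
    (c := C ^+ 2 * (12 * (b * (b + 1)) ^+ 2 + b * (b + 1))) :
  0 < e -> unitary U ->
  (forall z N, 0 < N -> U \o @tpow R m.+2 (rho z N) \o adj U =1
    @tens R m.+2 (rho ((Num.sqrt m.+2%:R)%:C * z) N) (@tpow R m.+1 (thermal N))) ->
  (worst_risk psi K (plugin_meas psi U) <=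
    ((1 + e) * A / m.+1%:R + (1 + e^-1) * c / m.+1%:R ^+ 2)%:E)%E.
Proof.
move=> e0 uU rU; apply: ge_ereal_sup => _ [[z N]/= KN <-].
have N0 : 0 < N := Kpos KN; have Nb := Kb KN.
have M0 : 0 < m.+1%:R :> R by rewrite ltr0n.
have i0 : 0 <= m.+1%:R^-1 :> R by rewrite invr_ge0 ltW.
have i2 : 0 <= m.+1%:R ^- 2 :> R by rewrite invr_ge0 exprn_ge0 ?ltW.
have e1 : 0 <= 1 + e^-1 by rewrite addr_ge0// invr_ge0 ltW.
rewrite (postprocess_risk uU _ rU psi z N0).
apply: le_trans (plugin_risk_bound (ltn0Sn m) e0 N0) _; rewrite lee_fin.
have v0 : 0 <= N * (N + 1) by rewrite mulr_ge0 ?addr_ge0 ?ltW.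
have vb : N * (N + 1) <= b * (b + 1).
  by apply: ler_pM; rewrite ?addr_ge0 ?lerD2r ?(ltW N0).
apply: lerD.
  by rewrite ler_wpM2r// ler_wpM2l ?addr_ge0 ?(ltW e0)//; exact: information_le_sup.
apply: ler_wpM2r => //; rewrite /c [leRHS]mulrA.
apply: ler_wpM2l; first by rewrite mulr_ge0 ?sqr_ge0.
by rewrite lerD// ler_wpM2l// lerXn2r ?nnegrE// (le_trans v0).
Qed.

Lemma information_ge0 : K !=set0 -> 0 <= A.
Proof.
move=> [N KN]; apply: le_trans (information_le_sup KN).
have N0 : 0 < N := Kpos KN.
by rewrite /g mulr_ge0 ?sqr_ge0// mulr_ge0 ?addr_ge0 ?ltW.
Qed.

Lemma plugin_upper e : K !=set0 -> 0 < e -> exists n0, forall m (U : modes R m.+2), (n0 <= m)%N ->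
  unitary U ->
  (forall z N, 0 < N -> U \o @tpow R m.+2 (rho z N) \o adj U =1
    @tens R m.+2 (rho ((Num.sqrt m.+2%:R)%:C * z) N) (@tpow R m.+1 (thermal N))) ->
  (worst_risk psi K (plugin_meas psi U) <= ((A + e) / m.+2%:R)%:E)%E.
Proof.
move=> Kne e0; have A0 := information_ge0 Kne.
pose c := C ^+ 2 * (12 * (b * (b + 1)) ^+ 2 + b * (b + 1)).
have c0 : 0 <= c.
  have v0 : 0 <= b * (b + 1) by rewrite mulr_ge0 ?addr_ge0.
  by rewrite mulr_ge0 ?sqr_ge0// addr_ge0// mulr_ge0 ?sqr_ge0.
(* Half of [e] pays for the factor 1 + d; the summand 1 covers A = 0. *)
pose d := e / (2 * (A + 1)).
have A1 : 0 < A + 1 by rewrite ltr_wpDl.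
have d0 : 0 < d by rewrite divr_gt0// mulr_gt0.
have dA : d * A <= e / 2.
  have -> : e / 2 = d * (A + 1) by rewrite /d; field; rewrite gt_eqF.
  by rewrite ler_wpM2l ?lerDl// ltW.
pose k := (1 + d^-1) * c.
have k0 : 0 <= k by rewrite mulr_ge0// addr_ge0// invr_ge0 ltW.
(* The other half of [e] pays for D / (m + 1), which bounds the fourth-moment remainder together
   with the passage from m + 1 to m + 2 in the denominator. *)
pose D := (1 + d) * A + 2 * k.

exists (Num.truncn (2 * D / e)).+1 => m U nm uU rU.
apply: le_trans (plugin_worst_bound d0 uU rU) _; rewrite lee_fin -/c -/k.
have Dm : 2 * D / e <= m.+1%:R.
  apply: ltW; apply: lt_le_trans (truncnS_gt _) _.
  by rewrite ler_nat; exact: leqW.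
have M0 : 0 < m.+1%:R :> R by rewrite ltr0n.
have M1 : 1 <= m.+1%:R :> R by rewrite ler1n.
rewrite -[m.+2%:R]natr1; move: (m.+1%:R) Dm M0 M1 => x Dm M0 M1.
rewrite ler_pdivlMr ?addr_gt0//.
have -> : ((1 + d) * A / x + k / x ^+ 2) * (x + 1) =
    (1 + d) * A + ((1 + d) * A + k + k / x) / x by field; rewrite gt_eqF.
have kx : k / x <= k by rewrite ler_pdivrMr// ler_peMr.
have h : ((1 + d) * A + k + k / x) / x <= e / 2.
  rewrite ler_pdivrMr//; apply: (@le_trans _ _ D); first by rewrite /D; lra.
  by move: Dm; rewrite ler_pdivrMr//; lra.
by lra.
Qed.

Lemma information_continuous (N : R) :
  dpsi `|x| ^+ 2 * (x * (x + 1)) @[x --> N] --> dpsi `|N| ^+ 2 * (N * (N + 1)).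
Proof.
have dc := deriv_continuous_norm dpsid (x := N).
apply: cvgM; first by apply: cvgM.
by apply: cvgM; [exact: cvg_id|apply: cvgD; [exact: cvg_id|exact: cvg_cst]].
Qed.

(** The supremum is nearly reached at some point of [K]. Since [K] is the closure of its interior,
    continuity moves that point to an interior one, [a]; a short interval to its right stays in [K]
    and has a difference quotient close to [dpsi a]. *)
Lemma near_optimal_slope e : K !=set0 -> K = closure K° -> 0 < e ->
  exists a y, [/\ 0 < a, a < y, forall N, a <= N <= y -> K N &
    A - e < (psi y - psi a) ^+ 2 / (y - a) ^+ 2 * (a * (a + 1))].
Proof.
move=> Kne Kreg e0; have e4 : 0 < e / 2 by rewrite divr_gt0.
have e8 : 0 < e / 2 / 2 by rewrite divr_gt0.
have [_ [N0 KN0 <-] gN0] := sup_adherent e8 (has_sup_information Kne).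
have N00 : 0 < N0 := Kpos KN0.
have : closure K° N0 by rewrite -Kreg.
have ct := @information_continuous N0.
have gN0' : A - e / 2 < dpsi `|N0| ^+ 2 * (N0 * (N0 + 1)).
  by rewrite (gtr0_norm N00); apply: le_lt_trans gN0; rewrite -/A; lra.
have nb : \forall x \near N0, A - e / 2 < dpsi `|x| ^+ 2 * (x * (x + 1)).
  by apply: (cvgr_gt _ ct).
move=> /(_ _ nb) [a [Ka ga]].
have a0 : 0 < a by apply: Kpos; exact: interior_subset Ka.
move: ga => /=; rewrite (gtr0_norm a0) => ga.
pose l := dpsi a; pose V := a * (a + 1).
have V0 : 0 < V by rewrite mulr_gt0 ?addr_gt0.
(* Chosen to make |l| d V at most e / 4; the summand 1 covers l = 0. *)
pose d := e / (4 * (`|l| + 1) * V).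
have l1 : 0 < `|l| + 1 by rewrite ltr_wpDl.
have d0 : 0 < d by apply: divr_gt0 => //; do 2!apply: mulr_gt0 => //.
have [r r0 hr] := has_deriv_ge0_near (psid (ltW a0)) d0.
move: Ka => /nbhs_ballP[r' /= r'0 hr'].
pose y := a + Num.min r r' / 2.
have mr0 : 0 < Num.min r r' by rewrite lt_min r0.
have ay : a < y by rewrite ltrDl divr_gt0.
have ya : y - a < Num.min r r' by rewrite /y addrAC subrr add0r ltr_pdivrMr// ltr_pMr// ltr1n.
exists a, y; split=> //.
  move=> N /andP[aN Ny]; apply: hr'; rewrite /ball/= distrC ger0_norm ?subr_ge0//.
  apply: le_lt_trans (_ : y - a < r'); first by rewrite lerD2r.
  by apply: lt_le_trans ya _; rewrite ge_min lexx orbT.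
have y0 : 0 < y - a by rewrite subr_gt0.
have yr : `|y - a| < r.
  by rewrite gtr0_norm//; apply: lt_le_trans ya _; rewrite ge_min lexx.
have := hr y (ltW (lt_trans a0 ay)) yr; rewrite (gtr0_norm y0) -/l.
pose s := (psi y - psi a) / (y - a).
have -> : psi y - psi a = s * (y - a) by rewrite /s divfK// gt_eqF.
rewrite -mulrBl normrM (gtr0_norm y0) ler_pM2r// => sl.
have -> : (s * (y - a)) ^+ 2 / (y - a) ^+ 2 * V = s ^+ 2 * V by field; rewrite gt_eqF.
apply: lt_le_trans (_ : A - e < l ^+ 2 * V - e / 2) _.
  by move: ga; rewrite -/l -/V; lra.
have ls : `|l| * `|s - l| * V <= e / 4.
  apply: le_trans (_ : `|l| * d * V <= _); first by rewrite ler_wpM2r ?ler_wpM2l// ltW.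
  rewrite /d (_ : _ * _ * V = e / 4 * (`|l| / (`|l| + 1))); last by field; rewrite !gt_eqF.
  by rewrite ler_piMr ?divr_ge0 ?(ltW e0)// ler_pdivrMr// mul1r lerDl.
have h2 : - (`|l| * `|s - l|) <= l * (s - l) by rewrite -normrM lerNl -normrN ler_norm.
have h3 : - (`|l| * `|s - l| * V) <= l * (s - l) * V by rewrite -mulNr ler_wpM2r// ltW.
have h4 : 0 <= (s - l) ^+ 2 * V by rewrite mulr_ge0 ?sqr_ge0 ?ltW.
have -> : s ^+ 2 * V = l ^+ 2 * V + 2 * (l * (s - l) * V) + (s - l) ^+ 2 * V by ring.
by lra.
Qed.

(** In terms of x = 1 / n the factor in [increment_bound] is F x, continuous at 0 with F 0 = d^2 /
    V. A worst risk W below (A - e) / n would give (psi y - psi a)^2 <= (A - e) F (1 / n), against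
    the choice of the slope for large n. *)
Lemma minimax_lower e : K !=set0 -> K = closure K° -> 0 < e ->
  \forall n \near \oo, forall M : set R -> modes R n, povm M ->
    (((A - e) / n%:R)%:E <= worst_risk psi K M)%E.
Proof.
move=> Kne Kreg e0; have [a [y [a0 ay Kay hA]]] := near_optimal_slope Kne Kreg e0.
pose V := a * (a + 1); pose d := y - a.
have V0 : 0 < V by rewrite mulr_gt0 ?addr_gt0.
have d0 : 0 < d by rewrite subr_gt0.
pose F (x : R) := (2 * Num.sqrt x + d * Num.sqrt (V - d ^+ 2 * x)^-1) ^+ 2.
have cF : F x @[x --> (0 : R)] --> F 0.
  have sq0 : Num.sqrt x @[x --> (0 : R)] --> Num.sqrt (0 : R) by exact: sqrt_continuous.
  have cV : V - d ^+ 2 * x @[x --> (0 : R)] --> V - d ^+ 2 * 0.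
    by apply: cvgB; [exact: cvg_cst|apply: cvgM; [exact: cvg_cst|exact: cvg_id]].
  have ciV : (V - d ^+ 2 * x)^-1 @[x --> (0 : R)] --> (V - d ^+ 2 * 0)^-1.
    by apply: cvgV cV; rewrite mulr0 subr0 gt_eqF.
  have csV : Num.sqrt (V - d ^+ 2 * x)^-1 @[x --> (0 : R)] --> Num.sqrt (V - d ^+ 2 * 0)^-1.
    exact: (cvg_comp _ _ ciV (@sqrt_continuous _ _)).
  by apply: cvgM; apply: cvgD; apply: cvgM => //; exact: cvg_cst.
have F0 : F 0 = d ^+ 2 / V.
  by rewrite /F sqrtr0 !mulr0 add0r subr0 exprMn sqr_sqrtr ?invr_ge0 ?ltW.
have lt0 : (A - e) * F 0 < (psi y - psi a) ^+ 2.
  have dV0 : 0 < d ^+ 2 / V by rewrite divr_gt0 ?exprn_gt0.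
  move: hA; rewrite -/d -/V -(ltr_pM2r dV0) F0.
  by rewrite (_ : _ * V * _ = (psi y - psi a) ^+ 2)//; field; rewrite !gt_eqF.
have cA : (A - e) * F x @[x --> (0 : R)] --> (A - e) * F 0 by apply: cvgM => //; exact: cvg_cst.
have n1 : \forall x \near (0 : R), (A - e) * F x < (psi y - psi a) ^+ 2.
  by apply: (cvgr_lt _ cA).
have n2 : \forall x \near (0 : R), d ^+ 2 * x < V.
  have cd : d ^+ 2 * x @[x --> (0 : R)] --> d ^+ 2 * 0.
    by apply: cvgM; [exact: cvg_cst|exact: cvg_id].
  by apply: (cvgr_lt _ cd); rewrite mulr0.
have ch := @cvg_harmonic R; have {}n1 := ch _ n1; have {}n2 := ch _ n2.
apply: near_inftyS; near=> n => M pM.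
have h1 : (A - e) * F n.+1%:R^-1 < (psi y - psi a) ^+ 2 by near: n; exact: n1.
have h2 : d ^+ 2 * n.+1%:R^-1 < V by near: n; exact: n2.
rewrite leNgt; apply/negP => /ltW hW.
have [f hf] := mean_sq_risk pM Kpos Kne hW.
have dV : (y - a) ^+ 2 < n.+1%:R * (a * (a + 1)).
  by rewrite mulrC -ltr_pdivrMr ?ltr0n.
have := increment_bound a0 ay dV (fun N aN => hf N (Kay N aN)).
rewrite [n.+1%:R * _]mulrC divfK ?pnatr_eq0// -sqrtrV ?ler0n// leNgt => /negP; apply.
exact: h1.
Unshelve. all: by end_near. Qed.

End Smooth.

(** * Assembling the two bounds into the asymptotic risk *)

Section Main.
Context {R : realType}.

Lemma residual_existence m : exists U : modes R m.+2, unitary U /\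
  forall z N, 0 < N -> U \o @tpow R m.+2 (rho z N) \o adj U =1
    @tens R m.+2 (rho ((Num.sqrt m.+2%:R)%:C * z) N) (@tpow R m.+1 (thermal N)).
Proof.
exists (@mixU R m.+1 (@reflection R m)); split.
  by apply: mixU_unitary; [exact: reflection_sym|exact: reflection_invol].
move=> z N N0; apply: mixU_rho => //.
- exact: reflection_sym.
- exact: reflection_invol.
- exact: reflection_row.
Qed.

(** A / n <= (A + e) / (n + 1) amounts to A <= e n, hence the threshold A / e. *)
Lemma sharp_rate (A : R) : 0 <= A -> near_rate A (fun n => (n.-1%:R^-1 * A)%:E).
Proof.
move=> A0 e e0; apply: near_inftyS; near=> n.
have nn : ((Num.truncn (A / e)).+1 <= n)%N by near: n; exact: nbhs_infty_ge.
rewrite /= !lee_fin -natr1.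
have n0 : 0 < n%:R :> R by rewrite ltr0n; case: (n) nn.
have An : A <= e * n%:R.
  rewrite -ler_pdivrMl// mulrC; apply: ltW; apply: lt_le_trans (truncnS_gt _) _.
  by rewrite ler_nat.
move: (n%:R) n0 An => x x0 An; have x1 : 0 < x + 1 by rewrite addr_gt0.
have -> : x^-1 * A = A * (x + 1) / x / (x + 1) by field; rewrite !gt_eqF.
have h : (A - e) * x <= A * (x + 1) <= (A + e) * x by apply/andP; split; nra.
by rewrite !ler_pM2r ?invr_gt0// ler_pdivlMr// ler_pdivrMr.
Unshelve. all: by end_near. Qed.

End Main.

Theorem theorem6p10 (R : realType) (K : set R) (psi dpsi ddpsi : R -> R)
    (Kpos : K `<=` [set N | 0 < N]) (Kne : K !=set0) (Kcpt : compact K)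
    (Kreg : K = closure K°)
    (psi_dpsi : forall x, 0 <= x -> has_deriv_ge0 psi x (dpsi x))
    (dpsi_ddpsi : forall x, 0 <= x -> has_deriv_ge0 dpsi x (ddpsi x))
    (ddpsi_cont : {within `[0, +oo[, continuous ddpsi})
    (ddpsi_bnd : exists c : R, forall x, 0 <= x -> `|ddpsi x| <= c) :
  eq_o_inv (minimax_risk psi K)
    (fun n => (n.-1%:R^-1 *
               sup [set dpsi N ^+ 2 * (N * (N + 1)) | N in K])%:E) /\
  forall U : forall n : nat, op R (n.-tuple nat),
    (forall n, (2 <= n)%N -> residual_unitary (U n)) ->
    eq_o_inv (fun n => worst_risk psi K (plugin_meas psi (U n)))
      (minimax_risk psi K).
Proof.
have [C ddC] := ddpsi_bnd.
have [b [b0 Kb]] : exists b : R, 0 <= b /\ forall N, K N -> N <= b.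
  have /pinfty_ex_gt0[b b0 hb] := compact_bounded Kcpt.
  by exists b; split=> [|N KN]; [exact: ltW|exact: le_trans (ler_norm _) (hb N KN)].
set A := sup _; have A0 : 0 <= A := information_ge0 Kpos Kb dpsi_ddpsi ddC Kne.
have lower e : 0 < e -> \forall n \near \oo, forall M : set R -> modes R n, povm M ->
    (((A - e) / n%:R)%:E <= worst_risk psi K M)%E.
  exact: (minimax_lower Kpos Kb psi_dpsi dpsi_ddpsi ddC Kne Kreg).
have upper e : 0 < e -> exists n0, forall m (U : modes R m.+2), (n0 <= m)%N ->
    unitary U -> _ := plugin_upper Kpos Kb b0 psi_dpsi dpsi_ddpsi ddC Kne.
have minimax_le m (U : modes R m.+2) : unitary U ->
    (minimax_risk psi K m.+2 <= worst_risk psi K (plugin_meas psi U))%E.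
  move=> uU; apply: ereal_inf_lbound; exists (plugin_meas psi U) => //.
  exact: postprocess_povm.
have rate_minimax : near_rate A (minimax_risk psi K).
  move=> e e0; have [n0 up] := upper e e0; have low := lower e e0.
  near=> n; apply/andP; split.
    have h : forall M : set R -> modes R n, povm M ->
      (((A - e) / n%:R)%:E <= worst_risk psi K M)%E by near: n.
    by apply: le_ereal_inf_tmp => _ [M pM <-]; exact: h.
  have : (n0.+2 <= n)%N by near: n; exact: nbhs_infty_ge.
  move: (n) => [|[|m]]// nm; have [U [uU rU]] := residual_existence (R := R) m.
  exact: le_trans (minimax_le m U uU) (up m U nm uU rU).
split; first by apply: near_rate_eq_o_inv rate_minimax _; exact: sharp_rate.
(* The plug-in is itself a POVM, so the lower bound applies to it and its worst risk has the same
   rate [A] as the minimax risk. *)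
move=> U hU; apply: (near_rate_eq_o_inv (A := A)) rate_minimax => e e0.
have [n0 up] := upper e e0; have low := lower e e0.
near=> n; apply/andP; split.
  have n2 : (2 <= n)%N by near: n; exact: nbhs_infty_ge.
  have h : forall M : set R -> modes R n, povm M ->
    (((A - e) / n%:R)%:E <= worst_risk psi K M)%E by near: n.
  apply: h; move: (n) n2 => [|[|m]]// n2.
  by have [uU _ _ _] := hU m.+2 isT; exact: postprocess_povm.
have : (n0.+2 <= n)%N by near: n; exact: nbhs_infty_ge.
move: (n) => [|[|m]]// nm; have [uU _ rU _] := hU m.+2 isT.
exact: up.
Unshelve. all: by end_near. Qed.
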